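(* Let $k$ be a fixed positive integer (not depending on $n$). For each $n$, let $P_n$ be a positive integer and $\mathcal{D}=\mathcal{D}_n$ a probability distribution on $\{1,2,\ldots,P_n\}$, and consider the general random intersection graph $G(n,P_n,\mathcal{D})$. Let $X$ be a random variable with distribution $\mathcal{D}$, and define the sequence $\alpha_n$ by $$\frac{\{\mathbb{E}[X]\}^2}{P_n}=\frac{\ln n+(k-1)\ln\ln n+\alpha_n}{n}.$$ If $\mathbb{E}[X]=\Omega(\sqrt{\ln n})$, $\mathrm{Var}[X]=o\!\left(\frac{\{\mathbb{E}[X]\}^2}{n(\ln n)^2}\right)$ and $|\alpha_n|=o(\ln n)$, then $$\lim_{n\to\infty}\mathbb{P}[G(n,P_n,\mathcal{D})\text{ is }k\text{-connected}]=\begin{cases}0,&\text{if }\lim_{n\to\infty}\alpha_n=-\infty,\\ 1,&\text{if }\lim_{n\to\infty}\alpha_n=\infty,\\ e^{-\frac{e^{-\alpha^*}}{(k-1)!}},&\text{if }\lim_{n\to\infty}\alpha_n=\alpha^*\in(-\infty,\infty).\end{cases}$$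
   Context: General random intersection graph $G(n,P_n,\mathcal{D})$: on nodes $v_1,\ldots,v_n$ and an object pool of $P_n$ distinct objects, each node $v_i$ independently receives an object set $S_i$ constructed as follows: first $|S_i|$ is drawn from $\mathcal{D}$, then, conditionally on $|S_i|=s_i$, $S_i$ is a uniformly random $s_i$-element subset of the pool. Distinct nodes $v_i,v_j$ are adjacent iff $S_i\cap S_j\neq\emptyset$. A graph is $k$-connected if every pair of nodes is joined by at least $k$ internally node-disjoint paths (equivalently it cannot be disconnected by deleting at most $k-1$ nodes). All limits and asymptotic notation ($o,O,\Omega,\omega,\sim$) are as $n\to\infty$. *)

(* Defs.v *)
From HB Require Import structures.
From mathcomp Require Import all_boot all_order all_algebra.
From mathcomp Require Import all_classical all_reals all_analysis.

Set Implicit Arguments.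
Unset Strict Implicit.
Unset Printing Implicit Defensive.

Import Order.TTheory GRing.Theory Num.Theory.
Import numFieldNormedType.Exports.

Local Open Scope classical_set_scope.
Local Open Scope ring_scope.

(* A path from u to v is given by the sequence q of its internal nodes. *)
Definition internal_path (T : finType) (e : rel T) (u v : T) (q : seq T) : bool :=
  path e u (rcons q v) && uniq (u :: rcons q v).

(* The condition q i != q j matters only for the one-edge path, whose sequence
   of internal nodes is empty: an edge {u, v} counts as a single path. *)
Definition k_connected (k : nat) (T : finType) (e : rel T) : Prop :=
  forall u v : T, u != v ->
  exists q : 'I_k -> seq T,
    (forall i, internal_path e u v (q i)) /\
    (forall i j, i != j -> q i != q j /\ ~~ has (mem (q i)) (q j)).

Definition intersection_graph (n m : nat) (S : 'I_n -> {set 'I_m}) : rel 'I_n :=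
  fun i j => (i != j) && (S i :&: S j != finset.set0).

(* S assigns to each of n nodes a random subset of a pool of m objects.
   - Independence: taking B i = setT for the nodes outside a subfamily gives the
     product rule for that subfamily.
   - Uniformity: the conditional probability Pr[S i = A | #|S i| = s], multiplied
     out so that it needs no restriction to sizes s of positive probability. *)
Record random_object_sets (R : realType) (d : measure_display)
    (Omega : measurableType d) (Pr : probability Omega R) (n m : nat)
    (D : probability nat R) (S : 'I_n -> Omega -> {set 'I_m}) : Prop := {
  ros_measurable : forall i (A : {set 'I_m}),
    measurable [set w | S i w = A] ;
  ros_independent : forall B : 'I_n -> set {set 'I_m},
    Pr [set w | forall i, B i (S i w)] =
      (\prod_(i < n) Pr [set w | B i (S i w)])%E ;
  ros_size : forall i (s : nat),
    Pr [set w | #|S i w| = s] = D [set s] ;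
  ros_uniform : forall i (s : nat) (A : {set 'I_m}), #|A| = s ->
    Pr [set w | S i w = A] =
      (Pr [set w | #|S i w| = s] * (('C(m, s))%:R^-1)%:E)%E
}.

(* Mean and variance of a nat-valued random variable with distribution D; they
   are finite when D has bounded support, so that fine loses nothing. *)
Definition mean (R : realType) (D : probability nat R) : R :=
  fine ('E_D[fun x : nat => x%:R])%E.

Definition var (R : realType) (D : probability nat R) : R :=
  fine ('V_D[fun x : nat => x%:R])%E.

(* Main.v *)
(** Idea.  A vertex of degree less than [k] is asymptotically the only
    obstruction to [k]-connectivity.

    By Chebyshev, the variance hypothesis lets us condition all set sizes to lie
    in [(1 -+ eps) E[X]] with [eps ln n -> 0], at a total variation cost that
    tends to 0.  A vertex then meets a given set with probability
    [1 - exp (- |U| E[X] / P)] up to negligible errors, and the probability that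
    [r] given vertices all have degree less than [k] is asymptotic to
    [(lam / n) ^ r], where [lam = exp (- alpha) / (k - 1)!]: the families whose
    [r] sets are disjoint give the main term and the others are negligible.
    Hence, by Bonferroni, the number of such vertices is asymptotically Poisson
    when [alpha] converges; the infinite cases use first and second moments.

    If all degrees are at least [k] but the graph is not [k]-connected, then by
    Menger's theorem (obtained here from Hall's theorem) some set [W] of fewer
    than [k] vertices separates a connected set [A], [2 <= |A|], from at least
    [|A|] other vertices.  With high probability every set [A] of moderate size
    has almost [|A| E[X]] objects, so that each vertex outside [A] and [W]
    avoids [A] with exponentially small probability.  Summing over the
    enumerations of [A] that make it grow connected when [A] is small, over all
    subsets when it is large, shows that such a separation has vanishing
    probability. *)
Require Import Defs.
From HB Require Import structures.
From mathcomp Require Import all_boot all_order all_algebra.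
From mathcomp Require Import zify.

(** The size window has to be as narrow as [eps ln n -> 0] because a vertex has low degree with
    probability [exp (- n E[X]^2 / P)], up to powers of [ln n], and this exponent, of order [ln n],
    must be known up to [o(1)]. The probability estimates are proved for an arbitrary law [mu] on
    sets and an arbitrary finite vertex set, as inequalities between finite sums; limits come in
    only at the end. Constants of the separation argument: a union of [a] sets of size about [K]
    keeps at least 3/4 of the [a K] objects, since the last quarter is what beats the number of
    choices of a smaller union. So a set of [a] vertices is avoided by nearly all [n] vertices with
    probability about [n^(-3a/4)], and by half of them with probability about [n^(-3a/8)]. Connected
    enumerations then contribute about [n (a n^(-3/4))^a], small for [a] below [n^(3/4)]; all
    subsets contribute about [(n / a)^a n^(-3a/8)], small for [a] above [n^(5/8)]. The threshold
    [n^(11/16)] is the midpoint of these exponents. *)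

Set Implicit Arguments.
Unset Strict Implicit.
Unset Printing Implicit Defensive.

(** * Hall's marriage theorem *)

Section Hall.
Variable T : finType.
Implicit Types (r : rel T) (A X Y : {set T}).

Definition rel_image r X : {set T} := [set y | [exists x in X, r x y]].

Lemma rel_imageP r X y :
  reflect (exists2 x, x \in X & r x y) (y \in rel_image r X).
Proof. by rewrite inE; apply: exists_inP. Qed.

(** Induction on [#|A|], with [r] general because used partners are deleted from the relation. If a
    proper nonempty [X] is tight, it is matched first, and the rest keeps Hall's condition outside
    [rel_image r X]. Otherwise every proper nonempty part has a neighbour to spare, so any partner
    for a first vertex is harmless. *)
Lemma hall_marriage r A :
  (forall X, X \subset A -> #|X| <= #|rel_image r X|) ->
  exists2 f : T -> T, {in A &, injective f} & {in A, forall x, r x (f x)}.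
Proof.
have [m] := ubnP #|A|; elim: m r A => // m IHm r A leAm hallA.
have [->|[x xA]] := set_0Vmem A.
  by exists id => [x y|x]; rewrite inE.
have [/existsP[X /and4P[XA X0 XnA leX]]|] :=
    boolP [exists X : {set T}, [&& X \subset A, X != set0, X != A
             & #|rel_image r X| <= #|X|]].
- have ltXA : #|X| < #|A| by apply: proper_card; rewrite properEneq XnA.
  have [||f fI fr] := IHm r X.
  + by apply: leq_trans ltXA _.
  + by move=> Y YX; apply: hallA; apply: subset_trans XA.
  pose r' := [rel a b | r a b && (b \notin rel_image r X)].
  have [||g gI gr] := IHm r' (A :\: X).
  + apply: leq_trans (_ : #|A| <= m) => //.
    apply: proper_card; rewrite properE subsetDl.
    apply/subsetPn; have [y yX] := set0Pn _ X0.
    by exists y; [apply: (subsetP XA)|rewrite inE yX].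
  + move=> Y YAX.
    have YX : [disjoint X & Y].
      apply/pred0P => y /=; apply/negP => /andP[yX yY].
      by have := subsetP YAX _ yY; rewrite inE yX.
    have := hallA (X :|: Y) _.
    rewrite subUset XA (subset_trans YAX) ?subsetDl // => /(_ isT).
    rewrite cardsU disjoint_setI0 // cards0 subn0 => leXY.
    have : rel_image r (X :|: Y) \subset rel_image r X :|: rel_image r' Y.
      apply/subsetP => b /rel_imageP[a /setUP[aX|aY] rab]; rewrite inE.
        by apply/orP; left; apply/rel_imageP; exists a.
      case: (boolP (b \in rel_image r X)) => //= bX.
      by apply/rel_imageP; exists a => //=; rewrite rab bX.
    move=> /subset_leq_card; rewrite cardsU; lia.
  exists (fun a => if a \in X then f a else g a) => [a b aA bA|a aA].
  + have fg c e : c \in X -> e \in A -> e \notin X -> f c != g e.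
      move=> cX eA eX; apply/eqP => E.
      have /andP[_ /negP[]] : r' e (g e) by apply: gr; rewrite inE eX.
      by rewrite -E; apply/rel_imageP; exists c; rewrite ?fr.
    case: ifPn => aX; case: ifPn => bX; first exact: fI.
    * by move=> /eqP; rewrite (negPf (fg _ _ _ _ _)).
    * by move=> /eqP; rewrite eq_sym (negPf (fg _ _ _ _ _)).
    * by apply: gI; rewrite inE ?aX ?bX.
  + case: ifPn => aX; first exact: fr.
    by have /andP[] : r' a (g a) by apply: gr; rewrite inE aX.
- rewrite negb_exists => /forallP nX.
  have slack X : X \subset A -> X != set0 -> X != A -> #|X| < #|rel_image r X|.
    by move=> XA X0 XnA; have := nX X; rewrite XA X0 XnA /= -ltnNge.
  have : 0 < #|rel_image r [set x]|.
    by apply: leq_trans (hallA _ _); rewrite ?cards1 ?sub1set.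
  rewrite card_gt0 => /set0Pn[y /rel_imageP[_ /set1P-> rxy]].
  pose r' := [rel a b | r a b && (b != y)].
  have [||f fI fr] := IHm r' (A :\ x).
  + by move: leAm; rewrite (cardsD1 x A) xA.
  + move=> X XA; have [->|X0] := eqVneq X set0; first by rewrite cards0.
    have := slack X (subset_trans XA (subsetDl _ _)) X0 _.
    have -> : X != A.
      by apply/eqP => E; have := subsetP XA x; rewrite E xA setD11 => /(_ isT).
    move=> /(_ isT).
    have : rel_image r X \subset y |: rel_image r' X.
      apply/subsetP => b /rel_imageP[a aX rab]; rewrite !inE.
      case: (eqVneq b y) => //= bX.
      by apply/exists_inP; exists a => //=; rewrite rab bX.
    move=> /subset_leq_card; rewrite cardsU1; lia.
  have fy a : a \in A -> a != x -> f a != y.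
    by move=> aA ax; have /andP[] : r' a (f a) by apply: fr; rewrite !inE ax.
  exists (fun a => if a == x then y else f a) => [a b aA bA|a aA].
  + case: eqVneq => [->|ax]; case: eqVneq => [->|bx] //.
    * by move=> /eqP; rewrite eq_sym (negPf (fy _ _ _)).
    * by move=> /eqP; rewrite (negPf (fy _ _ _)).
    * by apply: fI; rewrite !inE ?ax ?bx.
  + case: eqVneq => [->//|ax].
    by have /andP[] : r' a (f a) by apply: fr; rewrite !inE ax.
Qed.

End Hall.

(** * Menger's theorem *)

Lemma path_map_iota (T : eqType) (e : rel T) (node : nat -> T) m n :
  (forall s, m <= s < m + n -> e (node s) (node s.+1)) ->
  path e (node m) (map node (iota m.+1 n)).
Proof.
elim: n m => //= n IH m en; rewrite en ?leqnn ?addnS ?leq_addr //=.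
by apply: IH => s /andP[ms sn]; apply: en; rewrite (ltnW ms) addnS -addSn.
Qed.

Definition vertex_cut (T : finType) (e : rel T) (A W : {set T}) : bool :=
  [&& A != set0, [disjoint A & W], A :|: W != setT &
      [forall x in A, forall y, e x y ==> (y \in A :|: W)]].

Section Menger.
Variables (T : finType) (e : rel T) (k : nat).
Hypotheses (e_sym : symmetric e) (eirr : irreflexive e) (ltkT : k < #|T|).
Hypothesis uncut : forall A W, vertex_cut e A W -> k <= #|W|.

Section TwoVertices.
Variables u v : T.
Hypothesis uv : u != v.

(* A perfect matching of this bipartite graph is a permutation whose cycles
   through the copies [inr i] of the two ends are the disjoint paths. *)
Let step (x y : T + 'I_k) : bool :=
  match x, y with
  | inl a, inl b => (a == b) ||
      [&& a \notin [set u; v], b \notin [set u; v] & e a b]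
  | inl a, inr _ => (a \notin [set u; v]) && e a v
  | inr _, inl b => (b \notin [set u; v]) && e u b
  (* Only copy 0 may return to itself at once, so that the edge from [u] to [v] serves as a path at
     most once. *)
  | inr i, inr j => [&& i == 0 :> nat, j == 0 :> nat & e u v]
  end.

(** If [u] and [v] are not adjacent, [C] cuts [u |: Y] off from [v]. If they are, one end has to
    join the separator, [v] when [Y] is empty and [u] otherwise; this extra vertex is why [h < k] is
    required in that case. *)
Let cut_bound (Y : {set T}) (h : nat) (C := rel_image e (u |: Y) :\: (u |: (v |: Y))) :
  u \notin Y -> v \notin Y -> (forall a, a \in Y -> ~~ e a v) ->
  h <= k -> (e u v -> h < k) -> h <= #|C|.
Proof.
move=> uY vY Yv hk huv; rewrite leqNgt; apply/negP => ltC.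
have nbrC x y : x \in u |: Y -> e x y -> y \in [set u; v] :|: (Y :|: C).
  move=> xuY exy; rewrite !inE -!orbA.
  case: eqVneq => //= yu; case: eqVneq => //= yv; case: (boolP (y \in Y)) => //= yY.
  by apply/exists_inP; exists x.
have uC : u \notin C by rewrite !inE eqxx.
have vC : v \notin C by rewrite !inE eqxx ?orbT.
case: (boolP (e u v)) => [euv|neuv]; last first.
  suff /uncut : vertex_cut e (u |: Y) C by rewrite leqNgt (leq_trans ltC hk).
  apply/and4P; split.
  - by apply/set0Pn; exists u; rewrite setU11.
  - by apply/pred0P => x /=; rewrite !inE; case: (x == u); case: (x \in Y); rewrite ?orbT ?andbF.
  - apply/eqP => /setP/(_ v); rewrite in_setU (negPf vC) !inE (negPf vY) eq_sym.
    by rewrite (negPf uv).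
  - apply/forall_inP => x xA; apply/forallP => y; apply/implyP => exy.
    have := nbrC _ _ xA exy; rewrite in_setU in_set2 -!orbA => /or3P[/eqP->|/eqP E|].
    + by rewrite in_setU setU11.
    + move: exy; rewrite E; case/setU1P: xA => [->|/Yv]; by rewrite ?(negPf neuv) // => /negPf->.
    + by rewrite !in_setU orbC => /orP[->|->]; rewrite ?orbT.
have {huv} hk1 : #|C|.+1 < k by have := huv euv; lia.
have [Y0|Y0] := eqVneq Y set0.
  suff /uncut : vertex_cut e [set u] (v |: C) by rewrite cardsU1 vC; lia.
  apply/and4P; split.
  - by apply/set0Pn; exists u; rewrite set11.
  - by rewrite disjoints1 in_setU1 (negPf uv).
  (* By [ltkT], a vertex remains outside [u], [v] and [C], which have at most [k] elements
     together. *)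
  - apply/eqP => /(congr1 (fun S : {set T} => #|S|)); rewrite cardsT => E.
    have [+ _] := leq_card_setU [set u] (v |: C).
    by rewrite E cards1 cardsU1 vC; move: ltkT hk1; rewrite /C; lia.
  - apply/forall_inP => x /set1P->; apply/forallP => y; apply/implyP => exy.
    have := nbrC _ _ (setU11 _ _) exy.
    by rewrite Y0 set0U setUA.
suff /uncut : vertex_cut e Y (u |: C) by rewrite cardsU1 uC; lia.
apply/and4P; split => //.
- apply/pred0P => x /=; apply/negP => /andP[xY]; rewrite !inE xY !orbT andFb orbF.
  by move=> /eqP E; rewrite -E xY in uY.
- apply/eqP => /setP/(_ v); rewrite !in_setU (negPf vC) (negPf vY) !inE eq_sym.
  by rewrite (negPf uv).
- apply/forall_inP => x xA; apply/forallP => y; apply/implyP => exy.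
  have := nbrC _ _ (setU1r _ xA) exy; rewrite in_setU in_set2 -!orbA => /or3P[/eqP->|/eqP E|].
  + by rewrite in_setU setU11 orbT.
  + by move: exy; rewrite E (negPf (Yv _ xA)).
  + by rewrite !in_setU => /orP[->|->]; rewrite ?orbT.
Qed.

(** The loops at the vertices put [X0] in the image, so only [#|X1|] further elements are needed. If
    some vertex of [Y] is adjacent to [v], all copies are reached; otherwise the set [C] of
    [cut_bound] is. When [u] and [v] are adjacent and copy 0 is in [X1], its return to itself
    supplies the one element that [cut_bound] cannot give. *)
Let step_hall (X : {set T + 'I_k}) : #|X| <= #|rel_image step X|.
Proof.
pose X0 := [set a | inl a \in X]; pose X1 := [set i : 'I_k | inr i \in X].
have split_card (Z : {set T + 'I_k}) :
    #|Z| = #|[set a | inl a \in Z]| + #|[set i : 'I_k | inr i \in Z]|.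
  have {1}-> : Z = (inl @: [set a | inl a \in Z]) :|: (inr @: [set i | inr i \in Z]).
    apply/setP => -[a|i]; rewrite inE.
      rewrite mem_imset ?inE; last by move=> ? ? [].
      by rewrite orbC; case: imsetP => // -[].
    rewrite orbC mem_imset ?inE; last by move=> ? ? [].
    by rewrite orbC; case: imsetP => // -[].
  rewrite cardsU disjoint_setI0; last first.
    by apply/pred0P => -[a|i] /=; apply/negP => /andP[] /imsetP[? _] // -> /imsetP[].
  by rewrite cards0 subn0 !card_imset //; move=> ? ? [].
have X0sub : X0 \subset [set a | inl a \in rel_image step X].
  apply/subsetP => a; rewrite !inE => aX.
  by apply/exists_inP; exists (inl a) => //=; rewrite eqxx.
rewrite (split_card X) (split_card (rel_image _ _)).
pose Y := X0 :\: [set u; v].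
have [/exists_inP[a aY eav]|] := boolP [exists a in Y, e a v].
  apply: leq_add; first exact: subset_leq_card.
  apply: subset_leq_card; apply/subsetP => i _; rewrite !inE.
  move: aY; rewrite inE => /andP[auv]; rewrite inE => aX.
  by apply/exists_inP; exists (inl a) => //=; rewrite auv.
rewrite negb_exists_in => /forall_inP Yv.
have [X10|[i0 i0X]] := set_0Vmem X1.
  by rewrite -/X1 X10 cards0 addn0 (leq_trans (subset_leq_card X0sub)) // leq_addr.
pose C := rel_image e (u |: Y) :\: (u |: (v |: Y)).
have uY : u \notin Y by rewrite !inE eqxx.
have vY : v \notin Y by rewrite !inE eqxx orbT.
have X0C : #|X0| + #|C| <= #|[set a | inl a \in rel_image step X]|.
  have disj : X0 :&: C = set0.
    apply/setP => x; rewrite !inE.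
    by case: (inl x \in X); case: (x == u); case: (x == v); rewrite ?andbF.
  have <- : #|X0 :|: C| = #|X0| + #|C| by rewrite cardsU disj cards0 subn0.
  apply: subset_leq_card; rewrite subUset X0sub /=.
  apply/subsetP => b /setDP[/rel_imageP[a aA eab]].
  rewrite in_setU1 in_setU1 !negb_or => /and3P[bu bv bY]; rewrite inE.
  have buv : b \notin [set u; v] by rewrite in_set2 negb_or bu.
  apply/rel_imageP; case/setU1P: aA => [E|/setDP[aX auv]].
    exists (inr i0); first by move: i0X; rewrite inE.
    by rewrite /step buv -E.
  exists (inl a); first by move: aX; rewrite inE.
  by rewrite /step auv buv eab orbT.
have X1k : #|X1| <= k by rewrite (leq_trans (max_card _)) ?card_ord.
suff : #|X1| <= #|C| + #|[set i : 'I_k | inr i \in rel_image step X]|.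
  move=> X1C; apply: leq_trans (leq_add X0C (leqnn _)).
  by rewrite -addnA leq_add2l.
have [euv|neuv] := boolP (e u v); last first.
  by rewrite (leq_trans (cut_bound uY vY Yv X1k _)) ?leq_addr // => euv; rewrite euv in neuv.
have [/exists_inP[i iX /eqP i_0]|] := boolP [exists i in X1, i == 0 :> nat].
  apply: leq_trans (_ : #|C| + 1 <= _); last first.
    rewrite leq_add2l card_gt0; apply/set0Pn; exists i; rewrite inE.
    apply/rel_imageP; exists (inr i); first by move: iX; rewrite inE.
    by rewrite /step i_0 euv.
  have k0 : 0 < k := leq_trans (isT : 0 < i.+1) (ltn_ord i).
  rewrite -[X in X <= _](@subnK 1); last by rewrite card_gt0; apply/set0Pn; exists i.
  by rewrite leq_add2r; apply: (cut_bound uY vY Yv) => // [|_]; lia.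
rewrite negb_exists_in => /forall_inP nX1.
rewrite (leq_trans (cut_bound uY vY Yv X1k _)) ?leq_addr // => _.
have k0 : 0 < k := leq_trans (isT : 0 < i0.+1) (ltn_ord i0).
rewrite -[X in _ < X](card_ord k); apply: proper_card; apply/properP; split.
  by apply/subsetP.
by exists (Ordinal k0) => //; apply/negP => /nX1; rewrite eqxx.
Qed.

(** The matching [f] is injective on a finite type, hence a permutation. [q i] lists the [N i]
    vertices met on the orbit of [inr i] before its first return to a copy; vertices on no path lie
    on cycles that avoid the copies, mostly loops. *)
Lemma menger_pair : exists q : 'I_k -> seq T,
  (forall i, internal_path e u v (q i)) /\
  (forall i j, i != j -> q i != q j /\ ~~ has (mem (q i)) (q j)).
Proof.
have [f fI0 fr0] := @hall_marriage _ step setT (fun X _ => step_hall X).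
have fI : injective f by move=> x y; apply: fI0.
have fr x : step x (f x) by apply: fr0.
pose back (i : 'I_k) s := if iter s.+1 f (inr i) is inr _ then true else false.
have ex_back i : exists s, back i s.
  exists (fingraph.order f (inr i)).-1; rewrite /back prednK ?order_gt0 //.
  by rewrite iter_order.
pose N i := ex_minn (ex_back i).
have N_back i : exists j, iter (N i).+1 f (inr i) = inr j.
  rewrite /N; case: ex_minnP => m; rewrite /back; case: (iter _ _ _) => // j _ _.
  by exists j.
have N_inl i s : s < N i -> exists w, iter s.+1 f (inr i) = inl w.
  rewrite /N; case: ex_minnP => m _ mmin sm.
  case E : (iter s.+1 f (inr i)) => [w|j]; first by exists w.
  have : back i s by rewrite /back E.
  by move=> /mmin; rewrite leqNgt sm.
pose node i s := match iter s f (inr i) with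
  inl w => w | inr _ => if s == 0 then u else v end.
pose q i := map (node i) (iota 1 (N i)).
have nodeE i s : s < N i -> iter s.+1 f (inr i) = inl (node i s.+1).
  by move=> /N_inl[w]; rewrite /node => ->.
have node0 i : node i 0 = u by [].
have nodeN i : node i (N i).+1 = v by rewrite /node; case: (N_back i) => j ->.
have node_in i s : s < N i -> node i s.+1 \notin [set u; v].
  elim: s => [|s IH] sN.
    by have := fr (inr i); have /= -> := nodeE i 0 sN; case/andP.
  have := fr (iter s.+1 f (inr i)); rewrite -iterS nodeE; last exact: ltnW.
  rewrite (nodeE i s.+1) //; case/orP => [/eqP <-|/and3P[]//].
  by apply: IH; apply: ltnW.
have iterI n : injective (iter n f) by elim: n => [|n IH] // x y /fI/IH.
(* Two orbits that meet can be run backwards by injectivity; the one that is ahead would then be at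
   a copy before its first return. *)
have iter_eq i j s s' : s <= s' -> s' < N j ->
    iter s.+1 f (inr i) = iter s'.+1 f (inr j) -> i = j /\ s = s'.
  move=> ss' s'N; rewrite -(subnKC ss') -addSn iterD => /(iterI s.+1 _ _).
  case E : (s' - s) => [|t] /=; first by case=> ->; split=> //; rewrite addn0.
  have [|w] := N_inl j t; first by lia.
  by rewrite /= => ->.
have node_inj i : {in iota 0 (N i).+2 &, injective (node i)}.
  suff lt_ne s s' : s < s' -> s' < (N i).+2 -> node i s != node i s'.
    move=> s s'; rewrite !mem_iota !add0n => /andP[_ sN] /andP[_ s'N] E.
    case: (ltngtP s s') => // ss'; [have := lt_ne s s' ss' s'N|have := lt_ne s' s ss' sN];
    by rewrite E eqxx.
  case: s s' => [|s] [//|s'] ss' s'N; rewrite ?node0.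
    have [->|s'i] := eqVneq s' (N i); first by rewrite nodeN.
    have := @node_in i s'; have -> : s' < N i by lia.
    by move=> /(_ isT); rewrite in_set2 negb_or eq_sym => /andP[].
  have sN : s < N i by lia.
  have [->|s'i] := eqVneq s' (N i).
    by rewrite nodeN; have := node_in i s sN; rewrite in_set2 negb_or => /andP[].
  have s'N' : s' < N i by lia.
  apply/eqP => E; have := nodeE i s sN; rewrite E -(nodeE i s' s'N').
  move=> /iter_eq []; rewrite ?(ltnW ss') //; lia.
have full i : u :: rcons (q i) v = map (node i) (iota 0 (N i).+2).
  rewrite -[(N i).+2]addn1 iotaD map_cat /= add0n nodeN /= node0 cats1.
  by rewrite /q.
exists q; split=> [i|i j ij].
  apply/andP; split; last first.
    by rewrite full map_inj_in_uniq ?iota_uniq //; apply: node_inj.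
  have -> : rcons (q i) v = map (node i) (iota 1 (N i).+1).
    by case: (full i).
  rewrite -(node0 i); apply: path_map_iota => s; rewrite add0n /= => sN.
  case: s sN => [|s] sN.
    have := fr (inr i); rewrite node0.
    have [N0|Npos] := posnP (N i).
      have := nodeN i; have := N_back i; rewrite N0 /= => -[j ->] ->.
      by case/and3P.
    by have /= -> := nodeE i 0 Npos; case/andP.
  have sN' : s < N i by [].
  have := fr (iter s.+1 f (inr i)); rewrite -iterS nodeE //.
  have [E|s1N] := eqVneq s.+1 (N i).
    by have [j] := N_back i; rewrite E nodeN => ->; case/andP.
  rewrite (nodeE i s.+1) /=; last by lia.
  case/orP => [/eqP/node_inj|/and3P[]//].
  by rewrite !mem_iota => /(_ _ _)-H; have := H _ _; lia.
have disj : ~~ has (mem (q i)) (q j).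
  apply/hasPn => x /mapP[s]; rewrite mem_iota add1n => /andP[]; case: s => // s _ sN ->.
  apply/negP => /mapP[s']; rewrite mem_iota add1n => /andP[]; case: s' => // s' _ s'N E.
  have E' : iter s.+1 f (inr j) = iter s'.+1 f (inr i).
    by rewrite !nodeE // E.
  case: (leqP s s') => ss'; first by have [] := iter_eq _ _ _ _ ss' s'N E' => E2; rewrite E2 eqxx in ij.
  by have [] := iter_eq _ _ _ _ (ltnW ss') sN (esym E') => E2; rewrite E2 eqxx in ij.
(* Disjoint lists can be equal only if both are empty, and an empty list is the edge, which is
   reserved to copy 0. *)
split=> //; apply/eqP => E.
have q_nil l : q l = [::] -> l = 0 :> nat.
  move=> /(congr1 size); rewrite size_map size_iota => Nl.
  have [l'] := N_back l; have := fr (inr l); rewrite Nl /= => + El.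
  by rewrite El => /and3P[/eqP].
move: disj; rewrite -E; case Eq : (q i) => [|x s]; last by rewrite /= inE eqxx.
have i0 := q_nil _ Eq; have j0 : j = 0 :> nat by apply: q_nil; rewrite -E.
by move: ij; rewrite -val_eqE /= i0 j0.
Qed.

End TwoVertices.

Lemma menger : k_connected k e.
Proof. by move=> u v; apply: menger_pair. Qed.

End Menger.

From mathcomp Require Import boolp.

(** * Degrees and minimal separations *)

Definition nbrs (T : finType) (e : rel T) (u : T) : {set T} := [set w | e u w].

(** The first steps of the [k] paths from [u] to any other vertex are distinct neighbours of [u]:
    internal nodes are disjoint, [v] is internal to no path, and at most one path is the edge
    itself. *)
Lemma k_connected_degree (T : finType) (e : rel T) (k : nat) (u : T) :
  1 < #|T| -> k_connected k e -> k <= #|nbrs e u|.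
Proof.
move=> T1 kc.
have [v uv] : exists v, u != v.
  apply/existsP; rewrite -negb_forall; apply/negP => /forallP uE.
  have : #|T| <= #|[set u]|.
    by rewrite -cardsT; apply/subset_leq_card/subsetP => x _; rewrite inE eq_sym.
  by rewrite cards1 leqNgt T1.
have [q [qp qd]] := kc u v uv.
pose fst (i : 'I_k) := head v (q i).
have fst_nbr i : fst i \in nbrs e u.
  by have := qp i; rewrite /internal_path /fst inE; case: (q i) => [|x s] /=; case/andP => /andP[].
have v_q i : v \notin q i.
  have /andP[_] := qp i; rewrite /= => /andP[_]; rewrite rcons_uniq.
  by case/andP.
have fstI : injective fst.
  move=> i j; rewrite /fst => E; apply/eqP/negPn/negP => /qd[qij /hasPn dj].
  have vi := v_q i; have vj := v_q j.
  case Ei : (q i) E qij dj vi => [|x s]; case Ej : (q j) vj => [|y t] //= vj E qij dj vi.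
  - by rewrite E inE eqxx in vj.
  - by rewrite -E inE eqxx in vi.
  - by have := dj y; rewrite !inE -E eqxx => /(_ isT).
rewrite -[k in k <= _]card_ord -(card_imset _ fstI).
by apply/subset_leq_card/subsetP => _ /imsetP[i _ ->].
Qed.

(** New entries are put at the head, so the enumeration starts with the last entry of the list; each
    new one is adjacent to an earlier one. *)
Fixpoint growing (T : eqType) (e : rel T) (s : seq T) : bool :=
  if s is x :: s' then growing e s' && ((s' == [::]) || has (e x) s') else true.

Section Separation.
Variables (T : finType) (e : rel T) (k : nat).
Hypotheses (e_sym : symmetric e) (e_irr : irreflexive e) (ltkT : k < #|T|).

Lemma vertex_cutP (A W : {set T}) : reflect [/\ A != set0, [disjoint A & W], A :|: W != setT &
   forall x y, x \in A -> e x y -> y \in A :|: W] (vertex_cut e A W).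
Proof.
apply: (iffP and4P) => -[A0 AW AWT cl]; split=> //.
  by move=> x y xA exy; apply: (implyP (forallP (forall_inP cl x xA) y)).
by apply/forall_inP => x xA; apply/forallP => y; apply/implyP; apply: cl.
Qed.

Lemma vertex_cutC (A W : {set T}) : vertex_cut e A W -> vertex_cut e (~: (A :|: W)) W.
Proof.
case/vertex_cutP => A0 /pred0P AW AWT cl; apply/vertex_cutP; split.
- by apply: contra AWT => /eqP E; rewrite -(setCK (A :|: W)) E setC0.
- by apply/pred0P => x /=; rewrite !inE; case: (x \in W); rewrite ?orbT ?andbF.
- have [x xA] := set0Pn _ A0; apply/eqP => /setP/(_ x).
  by have := AW x; rewrite /= !inE xA /= => ->.
- move=> x y; rewrite !inE negb_or => /andP[xA xW] exy.
  case yW : (y \in W); rewrite ?orbT //= !orbF; apply/negP => yA.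
  by have := cl y x yA; rewrite e_sym exy !inE (negPf xA) (negPf xW) => /(_ isT).
Qed.

(** Take a cut [(A, W)] with [#|W| < k] and [#|A|] least. The far side with the same [W] is also a
    cut, hence at least as large as [A]; and a growing enumeration cannot stop inside [A]. If [A] is
    a single vertex, its neighbours all lie in [W]. *)
Lemma minimal_separation : ~ k_connected k e ->
  (exists v, #|nbrs e v| < k) \/
  exists (s : seq T) (W : {set T}), let A := [set x in s] in
    [/\ [/\ uniq s, growing e s & 1 < size s],
        #|W| < k /\ [disjoint A & W],
        (forall w, w \in W -> exists2 a, a \in A & e w a),
        (forall x y, x \in A -> y \notin A :|: W -> ~~ e x y) &
        size s <= #|~: (A :|: W)|].
Proof.
move=> nkc.
pose bad (p : {set T} * {set T}) := vertex_cut e p.1 p.2 && (#|p.2| < k).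
have [p0 p0bad] : exists p, bad p.
  apply/existsP; apply: contrapT => /negP; rewrite negb_exists => /forallP nbad.
  apply: nkc; apply: menger => // A W AW.
  by have := nbad (A, W); rewrite /bad /= AW /= -leqNgt.
have [[A W] /andP[/= AW Wk] Amin] := arg_minnP (fun p : {set T} * {set T} => #|p.1|) p0bad.
have AB : #|A| <= #|~: (A :|: W)|.
  by apply: (Amin (_, W)); rewrite /bad /= vertex_cutC.
case/vertex_cutP: (AW) => A0 AdW AWT cl.
(* A proper part of [A] without edges to the rest of [A] would be a smaller
   set cut off by [W]. *)
have grow m : m < #|A| -> exists s : seq T,
    [/\ uniq s, size s = m.+1, {subset s <= A} & growing e s].
  elim: m => [|m IH] mA.
    have [x xA] := set0Pn _ A0; exists [:: x]; split=> // y.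
    by rewrite inE => /eqP->.
  have [s [su ss sA sg]] := IH (ltnW mA).
  have [/exists_inP[x /setDP[xA]]|] := boolP [exists x in A :\: [set x in s], has (e x) s].
    rewrite inE => xs xe; exists (x :: s); split=> //=.
    - by rewrite xs.
    - by rewrite ss.
    - by move=> y; rewrite inE => /predU1P[->|/sA].
    - by rewrite sg xe orbT.
  rewrite negb_exists_in => /forall_inP ne.
  have cs : #|[set x in s]| = m.+1 by rewrite cardsE (card_uniqP su).
  suff /(Amin (_, W)) : bad ([set x in s], W) by rewrite /= cs leqNgt mA.
  rewrite /bad Wk andbT /=; apply/vertex_cutP; split.
  - by rewrite -card_gt0 cs.
  - apply/pred0P => x /=; rewrite inE; apply/negP => /andP[/sA xA xW].
    by have /pred0P/(_ x) := AdW; rewrite /= xA xW.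
  - apply: contra AWT; rewrite -!subTset => /subset_trans-> //.
    by apply: setSU; apply/subsetP => x; rewrite inE => /sA.
  - move=> x y; rewrite inE => xs exy; rewrite !inE.
    have := cl x y (sA x xs) exy; rewrite inE => /orP[yA|->]; last by rewrite orbT.
    case: (boolP (y \in s)) => //= ys.
    have := ne y; rewrite !inE ys yA => /(_ isT)/hasPn/(_ x xs).
    by rewrite e_sym exy.
have [m mA] : exists m, #|A| = m.+1 by exists #|A|.-1; rewrite prednK ?card_gt0.
have [|s [su ss sA sg]] := grow m; first by rewrite mA.
have As : [set x in s] = A.
  apply/eqP; rewrite eqEcard cardsE (card_uniqP su) ss mA leqnn andbT.
  by apply/subsetP => x; rewrite inE => /sA.
have [m0|m0] := posnP m.
  left; rewrite m0 in ss; case: s su ss sA sg As => [|x [|//]] // _ _ _ _ Ax.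
  exists x; apply: leq_ltn_trans Wk; apply/subset_leq_card/subsetP => y.
  rewrite inE => exy; have xA : x \in A by rewrite -Ax !inE.
  have := cl x y xA exy; rewrite in_setU -Ax !inE => /orP[/eqP yx|//].
  by rewrite yx e_irr in exy.
(* Dropping from [W] the vertices without neighbour in [A] keeps the separation, and makes each
   remaining one contribute the probability of meeting [A] in the union bound. *)
right; exists s, [set w in W | [exists a in A, e w a]].
rewrite /= As; split=> //.
- by rewrite ss.
- split; last by apply: disjointWr AdW; apply/subsetP => x; rewrite inE => /andP[].
  apply: leq_ltn_trans Wk; apply/subset_leq_card/subsetP => x.
  by rewrite inE => /andP[].
- by move=> w; rewrite inE => /andP[_ /exists_inP[a aA wa]]; exists a.
- move=> x y xA; rewrite !inE negb_or negb_and => /andP[yA /orP[yW|nyA]].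
    apply/negP => /(cl x y xA); by rewrite inE (negPf yA) (negPf yW).
  apply: contra nyA => exy; apply/exists_inP; exists x => //.
  by rewrite e_sym.
- rewrite ss -mA (leq_trans AB) //; apply/subset_leq_card.
  rewrite setCS; apply: setUS; apply/subsetP => x.
  by rewrite inE => /andP[].
Qed.

End Separation.

From mathcomp Require Import ring lra.

Import Order.TTheory GRing.Theory Num.Theory.
Local Open Scope ring_scope.

(** * Expectations over independent coordinates of law [mu] *)

Section ProductExpectation.
Variables (R : realFieldType) (T : finType) (mu : T -> R) (I : finType).
Implicit Types (f : {ffun I -> T}) (F G : {ffun I -> T} -> R).

Definition Ex F : R := \sum_(f : {ffun I -> T}) (\prod_i mu (f i)) * F f.

Lemma eq_Ex F G : F =1 G -> Ex F = Ex G.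
Proof. by move=> FG; apply: eq_bigr => f _; rewrite FG. Qed.

Lemma ExD F G : Ex (fun f => F f + G f) = Ex F + Ex G.
Proof. by rewrite -big_split; apply: eq_bigr => f _; rewrite mulrDr. Qed.

Lemma ExZ c F : Ex (fun f => c * F f) = c * Ex F.
Proof. by rewrite mulr_sumr; apply: eq_bigr => f _; rewrite mulrCA. Qed.

Lemma ExZr c F : Ex (fun f => F f * c) = Ex F * c.
Proof. by rewrite mulr_suml; apply: eq_bigr => f _; rewrite mulrA. Qed.

Lemma ExB F G : Ex (fun f => F f - G f) = Ex F - Ex G.
Proof. by rewrite -sumrB; apply: eq_bigr => f _; rewrite mulrBr. Qed.

Lemma Ex_sum (J : Type) (r : seq J) (P : pred J) (F : J -> {ffun I -> T} -> R) :
  Ex (fun f => \sum_(j <- r | P j) F j f) = \sum_(j <- r | P j) Ex (F j).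
Proof. by rewrite exchange_big; apply: eq_bigr => f _; rewrite mulr_sumr. Qed.

Lemma Ex_prod (g : I -> T -> R) :
  Ex (fun f => \prod_i g i (f i)) = \prod_i \sum_y mu y * g i y.
Proof.
by rewrite bigA_distr_bigA; apply: eq_bigr => f _; rewrite -big_split.
Qed.

Hypothesis mu_ge0 : forall y, 0 <= mu y.

(** Only families in the support of [mu] are compared; this is how the bounds on the set sizes
    enter. *)
Lemma Ex_le F G : (forall f, (forall i, 0 < mu (f i)) -> F f <= G f) -> Ex F <= Ex G.
Proof.
move=> FG; apply: ler_sum => f _.
have [/forallP f0|] := boolP [forall i, 0 < mu (f i)].
  by apply: ler_wpM2l; [apply: prodr_ge0 => i _|apply: FG].
rewrite negb_forall => /existsP[i]; rewrite lt_neqAle mu_ge0 andbT negbK => /eqP fi.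
by rewrite (bigD1 i) //= -fi !mul0r.
Qed.

Lemma Ex_ge0 F : (forall f, 0 <= F f) -> 0 <= Ex F.
Proof.
by move=> F0; apply: sumr_ge0 => f _; rewrite mulr_ge0 ?prodr_ge0.
Qed.

Hypothesis mu_sum1 : \sum_y mu y = 1.

Lemma Ex_cst c : Ex (fun=> c) = c.
Proof.
rewrite /Ex -mulr_suml -(bigA_distr_bigA (fun _ => mu)).
by rewrite big1 ?mul1r // => i _.
Qed.

Definition depends_on (A : {set I}) (X : Type) (F : {ffun I -> T} -> X) :=
  forall f g : {ffun I -> T}, {in A, f =1 g} -> F f = F g.

(** Conditioning on the coordinates in [A]: the others remain independent of law [mu], so a product
    with one factor for each of them may be replaced by the product of means, even though the
    factors depend on what happens in [A]. The proof groups the families by their restriction to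
    [A]. *)
Lemma Ex_resample (A : {set I}) F (G : I -> {ffun I -> T} -> T -> R) :
  depends_on A F -> (forall j y, depends_on A (fun f => G j f y)) ->
  Ex (fun f => F f * \prod_(j | j \notin A) G j f (f j)) =
  Ex (fun f => F f * \prod_(j | j \notin A) \sum_y mu y * G j f y).
Proof.
move=> FA GA.
pose restr f := [ffun i => if i \in A then Some (f i) else None].
have restrE f f0 : (restr f == restr f0) = [forall i in A, f i == f0 i].
  apply/eqP/forall_inP => [/ffunP E i iA|E].
    by have := E i; rewrite !ffunE iA => -[->].
  by apply/ffunP => i; rewrite !ffunE; case: ifPn => // /E/eqP->.
rewrite /Ex (partition_big restr predT) //= [RHS](partition_big restr predT) //=.
apply: eq_bigr => x _.
have [[f0 /eqP <-]|nx] := pselect (exists f0, restr f0 == x); last first.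
  by rewrite !big_pred0 // => f; apply/negP => fx; apply: nx; exists f.
have step (H : I -> T -> R) :
    \sum_(f | restr f == restr f0) (\prod_i mu (f i)) *
       (F f0 * \prod_(j | j \notin A) H j (f j)) =
    F f0 * ((\prod_(i in A) mu (f0 i)) * \prod_(j | j \notin A) \sum_y mu y * H j y).
  pose K i y := mu y * (if i \in A then (y == f0 i)%:R else H i y).
  transitivity (F f0 * \sum_(f : {ffun I -> T}) \prod_i K i (f i)).
    rewrite mulr_sumr [RHS](bigID (fun f => restr f == restr f0)) /=.
    rewrite [X in _ + X]big1 ?addr0 => [|f].
      apply: eq_bigr => f; rewrite restrE => /forall_inP E.
      rewrite mulrCA; congr (_ * _); rewrite /K big_split /=; congr (_ * _).
      rewrite [RHS](bigID (mem A)) /= [X in _ = X * _]big1 ?mul1r.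
        by apply: eq_bigr => i /negPf->.
      by move=> i iA; rewrite iA E.
    rewrite restrE negb_forall_in => /exists_inP[i iA /negPf ne].
    by rewrite (bigD1 i) //= /K iA ne mulr0 mul0r mulr0.
  congr (_ * _); rewrite -(bigA_distr_bigA K) (bigID (mem A)) /=; congr (_ * _).
    apply: eq_bigr => i iA; rewrite /K iA (bigD1 (f0 i)) //= eqxx mulr1 big1 ?addr0 //.
    by move=> y /negPf->; rewrite mulr0.
  by apply: eq_bigr => i /negPf iA; apply: eq_bigr => y _; rewrite /K iA.
transitivity (\sum_(f | restr f == restr f0) (\prod_i mu (f i)) *
       (F f0 * \prod_(j | j \notin A) G j f0 (f j))).
  apply: eq_bigr => f; rewrite restrE => /forall_inP E.
  have E' : {in A, f =1 f0} by move=> i /E/eqP.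
  rewrite (FA _ _ E'); congr (_ * (_ * _)); apply: eq_bigr => j _.
  by rewrite (GA j (f j) _ _ E').
rewrite (step (fun j => G j f0)).
transitivity (\sum_(f | restr f == restr f0) (\prod_i mu (f i)) *
       (F f0 * \prod_(j | j \notin A) \sum_y mu y * G j f0 y)).
  rewrite (step (fun j _ => \sum_y mu y * G j f0 y)); congr (_ * (_ * _)).
  by apply: eq_bigr => j _; rewrite -mulr_suml mu_sum1 mul1r.
apply: eq_bigr => f; rewrite restrE => /forall_inP E.
have E' : {in A, f =1 f0} by move=> i /E/eqP.
rewrite (FA _ _ E'); congr (_ * (_ * _)); apply: eq_bigr => j _.
by apply: eq_bigr => y _; rewrite (GA j y _ _ E').
Qed.

Lemma Ex_resample1 (A : {set I}) F i (G : {ffun I -> T} -> T -> R) : i \notin A ->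
  depends_on A F -> (forall y, depends_on A (fun f => G f y)) ->
  Ex (fun f => F f * G f (f i)) = Ex (fun f => F f * \sum_y mu y * G f y).
Proof.
move=> iA FA GA.
transitivity (Ex (fun f => F f * \prod_(j | j \notin A)
    (if j == i then G f (f j) else 1))).
  apply: eq_Ex => f; congr (_ * _); rewrite (bigD1 i) //= eqxx big1 ?mulr1 //.
  by move=> j /andP[_ /negPf->].
rewrite (Ex_resample (G := fun j f y => if j == i then G f y else 1)) //; last first.
  by move=> j y f g fg; case: eqP => // _; apply: GA.
apply: eq_Ex => f; congr (_ * _); rewrite (bigD1 i) //= eqxx [X in _ * X]big1 ?mulr1 //.
move=> j /andP[_ /negPf->].
by under eq_bigr do rewrite mulr1.
Qed.

Lemma Ex_coord i (G : T -> R) : Ex (fun f => G (f i)) = \sum_y mu y * G y.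
Proof.
under eq_Ex do rewrite -[G _]mul1r.
rewrite (@Ex_resample1 set0 (fun=> 1) i (fun=> G)) ?inE //.
by under eq_Ex do rewrite mul1r; rewrite Ex_cst.
Qed.

Lemma Ex_coord2 i j (G : T -> T -> R) : i != j ->
  Ex (fun f => G (f i) (f j)) = Ex (fun f => \sum_y mu y * G (f i) y).
Proof.
move=> ij; under eq_Ex do rewrite -[G _ _]mul1r.
rewrite (@Ex_resample1 [set i] (fun=> 1) j (fun f => G (f i))) ?inE 1?eq_sym //.
  by apply: eq_Ex => f; rewrite mul1r.
by move=> y f g fg; rewrite fg ?inE.
Qed.

End ProductExpectation.

From mathcomp Require Import reals sequences exp.

(** * Sums over small subsets, and sizes of unions *)

Section SubsetSums.
Variable R : realType.

Lemma sum_subsets_card (T : finType) (S : {set T}) (k : nat) (y : R) :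
  \sum_(J : {set T} | (J \subset S) && (#|J| < k)%N) y ^+ #|J| =
  \sum_(d < k) 'C(#|S|, d)%:R * y ^+ d.
Proof.
rewrite (eq_bigr (fun J : {set T} => \sum_(d < k | #|J| == d :> nat) y ^+ d)).
  rewrite (exchange_big_dep predT) //=; apply: eq_bigr => d _.
  rewrite sumr_const -[LHS]mulr_natl -cards_draws; congr (_%:R * _).
  apply: eq_card => J; rewrite !inE unfold_in -andbA; congr (_ && _).
  by case: eqP => [->|]; rewrite ?ltn_ord ?andbF.
move=> J /andP[_ Jk]; rewrite (bigD1 (Ordinal Jk)) ?eqxx //= big1 ?addr0 //.
by move=> d /andP[/eqP dJ]; rewrite -val_eqE /= dJ eqxx.
Qed.

Lemma binr_le (n d : nat) : ('C(n, d)%:R : R) <= n%:R ^+ d / (d`!)%:R.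
Proof.
rewrite ler_pdivlMr ?ltr0n ?fact_gt0 // -natrM -natrX ler_nat bin_ffact.
elim: d n => [|d IH] n; first by rewrite ffactn0.
case: n => [|n]; first by rewrite ffact0n.
rewrite ffactSS expnS leq_mul2l; apply: (leq_trans (IH n)).
by case: d {IH} => // d; rewrite leq_exp2r.
Qed.

Lemma sum_bin_le_trunc (n k : nat) (y : R) : 0 <= y ->
  \sum_(d < k) 'C(n, d)%:R * y ^+ d <= \sum_(d < k) (n%:R * y) ^+ d / (d`!)%:R.
Proof.
move=> y0; apply: ler_sum => d _; rewrite exprMn mulrAC.
by apply: ler_wpM2r (binr_le _ _); rewrite exprn_ge0.
Qed.

Lemma sum_bin_le (n h : nat) (y : R) : 0 <= y ->
  \sum_(d < h.+1) 'C(n, d)%:R * y ^+ d <= (1 + n%:R * y) ^+ h.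
Proof.
move=> y0; rewrite exprDn; apply: ler_sum => d _.
have dh : (d <= h)%N by rewrite -ltnS.
rewrite expr1n mul1r -[leRHS]mulr_natl exprMn mulrA; apply: ler_wpM2r; first exact: exprn_ge0.
apply: le_trans (binr_le _ _) _.
rewrite ler_pdivrMr ?ltr0n ?fact_gt0 // -natrX -!natrM ler_nat.
by rewrite mulnAC -{1}[(_ ^ _)%N]mul1n leq_mul2r muln_gt0 bin_gt0 dh fact_gt0 orbT.
Qed.

Lemma sum_small_subsets (T : finType) (S : {set T}) (h : nat) (y : R) : 0 <= y ->
  \sum_(J : {set T} | (J \subset S) && (#|J| <= h)%N) y ^+ #|J| <=
  (1 + #|S|%:R * y) ^+ h.
Proof. by move=> y0; rewrite (sum_subsets_card S h.+1) sum_bin_le. Qed.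

End SubsetSums.

(** An object that lies in [t > 0] of the sets is counted [t] times on the left and [1 + t (t - 1)]
    times on the right. *)
Lemma leq_sum_card_bigcup (I O : finType) (S : I -> {set O}) :
  (\sum_i #|S i| <= #|\bigcup_i S i| + \sum_i \sum_(j | j != i) #|S i :&: S j|)%N.
Proof.
have cardE (A : {set O}) : #|A| = (\sum_o (o \in A))%N.
  by rewrite -sum1_card big_mkcond; apply: eq_bigr => o _; case: (o \in A).
under eq_bigr do rewrite cardE.
under [X in (_ <= _ + X)%N]eq_bigr do under eq_bigr do rewrite cardE.
under [X in (_ <= _ + X)%N]eq_bigr do rewrite exchange_big.
rewrite exchange_big [X in (_ <= _ + X)%N]exchange_big cardE -big_split /=.
apply: leq_sum => o _.
have [/bigcupP[i0 _ oi0]|oU] := boolP (o \in \bigcup_i S i); last first.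
  rewrite big1 // => i _; case oi : (o \in S i) => //.
  by case/bigcupP: oU; exists i.
rewrite (bigD1 i0) //= oi0 leq_add2l.
rewrite [X in (_ <= X)%N](bigD1 i0) //=.
apply: leq_trans (leq_addr _ _).
by apply: leq_sum => i _; rewrite inE oi0.
Qed.

(** * Hitting probabilities of one random set *)

Section RandomSets.
Variables (R : realType) (O : finType) (mu : {set O} -> R).
Hypotheses (mu_ge0 : forall y, 0 <= mu y) (mu_sum1 : \sum_y mu y = 1).

Definition prob (Q : pred {set O}) : R := \sum_y mu y * (Q y)%:R.

Lemma prob_le (Q Q' : pred {set O}) :
  (forall y, 0 < mu y -> Q y -> Q' y) -> prob Q <= prob Q'.
Proof.
move=> QQ'; apply: ler_sum => y _; have := mu_ge0 y; rewrite le_eqVlt.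
case/predU1P => [<-|mu0]; first by rewrite !mul0r.
rewrite ler_wpM2l // ler_nat; have := QQ' y mu0.
by case: (Q y) => // ->.
Qed.

Lemma prob_ge0 Q : 0 <= prob Q.
Proof. by apply: sumr_ge0 => y _; rewrite mulr_ge0. Qed.

Lemma prob_union (J : finType) (P : pred J) (Q : J -> pred {set O}) (Q' : pred {set O}) :
  (forall y, Q' y -> exists2 j, P j & Q j y) -> prob Q' <= \sum_(j | P j) prob (Q j).
Proof.
move=> QQ'; rewrite /prob exchange_big; apply: ler_sum => y _ /=.
rewrite -mulr_sumr ler_wpM2l //; case Q'y : (Q' y).
  have [j Pj Qj] := QQ' y Q'y.
  by rewrite (bigD1 j) //= Qj lerDl sumr_ge0.
by rewrite sumr_ge0.
Qed.

(** In the application sizes lie between [K1] and [K2] in a pool of [m] objects, [p = K2 / m] and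
    [theta = K1 / m]. The product [rho = p * K2] then bounds the probability that two sets meet. *)
Variables (p K2 theta : R).
Hypotheses (p_ge0 : 0 <= p) (K2_ge0 : 0 <= K2).
Hypothesis mu_size : forall y, 0 < mu y -> #|y|%:R <= K2.
Hypothesis mu_sup : forall B : {set O}, prob (fun y => B \subset y) <= p ^+ #|B|.
Hypothesis mu_avoid : forall U : {set O},
  prob (fun y => [disjoint y & U]) <= expR (- (theta * #|U|%:R)).

Let rho := p * K2.

Lemma rho_ge0 : 0 <= rho. Proof. exact: mulr_ge0. Qed.

Lemma prob_hit (U : {set O}) :
  prob (fun y => ~~ [disjoint y & U]) <= p * #|U|%:R.
Proof.
apply: le_trans (_ : \sum_(o in U) prob (fun y => o \in y) <= _).
  by apply: prob_union => y /pred0Pn[o /andP[oy oU]]; exists o.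
apply: le_trans (_ : \sum_(o in U) p <= _); last by rewrite sumr_const mulr_natr.
apply: ler_sum => o _; have := mu_sup [set o]; rewrite cards1 expr1.
by apply: le_trans; apply: prob_le => y _; rewrite sub1set.
Qed.

(** Choose one object of [y] in each set of [s]: there are at most [K2 ^+ size s] choices, the
    chosen objects are distinct because the sets are disjoint, and each costs a factor [p]. [B]
    accumulates the objects already chosen. *)
Lemma prob_hit_all (B : {set O}) (s : seq {set O}) :
  pairwise (fun X Y : {set O} => [disjoint X & Y]) (B :: s) ->
  (forall X, X \in s -> #|X|%:R <= K2) ->
  prob (fun y => (B \subset y) && all (fun X : {set O} => ~~ [disjoint y & X]) s)
    <= p ^+ #|B| * rho ^+ size s.
Proof.
elim: s B => [|X s IH] B.
  by move=> _ _; rewrite mulr1; apply: le_trans (mu_sup _); apply: prob_le => y _ /andP[].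
rewrite pairwise_cons => /andP[/andP[BX Bs] Xs] leK.
apply: le_trans (_ : \sum_(o in X) p ^+ #|o |: B| * rho ^+ size s <= _).
  apply: le_trans (_ : \sum_(o in X) prob (fun y => (o |: B \subset y) &&
      all (fun X : {set O} => ~~ [disjoint y & X]) s) <= _).
    apply: prob_union => y /andP[By /andP[/pred0Pn[o /andP[oy oX]] sy]].
    by exists o => //; apply/andP; split=> //; rewrite subUset sub1set By andbT; apply: oy.
  apply: ler_sum => o oX; apply: IH => [|Y Ys]; last by rewrite leK // inE Ys orbT.
  move: Xs; rewrite !pairwise_cons => /andP[Xs ->]; rewrite andbT.
  apply/allP => Y Ys; rewrite -setI_eq0 setIUl setU_eq0 !setI_eq0 (allP Bs) // disjoints1.
  by rewrite (disjointFr (allP Xs _ Ys) oX).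
rewrite (eq_bigr (fun=> p ^+ #|B|.+1 * rho ^+ size s)) => [|o oX]; last first.
  by rewrite cardsU1 (disjointFl BX oX).
rewrite sumr_const -mulr_natr exprSr [rho ^+ _.+1]exprS /rho -!mulrA.
apply: ler_wpM2l; first exact: exprn_ge0.
apply: ler_wpM2l => //; rewrite mulrC; apply: ler_wpM2r; first by rewrite exprn_ge0 ?rho_ge0.
by apply: leK; rewrite mem_head.
Qed.

(** Expand the power over the subsets [J] of [A :&: y] and apply [mu_sup] to each [J]. *)
Lemma mean_overlap (A : {set O}) (x : R) : 0 <= x ->
  \sum_y mu y * (1 + x) ^+ #|A :&: y| <= (1 + x * p) ^+ #|A|.
Proof.
move=> x0.
have expand (z : R) (B : {set O}) :
    (1 + z) ^+ #|B| = \sum_(J : {set O} | J \subset B) z ^+ #|J|.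
  transitivity (\prod_o ((if o \in B then z else 0) + 1)).
    rewrite [RHS](bigID (mem B)) /= [X in _ = _ * X]big1 ?mulr1; last first.
      by move=> o /negPf->; rewrite add0r.
    rewrite (eq_bigr (fun=> 1 + z)) ?prodr_const // => o /= ->.
    by rewrite addrC.
  rewrite bigA_distr (bigID (fun J : {set O} => J \subset B)) /= [X in _ + X]big1 ?addr0; last first.
    move=> J /subsetPn[o oJ oB].
    by rewrite (bigD1 o) //= oJ (negPf oB) mul0r.
  apply: eq_bigr => J JB; rewrite -big_mkcond /=.
  rewrite (eq_bigr (fun=> z)) ?prodr_const // => o oJ.
  by rewrite (subsetP JB).
rewrite expand; under eq_bigr do rewrite expand mulr_sumr.
rewrite (exchange_big_dep (fun J : {set O} => J \subset A)) /=; last first.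
  by move=> y J _; rewrite subsetI => /andP[].
apply: ler_sum => J JA; rewrite exprMn.
apply: le_trans (_ : x ^+ #|J| * prob (fun y => J \subset y) <= _).
  rewrite mulr_sumr big_mkcond; apply: ler_sum => y _ /=.
  rewrite subsetI JA /=; case: (J \subset y); rewrite ?mulr1 ?mulr0 //.
  by rewrite mulrC.
by rewrite ler_wpM2l ?exprn_ge0.
Qed.

End RandomSets.

(** * Upper bound for the probability that [r] given vertices have low degree *)

Definition meet_rel (I O : finType) (f : I -> {set O}) : rel I :=
  fun i j => (i != j) && (f i :&: f j != set0).

Lemma meet_relE (I O : finType) (f : I -> {set O}) i j :
  meet_rel f i j = (i != j) && ~~ [disjoint f i & f j].
Proof. by rewrite /meet_rel setI_eq0. Qed.

Lemma leq_card_bigcup (J T : finType) (S : J -> {set T}) :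
  (#|\bigcup_i S i| <= \sum_i #|S i|)%N.
Proof.
elim/big_rec2: _ => [|i m A _ le]; first by rewrite cards0.
by rewrite (leq_trans (leq_card_setU _ _)) // leq_add2l.
Qed.

Definition low_vertices (I O : finType) (k : nat) (f : I -> {set O}) : {set I} :=
  [set v | (#|nbrs (meet_rel f) v| < k)%N].

Section DegreeBounds.
Variables (R : realType) (O : finType) (mu : {set O} -> R).
Hypotheses (mu_ge0 : forall y, 0 <= mu y) (mu_sum1 : \sum_y mu y = 1).
Variables (p K1 K2 theta : R).
Hypotheses (p_ge0 : 0 <= p) (K1_ge0 : 0 <= K1) (theta_ge0 : 0 <= theta).
Hypothesis mu_size : forall y, 0 < mu y -> K1 <= #|y|%:R <= K2.
Hypothesis mu_sup : forall B : {set O}, prob mu (fun y => B \subset y) <= p ^+ #|B|.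
Hypothesis mu_avoid : forall U : {set O},
  prob mu (fun y => [disjoint y & U]) <= expR (- (theta * #|U|%:R)).
Hypothesis K2_ge0 : 0 <= K2.

Let rho := p * K2.
Let mu_size2 y : 0 < mu y -> #|y|%:R <= K2.
Proof. by move=> /mu_size/andP[]. Qed.
Let rho_pos : 0 <= rho. Proof. exact: mulr_ge0. Qed.

Variables (I : finType) (r : nat) (h : 'I_r -> I).
Hypothesis hI : injective h.
Let A := [set h i | i in 'I_r].
Let n := #|I|.
Implicit Types f : {ffun I -> {set O}}.

Let hA i : h i \in A. Proof. exact: imset_f. Qed.
Let cardA : #|A| = r. Proof. by rewrite card_imset ?card_ord. Qed.
Let cardCA : #|~: A| = (n - r)%N. Proof. by rewrite cardsCs setCK cardA. Qed.

Definition disjoint_family (J X : finType) (S : J -> {set X}) : bool :=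
  [forall i, forall j, (i != j) ==> [disjoint S i & S j]].

Lemma disjoint_familyP (J X : finType) (S : J -> {set X}) :
  reflect (forall i j, i != j -> [disjoint S i & S j]) (disjoint_family S).
Proof.
apply: (iffP forallP) => H i; first by move=> j; apply: (implyP (forallP (H i) j)).
by apply/forallP => j; apply/implyP; apply: H.
Qed.

Let fam f i := f (h i).

Let fam_dep i : depends_on A (fun f => fam f i).
Proof. by move=> f g fg; rewrite /fam fg. Qed.

Definition low_degrees (k : nat) f :=
  [forall i, (#|nbrs (meet_rel f) (h i)| < k)%N].

Section Upper.
Variable k : nat.
(** When the [r] vertices have degree below [k], at least [N0] vertices outside [A] meet none of
    their sets; each of these contributes a factor [E] if the sets are disjoint. *)
Let N0 := (n - r - r * k)%N.
Let E := expR (- (theta * (r%:R * K1))).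

Let matches (J : {ffun 'I_r -> {set I}}) j f (y : {set O}) :=
  [forall i, (~~ [disjoint y & fam f i]) == (j \in J i)].

Let matches_dep J j y : depends_on A (fun f => ((matches J j f y)%:R : R)).
Proof.
move=> f g fg; congr (_ %:R); congr (nat_of_bool _); apply: eq_forallb => i.
by rewrite (fam_dep i fg).
Qed.

Let disj_dep : depends_on A (fun f => ((disjoint_family (fam f))%:R : R)).
Proof.
move=> f g fg; congr (_ %:R); congr (nat_of_bool _).
apply: eq_forallb => i; apply: eq_forallb => j.
by rewrite (fam_dep i fg) (fam_dep j fg).
Qed.

Let card_union_disj f : (forall i, 0 < mu (f i)) -> disjoint_family (fam f) ->
  r%:R * K1 <= #|\bigcup_i fam f i|%:R.
Proof.
move=> f0 /disjoint_familyP fd.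
apply: le_trans (_ : (\sum_i #|fam f i|)%:R <= _).
  rewrite natr_sum -[r in r%:R]card_ord mulr_natl -sumr_const.
  by apply: ler_sum => i _; have /andP[] := mu_size (f0 (h i)).
rewrite ler_nat; apply: leq_trans (leq_sum_card_bigcup _) _.
rewrite [X in (_ + X)%N]big1 ?addn0 // => i _; rewrite big1 // => j ji.
by rewrite disjoint_setI0 ?cards0 // fd // eq_sym.
Qed.

(** Sum over the neighbourhoods [J i] outside [A]. Given the [r] disjoint sets, a vertex in [c j] of
    the [J i] must hit that many disjoint sets, and a vertex in none must avoid a union of at least
    [r * K1] objects. The resulting bound depends only on the sizes of the [J i], so the sum factors
    over [i]. *)
Lemma low_degree_disjoint :
  Ex mu (fun f => (low_degrees k f && disjoint_family (fam f))%:R) <=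
  E ^+ N0 * (\sum_(d < k) (n%:R * rho) ^+ d / (d`!)%:R) ^+ r.
Proof.
pose Q := [pred X : {set I} | (X \subset ~: A) && (#|X| < k)%N].
have E_le1 : E <= 1 by rewrite -expR0 ler_expR oppr_le0 !mulr_ge0.
have E_ge0 : 0 <= E by exact: expR_ge0.
apply: le_trans (_ : Ex mu (fun f => \sum_(J in ffun_on Q)
   (disjoint_family (fam f))%:R *
     \prod_(j | j \notin A) (matches J j f (f j))%:R) <= _).
  apply: Ex_le => // f _.
  have pos (J : {ffun 'I_r -> {set I}}) : 0 <= (disjoint_family (fam f))%:R *
     \prod_(j | j \notin A) (matches J j f (f j))%:R :> R.
    by rewrite mulr_ge0 ?prodr_ge0.
  have [/andP[lo ->]|_] := boolP (_ && _); last by rewrite sumr_ge0.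
  pose J0 := [ffun i => nbrs (meet_rel f) (h i) :\: A].
  rewrite (bigD1 J0) /=; last first.
    apply/ffun_onP => i; rewrite ffunE inE; apply/andP; split.
      by apply/subsetP => x; rewrite !inE => /andP[].
    by apply: leq_ltn_trans (forallP lo i); rewrite subset_leq_card ?subsetDl.
  rewrite big1 ?mulr1 => [|j jA].
    rewrite lerDl; apply: sumr_ge0 => J _.
    by rewrite mulr_ge0 ?prodr_ge0.
  have -> // : matches J0 j f (f j).
  apply/forallP => i; rewrite ffunE !inE jA meet_relE disjoint_sym.
  have -> // : h i != j by apply: contraNneq jA => <-.
rewrite Ex_sum.
apply: le_trans (_ : \sum_(J in ffun_on Q) E ^+ N0 * \prod_i rho ^+ #|J i| <= _).
  apply: ler_sum => J /ffun_onP JQ.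
  rewrite (Ex_resample mu_sum1 disj_dep (fun j y => @matches_dep J j y)).
  apply: le_trans (_ : Ex mu (fun f => E ^+ N0 * \prod_i rho ^+ #|J i|) <= _); last first.
    by rewrite Ex_cst.
  apply: Ex_le => // f f0.
  have [fd|_] := boolP (disjoint_family _); last first.
    by rewrite mul0r mulr_ge0 ?exprn_ge0 // prodr_ge0 // => i _; rewrite exprn_ge0.
  rewrite mul1r.
  pose c j := #|[set i | j \in J i]|.
  apply: le_trans (_ : \prod_(j | j \notin A) ((if c j == 0%N then E else 1) * rho ^+ c j) <= _).
    apply: ler_prod => j jA; rewrite prob_ge0 //=.
    case: eqP => [cj0|_].
      rewrite cj0 mulr1; apply: le_trans (_ : prob mu (fun y => [disjoint y & \bigcup_i fam f i]) <= _).
        apply: prob_le => // y _ /forallP my; apply: contraT => /pred0Pn[o /andP[oy /bigcupP[i _ oi]]].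
        have /eqP := my i; have -> : (j \in J i) = false.
          by apply/negP => jJ; move/eqP: cj0; rewrite cards_eq0 => /eqP/setP/(_ i); rewrite !inE jJ.
        by move=> /negbFE/pred0P/(_ o); rewrite /= oi; rewrite [_ \in _]oy.
      apply: le_trans (mu_avoid _) _; rewrite ler_expR lerN2 ler_wpM2l //.
      exact: card_union_disj.
    rewrite mul1r.
    have := @prob_hit_all _ _ _ mu_ge0 _ _ p_ge0 K2_ge0 mu_sup set0
       [seq fam f i | i <- enum [set i | j \in J i]].
    rewrite size_map -cardE cards0 mul1r => le; apply: le_trans (le _ _).
    - apply: prob_le => // y _ /forallP my; rewrite sub0set.
      by apply/allP => _ /mapP[i + ->]; rewrite mem_enum inE => jJ; rewrite (eqP (my i)).
    - rewrite pairwise_cons pairwise_map; apply/andP; split.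
        by apply/allP => X _; rewrite -setI_eq0 set0I.
      have := enum_uniq [set i | j \in J i]; rewrite uniq_pairwise.
      by apply: sub_pairwise => i i'; apply: (disjoint_familyP _ fd).
    - by move=> X /mapP[i _ ->]; apply: mu_size2; apply: f0.
  rewrite big_split /= ler_pM ?prodr_ge0 //; try (by move=> j _; rewrite ?exprn_ge0 //; case: ifP).
    rewrite -big_mkcondr /= prodr_const; apply: ler_wiXn2l => //.
    apply: leq_trans (_ : #|~: A :\: \bigcup_i J i| <= _)%N.
      rewrite cardsD /N0 cardCA leq_sub2l //.
      apply: leq_trans (subset_leq_card (subsetIr _ _)) _.
      apply: leq_trans (leq_card_bigcup _) _.
      rewrite -[r in (r * k)%N]card_ord -sum_nat_const; apply: leq_sum => i _.
      by have /andP[_ /ltnW] := JQ i.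
    apply/subset_leq_card/subsetP => j; rewrite in_setD in_setC => /andP[jJ jA].
    rewrite unfold_in /= jA /= cards_eq0; apply/eqP/setP => i; rewrite !inE; apply/negP => ji.
    by case/bigcupP: jJ; exists i.
  rewrite prodrXr prodrXr le_eqVlt; apply/orP; left; apply/eqP.
  congr (_ ^+ _).
  transitivity (\sum_(j | j \notin A) \sum_i (j \in J i))%N.
    apply: eq_bigr => j _; rewrite /c -sum1dep_card big_mkcond.
    by apply: eq_bigr => i _; case: (j \in J i).
  rewrite exchange_big; apply: eq_bigr => i _.
  rewrite -sum1_card -[LHS]big_mkcondr; apply: eq_bigl => j.
  case: (boolP (j \in J i)); rewrite ?andbF // => ji; rewrite andbT.
  by have /andP[/subsetP/(_ j ji)] := JQ i; rewrite inE => ->.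
rewrite -mulr_sumr ler_wpM2l ?exprn_ge0 //.
rewrite -(bigA_distr_big Q (fun _ X => rho ^+ #|X|)) prodr_const card_ord.
have -> : \sum_(j in Q) rho ^+ #|j| =
    \sum_(J : {set I} | (J \subset ~: A) && (#|J| < k)%N) rho ^+ #|J| by [].
rewrite sum_subsets_card; apply: lerXn2r; rewrite ?nnegrE ?sumr_ge0 //.
- by move=> d _; rewrite mulr_ge0 ?exprn_ge0.
- by move=> d _; rewrite mulr_ge0 ?invr_ge0 ?exprn_ge0 ?mulr_ge0.
apply: le_trans (sum_bin_le_trunc _ _ _) _ => //.
apply: ler_sum => d _; rewrite ler_wpM2r ?invr_ge0 //.
apply: lerXn2r; rewrite ?nnegrE ?mulr_ge0 // ler_wpM2r // ler_nat.
by rewrite cardCA leq_subr.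
Qed.

(** If no two of the sets share more than [w] objects, the union falls at most [r ^ 2 * w] short of
    [r * K1], which costs at most a factor [x ^+ w] over all vertices. *)
Let x := expR (theta * (n%:R * (r ^ 2)%:R)).

Let overlap f := (\sum_i \sum_(j | j != i) #|fam f i :&: fam f j|)%N.

Let overlap_bound f (U := \bigcup_i fam f i) : (forall i, 0 < mu (f i)) ->
  ~~ disjoint_family (fam f) ->
  expR (- (theta * #|U|%:R)) ^+ N0 <=
  E ^+ N0 * \sum_i \sum_(j | j != i) ((1 + x) ^+ #|fam f i :&: fam f j| - 1).
Proof.
move=> f0 nd.
have x_ge0 : 0 <= x by exact: expR_ge0.
have term_ge0 m : 0 <= (1 + x) ^+ m - 1.
  by rewrite subr_ge0 exprn_ege1 // lerDl.
pose w (q : 'I_r * 'I_r) := #|fam f q.1 :&: fam f q.2|.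
have [q0 /andP[q0d q0w]] : exists q : 'I_r * 'I_r, (q.2 != q.1) && (0 < w q)%N.
  have [i [j [ij nij]]] : exists i j, i != j /\ ~~ [disjoint fam f i & fam f j].
    apply: contrapT => no; case/negP: nd; apply/disjoint_familyP => i j ij.
    by apply: contrapT => /negP nij; apply: no; exists i, j.
  by exists (i, j); rewrite /w /= eq_sym ij card_gt0 setI_eq0.
have [q qd qmax] := @arg_maxnP _ q0 (fun q => q.2 != q.1) w q0d.
have w0 : (0 < w q)%N by apply: leq_trans (qmax _ q0d).
have tw : (overlap f <= r ^ 2 * w q)%N.
  apply: leq_trans (_ : \sum_(i < r) \sum_(j < r) w q <= _)%N.
    apply: leq_sum => i _; rewrite big_mkcond; apply: leq_sum => j _.
    by case: ifP => // ji; apply: (qmax (i, j)).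
  by rewrite !sum_nat_const !card_ord mulnA mulnn.
apply: le_trans (_ : E ^+ N0 * ((1 + x) ^+ w q - 1) <= _); last first.
  apply: ler_wpM2l; first by rewrite exprn_ge0 ?expR_ge0.
  rewrite (bigD1 q.1) //= (bigD1 q.2) //= -addrA lerDl addr_ge0 //.
    by apply: sumr_ge0 => j _.
  by apply: sumr_ge0 => i _; apply: sumr_ge0 => j _.
(* Since [w q > 0], [x ^+ w q] is at most [(1 + x) ^+ w q - 1]. The latter vanishes for disjoint
   pairs, which keeps its mean, computed by [mean_overlap], small. *)
apply: le_trans (_ : E ^+ N0 * x ^+ w q <= _); last first.
  apply: ler_wpM2l; first by rewrite exprn_ge0 ?expR_ge0.
  rewrite lerBrDr; case: (w q) w0 => // m _; elim: m => [|m IH].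
    by rewrite !expr1 addrC.
  rewrite exprS [leRHS]exprS mulrDl mul1r.
  have : 0 <= x * 1 by rewrite mulr1.
  have : x * (x ^+ m.+1 + 1) <= x * (1 + x) ^+ m.+1 by rewrite ler_wpM2l.
  have : 0 <= x ^+ m.+1 by rewrite exprn_ge0.
  lra.
rewrite /E /x -!expRM_natl -expRD ler_expR.
have le1 : r%:R * K1 <= #|U|%:R + (overlap f)%:R.
  apply: le_trans (_ : (\sum_i #|fam f i|)%:R <= _).
    rewrite natr_sum -[r in r%:R]card_ord mulr_natl -sumr_const.
    by apply: ler_sum => i _; have /andP[] := mu_size (f0 (h i)).
  by rewrite -natrD ler_nat leq_sum_card_bigcup.
have le2 : N0%:R * (overlap f)%:R <= n%:R * (r ^ 2 * w q)%:R :> R.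
  by rewrite -!natrM ler_nat leq_mul // /N0 -subnDA leq_subr.
have le3 : theta * (N0%:R * (r%:R * K1)) <= theta * (N0%:R * (#|U|%:R + (overlap f)%:R)).
  by rewrite !ler_wpM2l.
have le4 : theta * (N0%:R * (overlap f)%:R) <= theta * (n%:R * (r ^ 2 * w q)%:R).
  by rewrite ler_wpM2l.
rewrite natrM in le4; lra.
Qed.

(** A cruder count than for disjoint sets suffices: only the set [J] of the at most [r * k] outside
    vertices that meet the union is recorded. The loss is a power of [ln n], whereas the overlap
    factor [exp (x rho) - 1] is polynomially small. *)
Lemma low_degree_overlap :
  Ex mu (fun f => (low_degrees k f && ~~ disjoint_family (fam f))%:R) <=
  (1 + n%:R * (r%:R * rho)) ^+ (r * k) *
  (E ^+ N0 * ((r ^ 2)%:R * (expR (x * rho) - 1))).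
Proof.
pose U f := \bigcup_i fam f i.
have x_ge0 : 0 <= x by exact: expR_ge0.
have U_dep : depends_on A U.
  by move=> f g fg; apply: eq_bigr => i _; apply: fam_dep.
pose hits (J : {set I}) j f (y : {set O}) := (~~ [disjoint y & U f]) == (j \in J).
pose Q := [pred J : {set I} | (J \subset ~: A) && (#|J| <= r * k)%N].
have nd_dep : depends_on A (fun f => ((~~ disjoint_family (fam f))%:R : R)).
  move=> f g fg; have := disj_dep fg.
  by case: (disjoint_family _); case: (disjoint_family _) => //= /eqP;
    rewrite ?oner_eq0 // eq_sym oner_eq0.
apply: le_trans (_ : Ex mu (fun f => \sum_(J in Q)
   (~~ disjoint_family (fam f))%:R *
     \prod_(j | j \notin A) (hits J j f (f j))%:R) <= _).
  apply: Ex_le => // f f0.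
  have pos (J : {set I}) : 0 <= (~~ disjoint_family (fam f))%:R *
     \prod_(j | j \notin A) (hits J j f (f j))%:R :> R.
    by rewrite mulr_ge0 ?prodr_ge0.
  have [/andP[lo ->]|_] := boolP (_ && _); last by rewrite sumr_ge0.
  pose J0 := [set j in ~: A | ~~ [disjoint f j & U f]].
  rewrite (bigD1 J0) /=; last first.
    rewrite inE; apply/andP; split.
      by apply/subsetP => j; rewrite inE => /andP[].
    apply: leq_trans (_ : #|\bigcup_i nbrs (meet_rel f) (h i)| <= _)%N.
      apply/subset_leq_card/subsetP => j; rewrite inE in_setC => /andP[jA].
      case/pred0Pn => o /andP[oj /bigcupP[i _ oi]]; apply/bigcupP; exists i => //.
      rewrite inE meet_relE; apply/andP; split.
        by apply: contraNneq jA => <-.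
      by apply/pred0Pn; exists o; apply/andP.
    apply: leq_trans (leq_card_bigcup _) _.
    rewrite -[r in (r * k)%N]card_ord -sum_nat_const; apply: leq_sum => i _.
    exact/ltnW/(forallP lo).
  rewrite big1 ?mulr1 => [|j jA]; first by rewrite lerDl; apply: sumr_ge0 => J _; rewrite mulr_ge0 ?prodr_ge0.
  by have -> : hits J0 j f (f j) by rewrite /hits inE in_setC jA.
rewrite Ex_sum.
pose ov := Ex mu (fun f => \sum_(i < r) \sum_(j | j != i)
   ((1 + x) ^+ #|fam f i :&: fam f j| - 1)).
apply: le_trans (_ : \sum_(J in Q) (r%:R * rho) ^+ #|J| * (E ^+ N0 * ov) <= _).
  apply: ler_sum => J /andP[JA Jk].
  rewrite (Ex_resample (G := fun j f y => (hits J j f y)%:R) mu_sum1 nd_dep); last first.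
    by move=> j y f g fg; rewrite /hits (U_dep _ _ fg).
  rewrite -!ExZ; apply: Ex_le => // f f0.
  have [fd|nd] := boolP (disjoint_family _).
    rewrite mul0r mulr_ge0 ?exprn_ge0 ?mulr_ge0 //; first by rewrite exprn_ge0 ?expR_ge0.
    apply: sumr_ge0 => i _; apply: sumr_ge0 => j _.
    by rewrite subr_ge0 exprn_ege1 // lerDl.
  rewrite mul1r; apply: le_trans (ler_wpM2l _ (overlap_bound f0 nd)); last first.
    by rewrite exprn_ge0 ?mulr_ge0.
  set e := expR _.
  have e01 : 0 <= e <= 1.
    by rewrite expR_ge0 -expR0 ler_expR oppr_le0 !mulr_ge0.
  apply: le_trans (_ : \prod_(j | j \notin A) (if j \in J then r%:R * rho else e) <= _).
    apply: ler_prod => j jA; rewrite prob_ge0 //=; case: ifP => jJ.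
      apply: le_trans (_ : prob mu (fun y => ~~ [disjoint y & U f]) <= _).
        by apply: prob_le => // y _; rewrite /hits jJ eqb_id.
      apply: le_trans (prob_hit mu_ge0 mu_sup _) _.
      rewrite /rho mulrCA; apply: ler_wpM2l => //.
      apply: le_trans (_ : (\sum_i #|fam f i|)%:R <= _); first by rewrite ler_nat leq_card_bigcup.
      rewrite natr_sum -[r in r%:R]card_ord mulr_natl -sumr_const.
      by apply: ler_sum => i _; apply/mu_size2/f0.
    apply: le_trans (mu_avoid (U f)).
    by apply: prob_le => // y _; rewrite /hits jJ eqbF_neg negbK.
  rewrite (bigID (mem J)) /=; apply: ler_pM.
  - by apply: prodr_ge0 => j /andP[_ ->]; rewrite mulr_ge0.
  - by apply: prodr_ge0 => j _; case: ifP => _; rewrite ?mulr_ge0 //; case/andP: e01.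
  - rewrite (eq_bigr (fun=> r%:R * rho)) => [|j /andP[_ ->] //].
    rewrite prodr_const le_eqVlt; apply/orP; left; apply/eqP; congr (_ ^+ _).
    apply: eq_card => j; rewrite unfold_in /=; case: (boolP (j \in J)); rewrite ?andbF ?andbT //.
    by move=> /(subsetP JA); rewrite inE.
  - rewrite (eq_bigr (fun=> e)) => [|j /andP[_ /negPf->] //].
    rewrite prodr_const; apply: ler_wiXn2l => //; try by case/andP: e01.
    apply: leq_trans (_ : #|~: A :\: J| <= _)%N.
      rewrite cardsD /N0 cardCA leq_sub2l // (leq_trans _ Jk) //.
      by rewrite subset_leq_card ?subsetIr.
    by apply/subset_leq_card/subsetP => j; rewrite in_setD in_setC => /andP[jJ jA]; rewrite unfold_in /= jA jJ.
have ov_ge0 : 0 <= ov.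
  apply: Ex_ge0 => // f; apply: sumr_ge0 => i _; apply: sumr_ge0 => j _.
  by rewrite subr_ge0 exprn_ege1 // lerDl.
rewrite -mulr_suml; apply: ler_pM.
- by apply: sumr_ge0 => J _; rewrite exprn_ge0 ?mulr_ge0.
- by rewrite mulr_ge0 // exprn_ge0 ?expR_ge0.
- apply: le_trans (@sum_small_subsets _ _ (~: A) (r * k) _ _) _; first by rewrite mulr_ge0.
  apply: lerXn2r; rewrite ?nnegrE ?addr_ge0 ?mulr_ge0 //.
  by rewrite lerD2l ler_wpM2r ?mulr_ge0 // ler_nat cardCA leq_subr.
apply: ler_wpM2l; first by rewrite exprn_ge0 ?expR_ge0.
rewrite /ov Ex_sum.
apply: le_trans (_ : \sum_(i < r) \sum_(j < r) (expR (x * rho) - 1) <= _); last first.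
  by rewrite !sumr_const !card_ord -mulrnA mulnn mulr_natl.
have nn : 0 <= expR (x * rho) - 1.
  by rewrite subr_ge0 -expR0 ler_expR mulr_ge0.
apply: ler_sum => i _; rewrite Ex_sum big_mkcond; apply: ler_sum => j _.
case: eqP => //= /eqP ji; rewrite ExB Ex_cst // lerB //.
rewrite (@Ex_coord2 _ _ _ _ _ (h i) (h j) (fun a b => (1 + x) ^+ #|a :&: b|)) //; last first.
  by rewrite (inj_eq hI) eq_sym.
apply: le_trans (_ : Ex mu (fun f : {ffun I -> {set O}} => expR (x * rho)) <= _); last by rewrite Ex_cst.
apply: Ex_le => // f f0 /=; apply: le_trans (mean_overlap mu_sup _ _) _ => //.
apply: le_trans (_ : expR (x * p) ^+ #|f (h i)| <= _).
  apply: lerXn2r; rewrite ?nnegrE ?addr_ge0 ?mulr_ge0 ?expR_ge0 //.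
  exact: expR_ge1Dx.
rewrite -expRM_natl ler_expR /rho mulrC -mulrA; apply: ler_wpM2l => //.
by apply: ler_wpM2l => //; apply: mu_size2.
Qed.

End Upper.
End DegreeBounds.

(** * Lower bound for the same probability *)

Lemma card_draws_sup (T : finType) (B S : {set T}) (d : nat) :
  B \subset S -> (#|B| <= d)%N ->
  #|[set X : {set T} | [&& B \subset X, X \subset S & #|X| == d]]| =
  'C(#|S| - #|B|, d - #|B|).
Proof.
move=> BS Bd.
have <- : #|S :\: B| = (#|S| - #|B|)%N by rewrite cardsD (setIidPr BS).
rewrite -cards_draws -[RHS](card_in_imset (f := fun X : {set T} => B :|: X)).
  apply: eq_card => X; rewrite inE; apply/idP/imsetP => [|[Y]].
    case/and3P => BX XS /eqP Xd; exists (X :\: B).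
      by rewrite inE setSD //= cardsD (setIidPr BX) Xd.
    by rewrite setDE setUIr setUCr setIT (setUidPr BX).
  rewrite inE => /andP[YS /eqP Yd] ->; rewrite subsetUl subUset BS /=.
  rewrite (subset_trans YS) ?subsetDl //= cardsU Yd.
  have -> : B :&: Y = set0.
    by apply/eqP; rewrite setI_eq0 disjoint_sym; move: YS; rewrite subsetD => /andP[].
  by rewrite cards0 subn0 subnKC.
move=> X Y; rewrite !inE !subsetD => /andP[/andP[_ XB] _] /andP[/andP[_ YB] _] E.
have cancel (Z : {set T}) : [disjoint Z & B] -> (B :|: Z) :\: B = Z.
  by move=> ZB; rewrite setDUl setDv set0U; apply/setDidPl.
by rewrite -(cancel X) // E cancel.
Qed.

Lemma Ex_exchange (R : realFieldType) (T T' I I' : finType) (mu : T -> R) (nu : T' -> R)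
    (F : {ffun I -> T} -> {ffun I' -> T'} -> R) :
  Ex mu (fun f => Ex nu (F f)) = Ex nu (fun g => Ex mu (F^~ g)).
Proof.
rewrite /Ex; under eq_bigr do rewrite mulr_sumr.
rewrite exchange_big; apply: eq_bigr => g _; rewrite mulr_sumr.
by apply: eq_bigr => f _; rewrite mulrCA.
Qed.

(** Union bound over the pairs of sets and the element that they share. *)
Lemma disjoint_family_prob (R : realType) (X I : finType) (nu : {set X} -> R) (r : nat)
    (h : 'I_r -> I) (p : R) :
  (forall y, 0 <= nu y) -> \sum_y nu y = 1 -> injective h -> 0 <= p ->
  (forall o, prob nu (fun y => o \in y) <= p) ->
  1 - (r ^ 2)%:R * (#|X|%:R * p ^+ 2) <=
  Ex nu (fun f : {ffun I -> {set X}} => (disjoint_family (fun i => f (h i)))%:R).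
Proof.
move=> nu0 nu1 hI p0 nup; rewrite lerBlDr.
have pair i j : i != j ->
    Ex nu (fun f : {ffun I -> {set X}} => (~~ [disjoint f (h i) & f (h j)])%:R) <=
    #|X|%:R * p ^+ 2.
  move=> ij; apply: le_trans (_ : Ex nu (fun f : {ffun I -> {set X}} =>
     \sum_o (o \in f (h i))%:R * (o \in f (h j))%:R) <= _).
    apply: Ex_le => // f _; case: (boolP [disjoint _ & _]) => [_|/pred0Pn[o /andP[oi oj]]] /=.
      by apply: sumr_ge0 => o _; rewrite mulr_ge0.
    have oi' : o \in f (h i) by []. have oj' : o \in f (h j) by [].
    by rewrite (bigD1 o) //= oi' oj' mulr1 lerDl sumr_ge0 // => o' _; rewrite mulr_ge0.
  rewrite Ex_sum mulr_natl -sumr_const; apply: ler_sum => o _.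
  rewrite (@Ex_coord2 _ _ _ _ nu1 (h i) (h j) (fun a b => (o \in a)%:R * (o \in b)%:R)); last first.
    by rewrite (inj_eq hI).
  apply: le_trans (_ : Ex nu (fun f : {ffun I -> {set X}} => (o \in f (h i))%:R * p) <= _).
    apply: Ex_le => // f _ /=; under eq_bigr do rewrite mulrCA.
    by rewrite -mulr_sumr; apply: ler_wpM2l => //; apply: nup.
  rewrite ExZr (@Ex_coord _ _ _ _ nu1 (h i) (fun y => (o \in y)%:R)) expr2.
  by apply: ler_wpM2r => //; apply: nup.
apply: le_trans (_ : Ex nu (fun f : {ffun I -> {set X}} =>
   (disjoint_family (fun i => f (h i)))%:R +
   \sum_(i < r) \sum_(j | i != j) (~~ [disjoint f (h i) & f (h j)])%:R) <= _).
  rewrite -[X in X <= _](Ex_cst I nu1); apply: Ex_le => // f _.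
  have [_|nd] := boolP (disjoint_family _).
    by rewrite lerDl; apply: sumr_ge0 => i _; apply: sumr_ge0.
  have [i [j [ij nij]]] : exists i j, i != j /\ ~~ [disjoint f (h i) & f (h j)].
    apply: contrapT => no; case/negP: nd; apply/disjoint_familyP => i j ij.
    by apply: contrapT => /negP nij; apply: no; exists i, j.
  rewrite add0r (bigD1 i) //= (bigD1 j) //= nij -addrA lerDl addr_ge0 //.
    exact: sumr_ge0.
  by apply: sumr_ge0 => i' _; apply: sumr_ge0.
rewrite ExD lerD2l Ex_sum.
apply: le_trans (_ : \sum_(i < r) \sum_(j < r) #|X|%:R * p ^+ 2 <= _); last first.
  by rewrite !sumr_const !card_ord -mulrnA mulnn -[leLHS]mulr_natl.
apply: ler_sum => i _; rewrite Ex_sum big_mkcond; apply: ler_sum => j _.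
case: ifP => [/pair//|_]; by rewrite mulr_ge0 ?exprn_ge0.
Qed.

Lemma sumr_pred (R : realType) (T : finType) (P : pred T) :
  \sum_x (P x)%:R = #|[set x | P x]|%:R :> R.
Proof.
rewrite -sum1_card natr_sum [RHS]big_mkcond; apply: eq_bigr => x _.
by rewrite inE; case: (P x).
Qed.

Section LowerBound.
Variables (R : realType) (O : finType) (mu : {set O} -> R).
Hypotheses (mu_ge0 : forall y, 0 <= mu y) (mu_sum1 : \sum_y mu y = 1).
Variables (p K1 K2 theta : R).
Hypotheses (p_ge0 : 0 <= p) (K1_ge0 : 0 <= K1) (theta_ge0 : 0 <= theta) (K2_ge0 : 0 <= K2).
Hypothesis mu_size : forall y, 0 < mu y -> K1 <= #|y|%:R <= K2.
Hypothesis mu_sup : forall B : {set O}, prob mu (fun y => B \subset y) <= p ^+ #|B|.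
Hypothesis mu_avoid : forall U : {set O},
  prob mu (fun y => [disjoint y & U]) <= expR (- (theta * #|U|%:R)).
Let rho := p * K2.
Variables (I : finType) (r : nat) (h : 'I_r -> I).
Hypothesis hI : injective h.
Let A := [set h i | i in 'I_r].
Let n := #|I|.
Implicit Types f : {ffun I -> {set O}}.
Let fam f i := f (h i).
Let hA i : h i \in A. Proof. exact: imset_f. Qed.
Let cardCA : #|~: A| = (n - r)%N.
Proof. by rewrite cardsCs setCK card_imset ?card_ord. Qed.

(** Only neighbourhoods of exactly [d] vertices are counted, as the degrees below [k = d + 1] are
    asymptotically all equal to [d]. [q0] bounds from below the probability of avoiding all [r]
    sets, [qs] that of meeting exactly a prescribed one. *)
Variables (d : nat) (q0 qs : R).
Hypotheses (q0_ge0 : 0 <= q0) (q0_le1 : q0 <= 1) (qs_ge0 : 0 <= qs) (qs_le1 : qs <= 1).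
Hypothesis avoid_lb : forall U : {set O}, #|U|%:R <= r%:R * K2 ->
  q0 <= prob mu (fun y => [disjoint y & U]).
Hypothesis qs_le : qs <= 1 - expR (- (theta * K1)) - r%:R * rho ^+ 2.
Hypotheses (dN : (d <= n - r)%N) (N_gt0 : (0 < n - r)%N).

(* Summing over the possible neighbourhoods as an expectation under [nu] lets
   [disjoint_family_prob] bound their disjointness as well as that of the sets. *)
Let nu (X : {set I}) : R :=
  ((X \subset ~: A) && (#|X| == d))%:R / 'C(n - r, d)%:R.

Let C_gt0 : 0 < 'C(n - r, d)%:R :> R.
Proof. by rewrite ltr0n bin_gt0. Qed.

Let nu_ge0 X : 0 <= nu X.
Proof. by rewrite divr_ge0. Qed.

Let nu_sum1 : \sum_X nu X = 1.
Proof.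
rewrite -mulr_suml sumr_pred cards_draws cardCA divff //.
by rewrite gt_eqF.
Qed.

Let nu_mem i : prob nu (fun X => i \in X) <= d%:R / (n - r)%:R.
Proof.
have -> : prob nu (fun X => i \in X) =
    #|[set X : {set I} | [&& [set i] \subset X, X \subset ~: A & #|X| == d]]|%:R
      / 'C(n - r, d)%:R.
  rewrite -sumr_pred mulr_suml; apply: eq_bigr => X _.
  rewrite /nu sub1set mulrAC; congr (_ / _).
  by case: (_ && _); case: (_ \in _); rewrite ?mulr0 ?mulr1.
have [iA|iA] := boolP (i \in ~: A); last first.
  have -> : [set X : {set I} | [&& [set i] \subset X, X \subset ~: A & #|X| == d]] = set0.
    apply/setP => X; rewrite !inE sub1set; apply/negP => /and3P[iX XA _].
    by rewrite (subsetP XA _ iX) in iA.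
  by rewrite cards0 mul0r divr_ge0.
have [d0|d_gt0] := posnP d.
  have -> : [set X : {set I} | [&& [set i] \subset X, X \subset ~: A & #|X| == d]] = set0.
    apply/setP => X; rewrite !inE sub1set d0 cards_eq0; apply/negP => /and3P[iX _ /eqP X0].
    by rewrite X0 inE in iX.
  by rewrite cards0 mul0r divr_ge0.
rewrite card_draws_sup ?sub1set ?cards1 // cardCA.
rewrite ler_pdivrMr // mulrAC ler_pdivlMr ?ltr0n // -!natrM ler_nat.
by rewrite mulnC !subn1 mul_bin_diag prednK.
Qed.

Let matches (J : {ffun 'I_r -> {set I}}) j f (y : {set O}) :=
  [forall i, (~~ [disjoint y & fam f i]) == (j \in J i)].

Let fam_dep i : depends_on A (fun f => fam f i).
Proof. by move=> f g fg; rewrite /fam fg. Qed.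

Let matches_dep J j y : depends_on A (fun f => ((matches J j f y)%:R : R)).
Proof.
move=> f g fg; congr (_ %:R); congr (nat_of_bool _); apply: eq_forallb => i.
by rewrite (fam_dep i fg).
Qed.

Let disj_dep : depends_on A (fun f => ((disjoint_family (fam f))%:R : R)).
Proof.
move=> f g fg; congr (_ %:R); congr (nat_of_bool _).
apply: eq_forallb => i; apply: eq_forallb => j.
by rewrite (fam_dep i fg) (fam_dep j fg).
Qed.

(** When the [r] sets are disjoint, the only [J] outside [A] that matches every vertex is the family
    of actual neighbourhoods. Its weight under [nu] is ['C(n - r, d) ^- r] if all of them have [d]
    elements, and 0 otherwise. *)
Let low_ge f :
  (disjoint_family (fam f))%:R * Ex nu (fun J : {ffun 'I_r -> {set I}} =>
     (disjoint_family J)%:R * \prod_(j | j \notin A) (matches J j f (f j))%:R)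
  <= (low_degrees h d.+1 f)%:R / 'C(n - r, d)%:R ^+ r.
Proof.
have C_ge0 : 0 <= ('C(n - r, d)%:R ^+ r)^-1 :> R by rewrite invr_ge0 exprn_ge0.
have [fd|_] := boolP (disjoint_family (fam f)); last by rewrite mul0r mulr_ge0.
pose J0 := [ffun i => nbrs (meet_rel f) (h i)].
have prod_pos (J : {ffun 'I_r -> {set I}}) : 0 <= \prod_i nu (J i) by exact: prodr_ge0.
rewrite mul1r; apply: le_trans (_ : \prod_i nu (J0 i) <= _).
  rewrite /Ex (bigD1 J0) //= [X in _ + X]big1 ?addr0 => [|J JJ0].
    rewrite ler_piMr // mulr_ile1 ?prodr_ge0 ?prodr_ile1 //; first by case: disjoint_family.
    by move=> j _; rewrite ler0n lern1 leq_b1.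
  apply/eqP; rewrite !mulf_eq0; case: (boolP [forall i, J i \subset ~: A]); last first.
    rewrite negb_forall => /existsP[i /negPf JA].
    by rewrite (bigD1 i) //= /nu JA !mul0r eqxx.
  move=> /forallP JA; apply/orP; right; apply/orP; right.
  have [/forallP all_m|] := boolP [forall j, (j \notin A) ==> matches J j f (f j)]; last first.
    rewrite negb_forall => /existsP[j]; rewrite negb_imply => /andP[jA /negPf nm].
    by rewrite (bigD1 j) //= nm mul0r.
  case/eqP: JJ0; apply/ffunP => i; apply/setP => j; rewrite ffunE inE meet_relE.
  have [jA|jA] := boolP (j \in A).
    case/imsetP: jA => i' _ ->; rewrite (inj_eq hI).
    have /negPf -> : h i' \notin J i by apply/negP => /(subsetP (JA i)); rewrite inE hA.
    by case: eqVneq => //= ii'; rewrite (disjoint_familyP _ fd).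
  have := all_m j; rewrite jA => /forallP/(_ i)/eqP <-.
  have -> : h i != j by apply: contraNneq jA => <-.
  by rewrite disjoint_sym.
have -> : ('C(n - r, d)%:R ^+ r)^-1 = \prod_(i < r) 'C(n - r, d)%:R^-1 :> R.
  by rewrite prodr_const card_ord exprVn.
have [lo|] := boolP (low_degrees h d.+1 f).
  rewrite mul1r; apply: ler_prod => i _; rewrite nu_ge0 /= /nu.
  by rewrite ler_piMl ?invr_ge0 // lern1 leq_b1.
rewrite negb_forall => /existsP[i]; rewrite -leqNgt => di.
rewrite mul0r (bigD1 i) //= /nu ffunE.
have -> : #|nbrs (meet_rel f) (h i)| == d = false by apply/negP => /eqP E; rewrite E ltnn in di.
by rewrite andbF !mul0r.
Qed.

(** A vertex of [J i] fails to match only by avoiding the set of [h i], or by meeting that set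
    together with another one; the latter has probability at most [rho ^+ 2] for each other set. The
    remaining vertices have to avoid all [r] sets. *)
Let match_lb (J : {ffun 'I_r -> {set I}}) : disjoint_family J -> (forall i, #|J i| = d) ->
  qs ^+ (r * d) * q0 ^+ n * Ex mu (fun f => (disjoint_family (fam f))%:R) <=
  Ex mu (fun f => (disjoint_family (fam f))%:R *
    \prod_(j | j \notin A) (matches J j f (f j))%:R).
Proof.
move=> /disjoint_familyP Jd Jc.
rewrite (Ex_resample mu_sum1 disj_dep (fun j y => @matches_dep J j y)) -ExZ.
apply: Ex_le => // f f0; rewrite mulrC.
have [fd|_] := boolP (disjoint_family (fam f)); last by rewrite !mul0r.
rewrite !mul1r; move/disjoint_familyP: fd => fd.
have K2b i : #|fam f i|%:R <= K2 by have /andP[] := mu_size (f0 (h i)).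
apply: le_trans (_ : \prod_(j | j \notin A) (if j \in \bigcup_i J i then qs else q0) <= _); last first.
  apply: ler_prod => j jA; case: ifP => [/bigcupP[i _ ji]|nj].
    rewrite qs_ge0 /=; apply: le_trans qs_le _.
    pose both i' (y : {set O}) := ~~ [disjoint y & fam f i] && ~~ [disjoint y & fam f i'].
    have cover : 1 <= prob mu (fun y => [disjoint y & fam f i]) +
       \sum_(i' | i' != i) prob mu (both i') + prob mu (matches J j f).
      rewrite -mu_sum1 /prob exchange_big -!big_split; apply: ler_sum => y _ /=.
      rewrite -mulr_sumr -!mulrDr ler_peMr //.
      have [_|hit] := boolP [disjoint y & fam f i].
        by rewrite -addrA lerDl addr_ge0 ?sumr_ge0.
      rewrite add0r; have [m|] := boolP (matches J j f y).
        by rewrite lerDr sumr_ge0.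
      rewrite negb_forall addr0 => /existsP[i']; have [->|i'i] := eqVneq i' i.
        by rewrite hit ji.
      have -> : (j \in J i') = false.
        by apply/negP => ji'; have /pred0P/(_ j) := Jd _ _ i'i; rewrite /= ji ji'.
      rewrite eqbF_neg negbK => hit'.
      by rewrite (bigD1 i') //= /both hit hit' lerDl sumr_ge0.
    have le1 : prob mu (fun y => [disjoint y & fam f i]) <= expR (- (theta * K1)).
      apply: le_trans (mu_avoid _) _; rewrite ler_expR lerN2 ler_wpM2l //.
      by have /andP[] := mu_size (f0 (h i)).
    have le2 : \sum_(i' | i' != i) prob mu (both i') <= r%:R * rho ^+ 2.
      rewrite -[r in r%:R]card_ord mulr_natl -sumr_const big_mkcond /=.
      apply: ler_sum => i' _; case: ifP => [i'i|_]; last exact: exprn_ge0 (mulr_ge0 _ _).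
      have := @prob_hit_all _ _ _ mu_ge0 _ _ p_ge0 K2_ge0 mu_sup set0 [:: fam f i; fam f i'].
      rewrite cards0 mul1r /= => le; apply: le_trans (le _ _).
      - by apply: prob_le => // y _ /andP[]; rewrite sub0set => -> ->.
      - by rewrite !andbT -!setI_eq0 !set0I eqxx setI_eq0 fd // eq_sym.
      - move=> X; rewrite !inE => /orP[] /eqP->; apply: K2b.
    suff : 1 - expR (- (theta * K1)) - r%:R * rho ^+ 2 <= prob mu (matches J j f) by [].
    by move: cover le1 le2; lra.
  rewrite q0_ge0 /=; apply: le_trans (avoid_lb (U := \bigcup_i fam f i) _) _.
    apply: le_trans (_ : (\sum_i #|fam f i|)%:R <= _); first by rewrite ler_nat leq_card_bigcup.
    rewrite natr_sum -[r in r%:R]card_ord mulr_natl -sumr_const.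
    by apply: ler_sum => i _; have /andP[] := mu_size (f0 (h i)).
  apply: prob_le => // y _ yU; apply/forallP => i.
  have -> : (j \in J i) = false by apply/negP => ji; case/bigcupP: nj; exists i.
  rewrite eqbF_neg negbK; apply: disjointWr yU; exact: bigcup_sup.
rewrite (bigID (fun j => j \in \bigcup_i J i)) /=; apply: ler_pM; rewrite ?exprn_ge0 //.
  rewrite (eq_bigr (fun=> qs)) => [|j /andP[_ ->] //].
  rewrite prodr_const; apply: ler_wiXn2l => //.
  apply: leq_trans (_ : #|\bigcup_i J i| <= _)%N.
    by apply/subset_leq_card/subsetP => j; rewrite unfold_in => /andP[].
  apply: leq_trans (leq_card_bigcup _) _.
  by under eq_bigr do rewrite Jc; rewrite sum_nat_const card_ord.
rewrite (eq_bigr (fun=> q0)) => [|j /andP[_ /negPf->] //].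
by rewrite prodr_const; apply: ler_wiXn2l => //; apply: max_card.
Qed.

Lemma low_degree_lower (n_pos : (0 < n)%N)
  (s1 := 1 - (r ^ 2)%:R * (#|O|%:R * p ^+ 2))
  (s2 := 1 - (r ^ 2)%:R * (n%:R * (d%:R / (n - r)%:R) ^+ 2)) :
  0 <= s1 -> 0 <= s2 ->
  'C(n - r, d)%:R ^+ r * (s2 * (qs ^+ (r * d) * q0 ^+ n * s1)) <=
  Ex mu (fun f => (low_degrees h d.+1 f)%:R).
Proof.
move=> s1_ge0 s2_ge0.
have Cr : 0 < 'C(n - r, d)%:R ^+ r :> R by rewrite exprn_gt0.
rewrite mulrC -ler_pdivlMr // -ExZr.
apply: le_trans (_ : Ex mu (fun f => (disjoint_family (fam f))%:R * Ex nu (fun J : {ffun 'I_r -> {set I}} =>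
     (disjoint_family J)%:R * \prod_(j | j \notin A) (matches J j f (f j))%:R)) <= _); last first.
  by apply: Ex_le => // f _; apply: low_ge.
under eq_Ex do rewrite -ExZ.
(* With [J] outermost, [match_lb] applies to each disjoint [J], and [nu] gives those a total weight
   of at least [s2]. *)
rewrite Ex_exchange.
apply: le_trans (_ : Ex nu (fun J : {ffun 'I_r -> {set I}} =>
   (disjoint_family J)%:R * (qs ^+ (r * d) * q0 ^+ n * s1)) <= _).
  rewrite ExZr ler_wpM2r ?mulr_ge0 ?exprn_ge0 //.
  by apply: (@disjoint_family_prob _ _ _ _ _ id) => //; rewrite divr_ge0.
apply: Ex_le => // J J0; have [Jd|_] := boolP (disjoint_family J); last first.
  by rewrite mul0r; apply: Ex_ge0 => // f; rewrite !mulr_ge0 ?prodr_ge0.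
rewrite mul1r; apply: le_trans (_ : qs ^+ (r * d) * q0 ^+ n *
    Ex mu (fun f => (disjoint_family (fam f))%:R) <= _).
  apply: ler_wpM2l; first by rewrite mulr_ge0 ?exprn_ge0.
  apply: disjoint_family_prob => // o.
  have := mu_sup [set o]; rewrite cards1 expr1.
  by apply: le_trans; apply: prob_le => // y _; rewrite sub1set.
apply: le_trans (match_lb Jd _) _.
  move=> i; have := J0 i; rewrite /nu; case: eqP => // _.
  by rewrite andbF mul0r ltxx.
by apply: Ex_le => // f _; rewrite mul1r.
Qed.

End LowerBound.

(** * Union bound over the separations of the graph *)

Lemma Ex_union (R : realFieldType) (T I J : finType) (mu : T -> R) (P : pred J)
    (Q : {ffun I -> T} -> bool) (Q' : J -> {ffun I -> T} -> bool) :
  (forall y, 0 <= mu y) ->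
  (forall f : {ffun I -> T}, (forall i, 0 < mu (f i)) -> Q f -> exists2 j, P j & Q' j f) ->
  Ex mu (fun f : {ffun I -> T} => (Q f)%:R) <=
  \sum_(j | P j) Ex mu (fun f : {ffun I -> T} => (Q' j f)%:R).
Proof.
move=> mu0 QQi; rewrite -Ex_sum; apply: Ex_le => // f f0.
case Qf : (Q f); last exact: sumr_ge0.
have [j Pj Qj] := QQi f f0 Qf.
by rewrite (bigD1 j) //= Qj lerDl sumr_ge0.
Qed.

Lemma Ex_or (R : realFieldType) (T I : finType) (mu : T -> R)
    (Q Q1 Q2 : {ffun I -> T} -> bool) :
  (forall y, 0 <= mu y) ->
  (forall f : {ffun I -> T}, (forall i, 0 < mu (f i)) -> Q f -> Q1 f || Q2 f) ->
  Ex mu (fun f : {ffun I -> T} => (Q f)%:R) <=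
  Ex mu (fun f : {ffun I -> T} => (Q1 f)%:R) + Ex mu (fun f : {ffun I -> T} => (Q2 f)%:R).
Proof.
move=> mu0 QQ; rewrite -ExD; apply: Ex_le => // f f0; rewrite -natrD ler_nat.
have := QQ f f0; case: (Q f) => [/(_ isT)|_]; last by [].
by case: (Q1 f) => /= [_|->] //; rewrite leq_addr.
Qed.

Lemma sumr_draws (R : pzRingType) (T : finType) (a : nat) (x : R) :
  \sum_(A : {set T} | #|A| == a) x = 'C(#|T|, a)%:R * x.
Proof.
by rewrite -card_draws mulr_natl -sumr_const; apply: eq_bigl => A; rewrite inE.
Qed.

Lemma subset_of_card (T : finType) (A : {set T}) (m : nat) : (m <= #|A|)%N ->
  exists2 B : {set T}, B \subset A & #|B| = m.
Proof.
move=> mA; have : (0 < #|[set B : {set T} | (B \subset A) && (#|B| == m)]|)%N.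
  by rewrite cards_draws bin_gt0.
by rewrite card_gt0 => /set0Pn[B]; rewrite inE => /andP[BA /eqP]; exists B.
Qed.

Lemma superset_of_card (T : finType) (A : {set T}) (m : nat) : (#|A| <= m <= #|T|)%N ->
  exists2 B : {set T}, A \subset B & #|B| = m.
Proof.
case/andP=> Am mT; have [|B BA Bm] := @subset_of_card _ (~: A) (#|T| - m).
  by rewrite cardsCs setCK leq_sub2l.
exists (~: B); first by rewrite subsetC.
by rewrite cardsCs setCK Bm subKn.
Qed.

Section SeparationBounds.
Variables (R : realType) (O : finType) (mu : {set O} -> R).
Hypotheses (mu_ge0 : forall y, 0 <= mu y) (mu_sum1 : \sum_y mu y = 1).
Variables (p K2 theta : R) (kappa : nat).
Hypotheses (p_ge0 : 0 <= p) (theta_ge0 : 0 <= theta) (K2_ge0 : 0 <= K2).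
Hypothesis mu_size : forall y, 0 < mu y -> #|y|%:R <= K2.
Hypothesis mu_sup : forall B : {set O}, prob mu (fun y => B \subset y) <= p ^+ #|B|.
Hypothesis mu_avoid : forall U : {set O},
  prob mu (fun y => [disjoint y & U]) <= expR (- (theta * #|U|%:R)).
Hypothesis mu_inside : forall Z : {set O},
  prob mu (fun y => y \subset Z) <= (#|Z|%:R / #|O|%:R) ^+ kappa.
Let rho := p * K2.
Let rho_pos : 0 <= rho. Proof. exact: mulr_ge0. Qed.
Variable I : finType.
Let n := #|I|.
Let m := #|O|.
Implicit Types (f : {ffun I -> {set O}}) (A W : {set I}).

Definition union_of f A := \bigcup_(i in A) f i.

Lemma union_of_dep A : depends_on A (fun f => union_of f A).
Proof. by move=> f g fg; apply: eq_bigr => i /fg. Qed.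

Lemma card_union_of f A : (forall i, 0 < mu (f i)) ->
  #|union_of f A|%:R <= #|A|%:R * K2.
Proof.
move=> f0; apply: le_trans (_ : \sum_(i in A) #|f i|%:R <= _).
  rewrite -natr_sum ler_nat /union_of; elim/big_rec2: _ => [|i l B _ le].
    by rewrite cards0.
  by rewrite (leq_trans (leq_card_setU _ _)) // leq_add2l.
by rewrite mulr_natl -sumr_const; apply: ler_sum => i _; apply: mu_size.
Qed.

Definition small_union (a z : nat) f :=
  [exists A : {set I}, (#|A| == a) && (#|union_of f A| <= z)%N].

(** A union of at most [z] objects lies in some [Z] of exactly [z] objects; for fixed [Z] the [a]
    sets are inside it independently. *)
Lemma small_union_prob (a z : nat) : (z <= m)%N ->
  Ex mu (fun f => (small_union a z f)%:R) <=
  'C(n, a)%:R * ('C(m, z)%:R * ((z%:R / m%:R) ^+ kappa) ^+ a).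
Proof.
move=> zm.
apply: le_trans (_ : \sum_(A : {set I} | #|A| == a)
   Ex mu (fun f => (#|union_of f A| <= z)%N%:R) <= _).
  by apply: Ex_union => // f _ /existsP[A /andP[Aa Az]]; exists A.
apply: le_trans (_ : \sum_(A : {set I} | #|A| == a)
  ('C(m, z)%:R * ((z%:R / m%:R) ^+ kappa) ^+ a) <= _); last first.
  by rewrite sumr_draws.
apply: ler_sum => A /eqP Aa.
apply: le_trans (_ : \sum_(Z : {set O} | #|Z| == z)
   Ex mu (fun f => [forall i in A, f i \subset Z]%:R) <= _).
  apply: Ex_union => // f _ Az.
  have [|Z ZU Zz] := @superset_of_card _ (union_of f A) z; first by rewrite Az.
  exists Z; first by rewrite Zz.
  apply/forall_inP => i iA; apply: subset_trans ZU.
  exact: (bigcup_sup i).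
apply: le_trans (_ : \sum_(Z : {set O} | #|Z| == z) ((z%:R / m%:R) ^+ kappa) ^+ a <= _); last first.
  by rewrite sumr_draws.
apply: ler_sum => Z /eqP Zz.
rewrite (@eq_Ex _ _ mu _ _ (fun f => \prod_i (if i \in A then (f i \subset Z)%:R else 1))); last first.
  move=> f; case: (boolP [forall i in A, _]) => [/forall_inP fZ|].
    by rewrite big1 // => i _; case: ifP => // iA; rewrite fZ.
  rewrite negb_forall_in => /exists_inP[i iA /negPf fi].
  by rewrite (bigD1 i) //= iA fi mul0r.
rewrite (@Ex_prod _ _ mu _ (fun i y => if i \in A then (y \subset Z)%:R else 1)).
apply: le_trans (_ : \prod_i (if i \in A then (z%:R / m%:R) ^+ kappa else 1) <= _).
  apply: ler_prod => i _; case: ifP => iA.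
    rewrite prob_ge0 //=; apply: le_trans (mu_inside Z) _.
    by rewrite Zz.
  by under eq_bigr do rewrite mulr1; rewrite mu_sum1 ler01 lexx.
by rewrite -big_mkcond prodr_const Aa.
Qed.

Lemma growing_dep (s : seq I) :
  depends_on [set i in s] (fun f => growing (meet_rel f) s).
Proof.
elim: s => // x s IH f g fg /=.
have fg' : {in [set i in s], f =1 g}.
  by move=> i; rewrite inE => si; apply: fg; rewrite !inE si orbT.
rewrite (IH f g fg'); congr (_ && (_ || _)).
apply: eq_in_has => y ys; rewrite /meet_rel.
by rewrite fg ?mem_head ?inE ?eqxx // fg ?inE ?ys ?orbT.
Qed.

(** Given the earlier sets, each new vertex has to meet a union of at most [size s * K2] objects;
    the first vertex is free. *)
Lemma growing_prob (s : seq I) : uniq s ->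
  Ex mu (fun f => (growing (meet_rel f) s)%:R) <= ((size s)%:R * rho) ^+ (size s).-1.
Proof.
elim: s => [|x s IH]; first by rewrite /= Ex_cst.
move=> /andP[xs su]; case: (posnP (size s)) => [/size0nil->|s0].
  by under eq_Ex do rewrite /=; rewrite Ex_cst.
pose A := [set i in s].
apply: le_trans (_ : Ex mu (fun f => (growing (meet_rel f) s)%:R *
   (~~ [disjoint f x & union_of f A])%:R) <= _).
  apply: Ex_le => // f _; rewrite /=; case: growing; rewrite ?mul0r //= mul1r.
  have -> /= : (s == [::]) = false by case: (s) s0.
  case: hasP => [[y ys]|] //=; rewrite meet_relE => /andP[_ /pred0Pn[o /andP[ox oy]]].
  rewrite ler1n lt0b; apply/pred0Pn; exists o; apply/andP; split => //.
  by apply/bigcupP; exists y; rewrite ?inE.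
rewrite (@Ex_resample1 _ _ _ _ mu_sum1 A _ x (fun f y => (~~ [disjoint y & union_of f A])%:R)); last first.
- by move=> y f g fg; rewrite (union_of_dep fg).
- by move=> f g fg; rewrite (growing_dep fg).
- by rewrite inE.
apply: le_trans (_ : Ex mu (fun f => (growing (meet_rel f) s)%:R * ((size s)%:R * rho)) <= _).
  apply: Ex_le => // f f0; apply: ler_wpM2l => //.
  apply: le_trans (prob_hit mu_ge0 mu_sup _) _; rewrite /rho mulrCA ler_wpM2l //.
  by apply: le_trans (card_union_of _ f0) _; rewrite cardsE (card_uniqP su).
have le_base : (size s)%:R * rho <= (size s).+1%:R * rho by rewrite ler_wpM2r // ler_nat.
rewrite ExZr /= -{3}(prednK s0) exprSr; apply: ler_pM; rewrite ?mulr_ge0 ?Ex_ge0 //.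
apply: le_trans (IH su) _.
by apply: lerXn2r; rewrite ?nnegrE ?mulr_ge0.
Qed.

Definition separated A W f :=
  [forall w in W, ~~ [disjoint f w & union_of f A]] &&
  [forall j, (j \notin A :|: W) ==> [disjoint f j & union_of f A]].

(** Given the sets in [A], each vertex of [W] hits their union and every other vertex avoids it,
    independently. [C] carries a further condition inside [A]: growing for small [A], none for large
    [A]. *)
Lemma separated_prob A W (C : {ffun I -> {set O}} -> bool) (u : R) :
  depends_on A C -> [disjoint A & W] ->
  Ex mu (fun f => [&& C f, u <= #|union_of f A|%:R & separated A W f]%:R) <=
  Ex mu (fun f => (C f)%:R) * ((#|A|%:R * rho) ^+ #|W| *
     expR (- (theta * u)) ^+ (n - #|A| - #|W|)).
Proof.
move=> C_dep AW.
pose G j f (y : {set O}) : R :=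
  (if j \in W then ~~ [disjoint y & union_of f A] else [disjoint y & union_of f A])%:R.
pose F f : R := (C f && (u <= #|union_of f A|%:R))%:R.
have WA j : j \in W -> j \notin A.
  by move=> jW; apply/negP => jA; have /pred0P/(_ j) := AW; rewrite /= jA jW.
apply: le_trans (_ : Ex mu (fun f => F f * \prod_(j | j \notin A) G j f (f j)) <= _).
  apply: Ex_le => // f _; rewrite /F.
  have G_ge0 : 0 <= \prod_(j | j \notin A) G j f (f j) by apply: prodr_ge0.
  case: (C f) => /=; last by rewrite mul0r.
  case: (u <= _) => /=; last by rewrite mul0r.
  have [/andP[/forall_inP hitW /forallP avoid]|_] := boolP (separated _ _ _); last by rewrite mul1r.
  rewrite mul1r big1 // => j jA; rewrite /G; case: ifP => jW.
    by rewrite hitW.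
  by have := avoid j; rewrite in_setU jW orbF jA /= => ->.
rewrite (Ex_resample (G := G) mu_sum1); last first.
- by move=> j y f g fg; rewrite /G (union_of_dep fg).
- by move=> f g fg; rewrite /F (C_dep _ _ fg) (union_of_dep fg).
rewrite -ExZr; apply: Ex_le => // f f0; rewrite /F.
case: (C f) => /=; last by rewrite !mul0r.
have rhs_ge0 : 0 <= (#|A|%:R * rho) ^+ #|W| * expR (- (theta * u)) ^+ (n - #|A| - #|W|).
  by rewrite mulr_ge0 ?exprn_ge0 ?mulr_ge0 ?expR_ge0.
case: (leP u) => uU /=; last by rewrite mul0r mul1r.
rewrite !mul1r.
apply: le_trans (_ : \prod_(j | j \notin A) (if j \in W then #|A|%:R * rho else expR (- (theta * u))) <= _).
  apply: ler_prod => j jA; rewrite sumr_ge0 /=; last by move=> y _; rewrite mulr_ge0.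
  rewrite /G; case: ifP => jW.
    apply: le_trans (prob_hit mu_ge0 mu_sup _) _; rewrite /rho mulrCA ler_wpM2l //.
    exact: card_union_of.
  by apply: le_trans (mu_avoid _) _; rewrite ler_expR lerN2 ler_wpM2l.
rewrite (bigID (mem W)) /= le_eqVlt; apply/orP; left; apply/eqP; congr (_ * _).
  rewrite (eq_bigr (fun=> #|A|%:R * rho)) => [|j /andP[_ ->] //].
  rewrite prodr_const; congr (_ ^+ _); apply: eq_card => j; rewrite unfold_in /=.
  by case: (boolP (j \in W)) => [/WA->|]; rewrite ?andbF.
rewrite (eq_bigr (fun=> expR (- (theta * u)))) => [|j /andP[_ /negPf->] //].
rewrite prodr_const; congr (_ ^+ _).
have <- : #|~: (A :|: W)| = (n - #|A| - #|W|)%N.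
  by rewrite cardsCs setCK cardsU disjoint_setI0 // cards0 subn0 subnDA.
by apply: eq_card => j; rewrite unfold_in /= !inE negb_or.
Qed.

Lemma sum_separated_prob A (C : {ffun I -> {set O}} -> bool) (u : R) (k N : nat) :
  0 <= u -> depends_on A C ->
  \sum_(W : {set I} | [&& [disjoint A & W], (#|W| < k)%N & (N <= n - #|A| - #|W|)%N])
    Ex mu (fun f => [&& C f, u <= #|union_of f A|%:R & separated A W f]%:R) <=
  Ex mu (fun f => (C f)%:R) * ((1 + n%:R * (#|A|%:R * rho)) ^+ k * expR (- (theta * u)) ^+ N).
Proof.
move=> u0 C_dep.
have EC : 0 <= Ex mu (fun f => (C f)%:R) by apply: Ex_ge0.
have e01 : 0 <= expR (- (theta * u)) <= 1.
  by rewrite expR_ge0 -expR0 ler_expR oppr_le0 mulr_ge0.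
apply: le_trans (_ : \sum_(W : {set I} | (W \subset setT) && (#|W| <= k)%N)
   Ex mu (fun f => (C f)%:R) * ((#|A|%:R * rho) ^+ #|W| * expR (- (theta * u)) ^+ N) <= _).
  rewrite big_mkcond [leRHS]big_mkcond; apply: ler_sum => W _.
  case: ifP => [/and3P[AW Wk WN]|_]; last first.
    by case: ifP => // _; rewrite !mulr_ge0 ?exprn_ge0 ?mulr_ge0 ?expR_ge0.
  rewrite subsetT ltnW //; apply: le_trans (separated_prob _ C_dep AW) _.
  rewrite !ler_wpM2l ?exprn_ge0 ?mulr_ge0 //.
  by apply: ler_wiXn2l => //; case/andP: e01.
rewrite -mulr_sumr ler_wpM2l // -mulr_suml ler_wpM2r ?exprn_ge0 ?expR_ge0 //.
apply: le_trans (@sum_small_subsets _ _ setT k _ _) _; first exact: mulr_ge0.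
by rewrite cardsT.
Qed.

(* With high probability, [a] sets whose sizes are at least [kappa] have a
   union of more than [cut_size a] objects, as long as [a] is small compared
   with [#|O| / kappa]. *)
Definition cut_size (a : nat) : R := 3%:R / 4%:R * (a * kappa)%:R.

Let cut_floor (a : nat) : nat := ((3 * (a * kappa)) %/ 4)%N.

(** The three sums bound three events that cover the left side: some union of at most [M] sets is
    too small; a separated set with [2 <= #|A| <= a1] is enumerated growingly; a separated set has
    more than [a1] elements. Beyond [M] elements the union is bounded below through a part of [A]
    with [M] elements. The exponent [(n - k)./2] comes from the far side being at least as large as
    [A]. *)
Lemma disconnected_prob (k M a1 : nat) :
  (k < n)%N -> (a1 <= M)%N -> (cut_floor M <= m)%N ->
  Ex mu (fun f => (`[< ~ k_connected k (meet_rel f) >] &&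
      [forall v, (k <= #|nbrs (meet_rel f) v|)%N])%:R) <=
  \sum_(a < M) 'C(n, a.+1)%:R *
     ('C(m, cut_floor a.+1)%:R * (((cut_floor a.+1)%:R / m%:R) ^+ kappa) ^+ a.+1) +
  (\sum_(a < a1.+1 | (1 < a)%N) (n%:R ^+ a * (a%:R * rho) ^+ a.-1) *
     ((1 + n%:R * (a%:R * rho)) ^+ k * expR (- (theta * cut_size a)) ^+ (n - a1 - k)) +
   \sum_(a < n.+1 | (a1 < a)%N) 'C(n, a)%:R *
     ((1 + n%:R * (a%:R * rho)) ^+ k * expR (- (theta * cut_size (minn a M))) ^+ ((n - k)./2))).
Proof.
move=> kn a1M Mm.
pose small f := [exists a : 'I_M, small_union a.+1 (cut_floor a.+1) f].
pose event A W (C : {ffun I -> {set O}} -> bool) (u : R) f :=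
  [&& C f, u <= #|union_of f A|%:R & separated A W f].
pose PW A N := [pred W : {set I} | [&& [disjoint A & W], (#|W| < k)%N & (N <= n - #|A| - #|W|)%N]].
pose grown (a : nat) f := [exists s : a.-tuple I, uniq s &&
   [exists W in PW [set i in s] (n - a1 - k)%N,
     event [set i in s] W (fun f => growing (meet_rel f) s) (cut_size a) f]].
pose grown_any f := [exists a : 'I_a1.+1, (1 < a)%N && grown a f].
pose big (a : nat) f := [exists A : {set I}, (#|A| == a) &&
   [exists W in PW A ((n - k)./2), event A W (fun=> true) (cut_size (minn a M)) f]].
pose big_any f := [exists a : 'I_n.+1, (a1 < a)%N && big a f].
apply: le_trans (_ : Ex mu (fun f => (small f)%:R) +
    Ex mu (fun f => (grown_any f || big_any f)%:R) <= _).
  apply: Ex_or => // f f0 /andP[/asboolP nkc /forallP mindeg].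
  have sym : symmetric (meet_rel f).
    by move=> i j; rewrite /meet_rel eq_sym setIC.
  have irr : irreflexive (meet_rel f) by move=> i; rewrite /meet_rel eqxx.
  case: (minimal_separation sym irr kn nkc) => [[v]|]; first by rewrite ltnNge mindeg.
  case=> s [W [[su sg s1] [Wk AW] Whit Aavoid sB]].
  case: (boolP (small f)) => //=; rewrite negb_exists => /forallP nsmall.
  set A := [set x in s] in AW Whit Aavoid sB *.
  have As : #|A| = size s by rewrite cardsE (card_uniqP su).
  have cardB : #|~: (A :|: W)| = (n - #|A| - #|W|)%N.
    by rewrite cardsCs setCK cardsU disjoint_setI0 // cards0 subn0 subnDA.
  have union_lb (A' : {set I}) : (#|A'| <= M)%N -> cut_size #|A'| <= #|union_of f A'|%:R.
    move=> A'M; have [->|A'0] := posnP #|A'|; first by rewrite /cut_size mul0n mulr0.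
    have aM : (#|A'|.-1 < M)%N by rewrite prednK.
    have := nsmall (Ordinal aM); rewrite /= negb_exists => /forallP/(_ A').
    rewrite /= prednK // eqxx /= -ltnNge /cut_floor => lt4.
    rewrite /cut_size mulrAC ler_pdivrMr // -!natrM ler_nat; lia.
  have u_lb : cut_size (minn (size s) M) <= #|union_of f A|%:R.
    case: (leqP (size s) M) => sM; first by rewrite -As union_lb ?As.
    have [|A' A'A A'M] := @subset_of_card _ A M; first by rewrite As ltnW.
    apply: le_trans (_ : #|union_of f A'|%:R <= _).
      by rewrite -A'M union_lb ?A'M.
    rewrite ler_nat; apply/subset_leq_card/bigcupsP => i iA'.
    by apply: (bigcup_sup i); apply: (subsetP A'A).
  have sep : separated A W f.
    apply/andP; split.
      apply/forall_inP => w wW; have [a aA] := Whit w wW.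
      rewrite meet_relE => /andP[_ /pred0Pn[o /andP[ow oa]]].
      by apply/pred0Pn; exists o; apply/andP; split=> //; apply/bigcupP; exists a.
    apply/forallP => j; apply/implyP => jAW.
    apply/pred0P => o; apply/negP => /andP[oj /bigcupP[a aA oa]].
    have /negP := Aavoid a j aA jAW; apply.
    rewrite meet_relE; apply/andP; split.
      by apply: contraNneq jAW => <-; rewrite in_setU aA.
    by apply/pred0Pn; exists o; apply/andP.
  rewrite cardB in sB.
  have [sa1|sa1] := leqP (size s) a1.
    apply/orP; left; apply/existsP; exists (Ordinal (sa1 : (size s < a1.+1)%N)).
    rewrite /= s1; apply/existsP; exists (in_tuple s); rewrite /= su /=.
    apply/existsP; exists W; rewrite !inE -/A AW Wk /= /event -/A sg sep andbT /=.
    apply/andP; split; first by rewrite As; lia.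
    by move: u_lb; have -> : minn (size s) M = size s by apply/minn_idPl; apply: leq_trans a1M.
  have sn : (size s < n.+1)%N by rewrite ltnS -As max_card.
  apply/orP; right; apply/existsP; exists (Ordinal sn); rewrite /= sa1 /=.
  apply/existsP; exists A; rewrite As eqxx /=.
  apply/existsP; exists W; rewrite !inE AW Wk /= /event sep u_lb /= andbT.
  by move: sB; rewrite As; lia.
apply: lerD.
  apply: le_trans (Ex_union (P := predT) (Q' := fun (a : 'I_M) f => small_union a.+1 (cut_floor a.+1) f) mu_ge0 _) _.
    by move=> f _ /existsP[a]; exists a.
  apply: ler_sum => a _; apply: small_union_prob.
  apply: leq_trans Mm; apply: leq_div2r; rewrite leq_mul2l leq_mul2r.
  by rewrite ltn_ord orbT.
apply: le_trans (Ex_or (Q1 := grown_any) (Q2 := big_any) mu_ge0 _) _ => //.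
apply: lerD.
  apply: le_trans (Ex_union (P := fun a : 'I_a1.+1 => (1 < a)%N) (Q' := fun a : 'I_a1.+1 => grown a) mu_ge0 _) _.
    by move=> f _ /existsP[a /andP[a1' ga]]; exists a.
  apply: ler_sum => a a_gt1.
  apply: le_trans (Ex_union (P := fun s : a.-tuple I => uniq s)
    (Q' := fun s f => [exists W in PW [set i in s] (n - a1 - k)%N,
     event [set i in s] W (fun f => growing (meet_rel f) s) (cut_size a) f]) mu_ge0 _) _.
    by move=> f _ /existsP[s /andP[us es]]; exists s.
  have rhs_ge0 : 0 <= (a%:R * rho) ^+ a.-1 *
     ((1 + n%:R * (a%:R * rho)) ^+ k * expR (- (theta * cut_size a)) ^+ (n - a1 - k)).
    by rewrite !mulr_ge0 ?exprn_ge0 ?mulr_ge0 ?addr_ge0 ?mulr_ge0 ?expR_ge0.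
  apply: le_trans (_ : \sum_(s : a.-tuple I) ((a%:R * rho) ^+ a.-1 *
     ((1 + n%:R * (a%:R * rho)) ^+ k * expR (- (theta * cut_size a)) ^+ (n - a1 - k))) <= _); last first.
    by rewrite sumr_const card_tuple -[_ *+ _]mulr_natl natrX mulrA.
  rewrite big_mkcond; apply: ler_sum => s _; case: ifP => // us.
  apply: le_trans (Ex_union (P := PW [set i in s] (n - a1 - k)%N) (Q' := fun W f =>
     event [set i in s] W (fun f => growing (meet_rel f) s) (cut_size a) f) mu_ge0 _) _.
    by move=> f _ /existsP[W /andP[PWW ev]]; exists W.
  have As : #|[set i in s]| = a by rewrite cardsE (card_uniqP us) size_tuple.
  apply: le_trans (sum_separated_prob _ _ _ (@growing_dep s)) _.
    by rewrite /cut_size mulr_ge0 ?divr_ge0.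
  rewrite As; apply: ler_wpM2r.
    by rewrite !mulr_ge0 ?exprn_ge0 ?mulr_ge0 ?addr_ge0 ?mulr_ge0 ?expR_ge0.
  by have := growing_prob us; rewrite size_tuple.
apply: le_trans (Ex_union (P := fun a : 'I_n.+1 => (a1 < a)%N) (Q' := fun a : 'I_n.+1 => big a) mu_ge0 _) _.
  by move=> f _ /existsP[a /andP[a1' ga]]; exists a.
apply: ler_sum => a a_gt1.
apply: le_trans (Ex_union (P := fun A : {set I} => #|A| == a)
    (Q' := fun A f => [exists W in PW A (n - k)./2, event A W (fun=> true) (cut_size (minn a M)) f]) mu_ge0 _) _.
  by move=> f _ /existsP[A /andP[Aa ev]]; exists A.
rewrite -sumr_draws; apply: ler_sum => A /eqP Aa.
apply: le_trans (Ex_union (P := PW A (n - k)./2) (Q' := fun W f =>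
   event A W (fun=> true) (cut_size (minn a M)) f) mu_ge0 _) _.
  by move=> f _ /existsP[W /andP[PWW ev]]; exists W.
apply: le_trans (sum_separated_prob _ _ _ _) _ => //.
  by rewrite /cut_size mulr_ge0 ?divr_ge0.
by rewrite Ex_cst // mul1r Aa.
Qed.

End SeparationBounds.

(** * Ratios of binomials, and the law of a set that is uniform given its size *)

Lemma bin_sup_le (m s b : nat) : (b <= s)%N -> (s <= m)%N ->
  ('C(m - b, s - b) * m ^ b <= 'C(m, s) * s ^ b)%N.
Proof.
elim: b => [|b IH] bs sm; first by rewrite !subn0 !expn0.
have mb : (0 < m - b)%N by lia.
have := mul_bin_diag (m - b) (s - b.+1).
rewrite -subnS; have -> : (s - b.+1).+1 = (s - b)%N by lia.
move=> E; rewrite -(leq_pmul2l mb) mulnA E !expnSr.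
have := IH (ltnW bs) sm => le.
have le2 : ((s - b) * m <= (m - b) * s)%N by rewrite !mulnBl mulnC leq_sub2l // leq_mul2l sm orbT.
have := leq_mul le le2; nia.
Qed.

Lemma bin_inside_le (m z s : nat) : (z <= m)%N ->
  ('C(z, s) * m ^ s <= 'C(m, s) * z ^ s)%N.
Proof.
move=> zm; elim: s => [|s IH]; first by rewrite !bin0.
rewrite -(leq_pmul2l (ltn0Sn s)) !mulnA !mul_bin_left !expnSr.
have le2 : ((z - s) * m <= (m - s) * z)%N.
  by rewrite !mulnBl (mulnC z m) leq_sub2l // leq_mul2l zm orbT.
have := leq_mul IH le2; nia.
Qed.

(** The factors [(m - u - i) / (m - i)], [i < t], of the ratio of binomials decrease with [i]; each
    is compared with the value at [i = s]. *)
Lemma bin_avoid_ge (m u s t : nat) : (u + s <= m)%N -> (t <= s)%N ->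
  ('C(m, t) * (m - s - u) ^ t <= 'C(m - u, t) * (m - s) ^ t)%N.
Proof.
move=> usm; elim: t => [|t IH] ts; first by rewrite !bin0.
rewrite -(leq_pmul2l (ltn0Sn t)) !mulnA !mul_bin_left !expnSr.
have le2 : ((m - t) * (m - s - u) <= (m - u - t) * (m - s))%N.
  have [c mE] : exists c, m = (u + s + c)%N by exists (m - (u + s))%N; lia.
  have [e sE] : exists e, s = (t + e)%N by exists (s - t)%N; lia.
  have -> : (m - t = u + e + c)%N by lia.
  have -> : (m - s - u = c)%N by lia.
  have -> : (m - u - t = e + c)%N by lia.
  have -> : (m - s = u + c)%N by lia.
  nia.
have := leq_mul (IH (ltnW ts)) le2; nia.
Qed.

Section UniformGivenSize.
Variables (R : realType) (O : finType) (delta : nat -> R).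
Let m := #|O|.
Hypothesis m_gt0 : (0 < m)%N.
Hypothesis delta_ge0 : forall s, 0 <= delta s.
Hypothesis delta_sum1 : \sum_(s < m.+1) delta s = 1.

(** A set whose size has law [delta] and which is uniform given its size. Despite the name, sizes
    are not reweighted. *)
Definition size_biased (y : {set O}) : R := delta #|y| / 'C(m, #|y|)%:R.

Lemma size_biased_ge0 y : 0 <= size_biased y.
Proof. by rewrite divr_ge0. Qed.

Let m_pos : 0 < m%:R :> R. Proof. by rewrite ltr0n. Qed.

Lemma prob_size_biased (Q : pred {set O}) : prob size_biased Q =
  \sum_(s < m.+1) delta s * (#|[set y : {set O} | Q y && (#|y| == s)]|%:R / 'C(m, s)%:R).
Proof.
rewrite /prob (partition_big (fun y : {set O} => inord #|y| : 'I_m.+1) predT) //=.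
apply: eq_bigr => s _; rewrite -sumr_pred mulr_suml mulr_sumr big_mkcond.
apply: eq_bigr => y _.
have ym : (#|y| < m.+1)%N by rewrite ltnS max_card.
have -> : (inord #|y| == s) = (#|y| == s :> nat) by rewrite -val_eqE /= inordK.
case: eqP => [<-|_]; last by rewrite andbF !(mul0r, mulr0).
rewrite andbT /size_biased /m -mulrA; congr (_ * _).
by rewrite mulrC.
Qed.

Lemma size_biased_sum1 : \sum_y size_biased y = 1.
Proof.
rewrite -[RHS]delta_sum1.
have := prob_size_biased predT; rewrite /prob; under eq_bigr do rewrite mulr1.
move=> ->; apply: eq_bigr => s _.
rewrite (_ : #|_| = 'C(m, s)); last by rewrite -card_draws; apply: eq_card => y; rewrite !inE.
by rewrite divff ?mulr1 // pnatr_eq0 -lt0n bin_gt0 -ltnS.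
Qed.

Let prob_le_const (Q : pred {set O}) (c : R) :
  (forall s, (s <= m)%N -> 0 < delta s ->
    #|[set y : {set O} | Q y && (#|y| == s)]|%:R / 'C(m, s)%:R <= c) ->
  prob size_biased Q <= c.
Proof.
move=> H; rewrite prob_size_biased.
apply: le_trans (_ : (\sum_(s < m.+1) delta s) * c <= _); last by rewrite delta_sum1 mul1r.
rewrite mulr_suml.
apply: ler_sum => s _; have := delta_ge0 s; rewrite le_eqVlt.
case/predU1P => [<-|d0]; first by rewrite !mul0r.
by apply: ler_wpM2l => //; apply: H => //; rewrite -ltnS.
Qed.

Variables (K1 K2 : R) (kappa : nat).
Hypothesis K1_ge0 : 0 <= K1.
Hypothesis delta_supp : forall s, 0 < delta s ->
  [/\ K1 <= s%:R, s%:R <= K2 & (kappa <= s)%N].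

Lemma size_biased_supp y : 0 < size_biased y -> K1 <= #|y|%:R <= K2.
Proof.
rewrite /size_biased => y0.
have /delta_supp[-> ->//] : 0 < delta #|y|.
  rewrite lt_neqAle delta_ge0 andbT; apply: contraTN y0 => /eqP <-.
  by rewrite mul0r ltxx.
Qed.

Let K2_ge0 : 0 <= K2.
Proof.
have [s ds] : exists s, 0 < delta s.
  apply: contrapT => no; have : \sum_(s < m.+1) delta s = 0.
    apply: big1 => s _; apply/eqP; rewrite eq_le delta_ge0 andbT leNgt.
    by apply/negP => ds; apply: no; exists s.
  by rewrite delta_sum1 => /eqP; rewrite oner_eq0.
by case: (delta_supp ds) => _ sK _; apply: le_trans sK.
Qed.

Lemma size_biased_sup (B : {set O}) :
  prob size_biased (fun y => B \subset y) <= (K2 / m%:R) ^+ #|B|.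
Proof.
have base : 0 <= (K2 / m%:R) ^+ #|B| by rewrite exprn_ge0 ?divr_ge0.
apply: prob_le_const => s sm /delta_supp[_ sK _].
have C0 : 0 < 'C(m, s)%:R :> R by rewrite ltr0n bin_gt0.
have [Bs|Bs] := leqP #|B| s; last first.
  rewrite (_ : [set y | _] = set0) ?cards0 ?mul0r //.
  apply/setP => y; rewrite !inE; apply/negP => /andP[/subset_leq_card By /eqP ys].
  by move: Bs; rewrite -ys ltnNge By.
have -> : #|[set y : {set O} | (B \subset y) && (#|y| == s)]| = 'C(m - #|B|, s - #|B|).
  rewrite -[m](cardsT O) -card_draws_sup ?subsetT //.
  by apply: eq_card => y; rewrite !inE subsetT.
apply: le_trans (_ : (s%:R / m%:R) ^+ #|B| <= _); last first.
  by apply: lerXn2r; rewrite ?nnegrE ?divr_ge0 // ler_wpM2r ?invr_ge0.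
rewrite expr_div_n ler_pdivrMr // mulrAC ler_pdivlMr ?exprn_gt0 //.
by rewrite -!natrX -!natrM ler_nat [X in (_ <= X)%N]mulnC bin_sup_le.
Qed.

Let inside_card (Z : {set O}) s :
  #|[set y : {set O} | (y \subset Z) && (#|y| == s)]|%:R / 'C(m, s)%:R <=
  (#|Z|%:R / m%:R) ^+ s :> R.
Proof.
rewrite cards_draws; have [sm|sm] := leqP s m; last first.
  by rewrite bin_small ?mul0r ?exprn_ge0 ?divr_ge0 //; apply: leq_ltn_trans sm; apply: max_card.
have C0 : 0 < 'C(m, s)%:R :> R by rewrite ltr0n bin_gt0.
rewrite expr_div_n ler_pdivrMr // mulrAC ler_pdivlMr ?exprn_gt0 //.
rewrite -!natrX -!natrM ler_nat [X in (_ <= X)%N]mulnC.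
by rewrite bin_inside_le ?max_card.
Qed.

Lemma size_biased_inside (Z : {set O}) :
  prob size_biased (fun y => y \subset Z) <= (#|Z|%:R / m%:R) ^+ kappa.
Proof.
apply: prob_le_const => s sm /delta_supp[_ _ ks].
apply: le_trans (inside_card _ _) _; apply: ler_wiXn2l => //.
  by rewrite divr_ge0.
by rewrite ler_pdivrMr // mul1r ler_nat max_card.
Qed.

Lemma size_biased_avoid (U : {set O}) :
  prob size_biased (fun y => [disjoint y & U]) <= expR (- (K1 / m%:R * #|U|%:R)).
Proof.
apply: prob_le_const => s sm /delta_supp[Ks _ _].
have -> : [set y : {set O} | [disjoint y & U] && (#|y| == s)] =
    [set y : {set O} | (y \subset ~: U) && (#|y| == s)].
  by apply/setP => y; rewrite !inE disjoints_subset.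
apply: le_trans (inside_card _ _) _.
apply: le_trans (_ : expR (- (#|U|%:R / m%:R)) ^+ s <= _).
  apply: lerXn2r; rewrite ?nnegrE ?divr_ge0 ?expR_ge0 //.
  rewrite cardsCs setCK natrB ?max_card // mulrBl divff ?gt_eqF //.
  exact: expR_ge1Dx.
rewrite -expRM_natl ler_expR mulrN lerN2 mulrAC mulrA.
by rewrite ler_wpM2r ?invr_ge0 // ler_wpM2r.
Qed.

(** Counterpart of [size_biased_avoid]: applying [1 + x <= exp x] to [x = u / (m - s - u)] and
    inverting gives [1 - u / (m - s) >= exp (- u / (m - s - u))]. The two bounds agree to first
    order because [K2 / m] tends to 0. *)
Lemma size_biased_avoid_ge (r : nat) (U : {set O}) :
  r.+1%:R * K2 < m%:R -> #|U|%:R <= r%:R * K2 ->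
  expR (- (r%:R * K2 ^+ 2 / (m%:R - r.+1%:R * K2))) <=
  prob size_biased (fun y => [disjoint y & U]).
Proof.
move=> rK Ur; rewrite prob_size_biased; set q := expR _.
apply: le_trans (_ : (\sum_(s < m.+1) delta s) * q <= _); first by rewrite delta_sum1 mul1r.
rewrite mulr_suml {}/q.
apply: ler_sum => s _; have := delta_ge0 s; rewrite le_eqVlt.
case/predU1P => [<-|d0]; first by rewrite !mul0r.
rewrite ler_wpM2l //; have [_ sK _] := delta_supp d0.
have -> : [set y : {set O} | [disjoint y & U] && (#|y| == s)] =
    [set y : {set O} | (y \subset ~: U) && (#|y| == s)].
  by apply/setP => y; rewrite !inE disjoints_subset.
rewrite cards_draws cardsCs setCK -/m.
set u := #|U| in Ur *.
have rK' : r%:R * K2 + K2 < m%:R by move: rK; rewrite -natr1 mulrDl mul1r.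
have us : (u + s < m)%N.
  by rewrite -(ltr_nat R) natrD; apply: le_lt_trans rK'; apply: lerD.
have u_lt : (u < m - s)%N by rewrite ltn_subRL addnC.
have s_lt : (s < m)%N := leq_ltn_trans (leq_addl u s) us.
have C0 : 0 < 'C(m, s)%:R :> R by rewrite ltr0n bin_gt0 -ltnS.
have ms0 : 0 < (m - s)%:R :> R by rewrite ltr0n subn_gt0.
have msu0 : 0 < (m - s - u)%:R :> R by rewrite ltr0n subn_gt0.
apply: le_trans (_ : ((m - s - u)%:R / (m - s)%:R) ^+ s <= _); last first.
  rewrite expr_div_n ler_pdivrMr ?exprn_gt0 // mulrAC ler_pdivlMr //.
  rewrite -!natrX -!natrM ler_nat mulnC; apply: bin_avoid_ge => //.
  exact: ltnW.
apply: le_trans (_ : expR (- (u%:R / (m - s - u)%:R)) ^+ s <= _); last first.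
  apply: lerXn2r; rewrite ?nnegrE ?divr_ge0 ?expR_ge0 //.
  rewrite expRN -[leRHS]invrK lef_pV2 ?posrE ?expR_gt0 ?invr_gt0 ?divr_gt0 //.
  apply: le_trans (expR_ge1Dx _).
  rewrite invf_div -[X in X + _](divff (lt0r_neq0 msu0)) -mulrDl -natrD.
  by apply: ler_wpM2r; [rewrite invr_ge0 ler0n|rewrite ler_nat subnK // ltnW].
rewrite -expRM_natl ler_expR mulrN lerN2 mulrA.
have den : m%:R - r.+1%:R * K2 <= (m - s - u)%:R.
  rewrite (natrB _ (ltnW u_lt)) (natrB _ (ltnW s_lt)).
  by rewrite -natr1 mulrDl mul1r; move: Ur sK; lra.
apply: ler_pM; rewrite ?invr_ge0 ?mulr_ge0 ?(ltW msu0) //.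
  by rewrite mulrC expr2 mulrA ler_pM.
rewrite lef_pV2 ?posrE //; by rewrite subr_gt0.
Qed.

End UniformGivenSize.

(** * Numerical bounds for the three sums over separations *)

Lemma three_quarters (a k : nat) : ((3 * (a * (4 * k))) %/ 4 = 3 * (a * k))%N.
Proof. by rewrite -(mulnK (3 * (a * k)) (isT : 0 < 4)%N); congr (_ %/ 4)%N; ring. Qed.

Section NumericBounds.
Variable R : realType.
Implicit Types x y : R.

Lemma expR1_le3 : expR 1 <= 3 :> R.
Proof.
(* From [exp (-1/8) >= 7/8]; the eighth power of 8/7 is about 2.91. *)
have e8 : expR (1 / 8%:R) <= 8%:R / 7%:R :> R.
  have := expR_ge1Dx (- (1 / 8%:R) : R); rewrite expRN => le.
  rewrite -[leLHS]invrK -[leRHS]invrK lef_pV2 ?posrE ?invr_gt0 ?expR_gt0 ?divr_gt0 //.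
  by apply: le_trans le; rewrite invf_div; lra.
have -> : expR 1 = expR (1 / 8%:R) ^+ 8 :> R by rewrite -expRM_natl; congr expR; lra.
apply: le_trans (_ : (8%:R / 7%:R) ^+ 8 <= _).
  by apply: lerXn2r; rewrite ?nnegrE ?expR_ge0 ?divr_ge0.
by rewrite !exprS expr0; lra.
Qed.

Lemma pow_le_expR x d : 0 <= x -> x ^+ d <= (d`!)%:R * expR x.
Proof.
move=> x0; case: d => [|d].
  by rewrite expr0 mul1r -expR0 ler_expR.
rewrite mulrC -ler_pdivrMr ?ltr0n ?fact_gt0 //.
by apply: le_trans (expR_ge1Dxn d x0); rewrite lerDr.
Qed.

Lemma pow_le_expRM x c d : 0 <= x -> 0 < c -> x ^+ d <= (d`!)%:R / c ^+ d * expR (c * x).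
Proof.
move=> x0 c0; rewrite mulrAC ler_pdivlMr ?exprn_gt0 // mulrC -exprMn.
by apply: pow_le_expR; rewrite mulr_ge0 // ltW.
Qed.

Lemma natr_subBB (n a k : nat) : n%:R - a%:R - k%:R <= (n - a - k)%:R :> R.
Proof. rewrite lerBlDr lerBlDr -!natrD ler_nat; lia. Qed.

Lemma natr_half_sub (n k : nat) : (n%:R - k%:R - 1) / 2 <= ((n - k)./2)%:R :> R.
Proof. rewrite ler_pdivrMr // lerBlDr lerBlDr -natrM !natr1 -natrD ler_nat; lia. Qed.

Lemma nat_pow_le_expR (a d : nat) : a%:R ^+ d <= (d`!)%:R * expR a%:R :> R.
Proof. exact: pow_le_expR. Qed.

Lemma geometric_le2 (t : R) (M : nat) : 0 <= t -> t <= 1 / 2%:R ->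
  \sum_(a < M) t ^+ a.+1 <= 2%:R * t.
Proof.
move=> t0 t2.
suff : \sum_(a < M) t ^+ a.+1 <= 2%:R * t - 2%:R * t ^+ M.+1.
  by move/le_trans; apply; rewrite lerBlDr lerDl mulr_ge0 ?exprn_ge0.
elim: M => [|M IH]; first by rewrite big_ord0 expr1; lra.
rewrite big_ord_recr /= [t ^+ M.+2]exprS.
have := exprn_ge0 M.+1 t0; set w := t ^+ M.+1 in IH *; nra.
Qed.

Lemma binr_le_pow (n a : nat) : (0 < a)%N ->
  'C(n, a)%:R <= (expR 1 * n%:R / a%:R) ^+ a :> R.
Proof.
move=> a0; apply: le_trans (binr_le _ _ _) _.
have ap : 0 < a%:R :> R by rewrite ltr0n.
rewrite !exprMn exprVn -expRM_natl mulr1 [expR _ * _]mulrC -mulrA.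
apply: ler_wpM2l; first by rewrite exprn_ge0.
rewrite ler_pdivlMr ?exprn_gt0 // mulrC ler_pdivrMr ?ltr0n ?fact_gt0 // mulrC.
exact: nat_pow_le_expR.
Qed.

(** For [b] sets of at least [4 k4] objects inside [z = 3 b k4] objects, the number [(e P / z)^z] of
    choices uses up [3 b k4] of the [4 b k4] factors [y = z / P]; what is left is [(e^3 y)^(k4 b)].
    The constant 320 makes [e^3 y <= 81 / 320 < 1/2]. For each set, one of its [k4] factors pays for
    [e n / b], giving [3 e^4 n k4 / P] with [3 e^4 <= 3^5]. *)
Lemma small_union_sum (n P k4 M : nat) (t := 3 ^+ 5 * (n%:R * k4%:R / P%:R) * (1 / 2%:R) ^+ k4.-1 : R) :
  (0 < k4)%N -> (320 * k4 * M <= P)%N -> (0 < P)%N -> t <= 1 / 2%:R ->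
  \sum_(a < M) 'C(n, a.+1)%:R *
     ('C(P, (3 * (a.+1 * (4 * k4))) %/ 4)%:R *
      ((((3 * (a.+1 * (4 * k4))) %/ 4)%:R / P%:R) ^+ (4 * k4)) ^+ a.+1) <= 2%:R * t.
Proof.
move=> k0 MP P0 t2.
have Pp : 0 < P%:R :> R by rewrite ltr0n.
have t_ge0 : 0 <= t by rewrite !mulr_ge0 ?invr_ge0 ?exprn_ge0 ?divr_ge0.
apply: le_trans (geometric_le2 M t_ge0 t2); apply: ler_sum => -[a aM] _ /=.
(* Taking [kappa] to be a multiple of 4 makes three quarters of [a * kappa] an integer. *)
rewrite three_quarters.
set b := a.+1; set z := (3 * (b * k4))%N.
have b0 : (0 < b)%N by [].
have z0 : (0 < z)%N by rewrite !muln_gt0 k0.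
have bp : 0 < b%:R :> R by rewrite ltr0n.
pose y : R := z%:R / P%:R.
have y0 : 0 <= y by rewrite divr_ge0.
have e3 : expR 1 ^+ 3 <= 27%:R :> R.
  have := expR1_le3; have := expR_ge0 (1 : R); rewrite !exprS expr0 mulr1.
  set e := expR 1 => e0 e3; nra.
have ey : expR 1 ^+ 3 * y <= 1 / 2%:R.
  apply: le_trans (_ : 27%:R * y <= _); first by rewrite ler_wpM2r.
  rewrite /y mulrA ler_pdivrMr // -natrM.
  have : (320 * (b * k4) <= P)%N.
    by apply: leq_trans MP; rewrite mulnCA mulnC leq_mul2l /b aM orbT.
  rewrite -(ler_nat R) /z natrM [(27 * _)%:R]natrM [(3 * _)%:R]natrM; lra.
have inner : 'C(P, z)%:R * (y ^+ (4 * k4)) ^+ b <= (expR 1 ^+ 3 * y) ^+ (k4 * b).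
  rewrite -exprM.
  have -> : (4 * k4 * b = z + k4 * b)%N by rewrite /z; ring.
  rewrite exprD mulrA [leRHS]exprMn; apply: ler_pM; rewrite ?mulr_ge0 ?exprn_ge0 //.
  apply: le_trans (ler_wpM2r _ (binr_le_pow P z0)) _; first exact: exprn_ge0.
  rewrite -exprMn /y.
  have -> : expR 1 * P%:R / z%:R * (z%:R / P%:R) = expR 1 :> R.
    by field; rewrite !pnatr_eq0; apply/andP; split; rewrite -lt0n.
  by rewrite -exprM le_eqVlt; apply/orP; left; apply/eqP; congr (_ ^+ _); rewrite /z; ring.
apply: le_trans (_ : (expR 1 * n%:R / b%:R) ^+ b * (expR 1 ^+ 3 * y) ^+ (k4 * b) <= _).
  by apply: ler_pM; rewrite ?mulr_ge0 ?exprn_ge0 ?binr_le_pow.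
rewrite exprM -exprMn; apply: lerXn2r; rewrite ?nnegrE //.
  rewrite mulr_ge0 // ?divr_ge0 // ?exprn_ge0 // mulr_ge0 // ?exprn_ge0 // ?expR_ge0 //.
have ey0 : 0 <= expR 1 ^+ 3 * y by rewrite mulr_ge0 ?exprn_ge0 ?expR_ge0.
rewrite -{1}(prednK k0) exprS mulrA /t; apply: ler_pM.
- by rewrite !mulr_ge0 ?invr_ge0 ?expR_ge0.
- exact: exprn_ge0.
- have -> : expR 1 * n%:R / b%:R * (expR 1 ^+ 3 * y) = 3%:R * expR 1 ^+ 4 * (n%:R * k4%:R / P%:R) :> R.
    rewrite /y /z !natrM; field.
    by apply/andP; split; apply: lt0r_neq0.
  apply: ler_wpM2r; first by rewrite divr_ge0 ?mulr_ge0.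
  have : expR 1 ^+ 4 <= 3%:R * 27%:R :> R.
    by rewrite exprS; apply: ler_pM; rewrite ?exprn_ge0 ?expR_ge0 ?expR1_le3.
  lra.
- by apply: lerXn2r; rewrite ?nnegrE ?divr_ge0.
Qed.

(** Each term is at most [c (a Y)^a]. As [a >= 2], a factor [Y^2] comes out, and [a Y <= 1/8] makes
    the rest geometric. The square is essential: in the application [Y] is about [n^(-18/25)], so
    that [n Y^2] tends to 0 whereas [n Y] does not. *)
Lemma grown_sum (n k a1 k4 N : nat) (rho theta g : R)
    (b := n%:R * rho) (Y := expR 1 * b * expR (- g)) :
  0 <= rho -> 0 <= theta -> 1 <= b ->
  g <= theta * (3%:R * k4%:R) * N%:R -> a1%:R * Y <= 1 / 8%:R ->
  \sum_(a < a1.+1 | (1 < a)%N) (n%:R ^+ a * (a%:R * rho) ^+ a.-1) *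
     ((1 + n%:R * (a%:R * rho)) ^+ k *
        expR (- (theta * (3%:R / 4%:R * (a * (4 * k4))%:R))) ^+ N)
  <= 2 ^+ 8 * (n%:R * (k`!)%:R * (1 + b) ^+ k * Y ^+ 2).
Proof.
move=> rho0 theta0 b1 gN a1Y.
have b0 : 0 <= b by apply: le_trans b1.
have Y0 : 0 <= Y by rewrite !mulr_ge0 ?expR_ge0.
pose c := n%:R * (k`!)%:R * (1 + b) ^+ k.
have c0 : 0 <= c by rewrite !mulr_ge0 ?exprn_ge0 ?addr_ge0.
apply: le_trans (_ : \sum_(a < a1.+1) c * (128%:R * Y ^+ 2) * (1 / 2%:R) ^+ a <= _); last first.
  rewrite -mulr_sumr -/c big_ord_recl expr0.
  have := @geometric_le2 (1 / 2%:R) a1; rewrite divr_ge0 // lexx => /(_ isT isT) le.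
  have c1 : 0 <= c * (128%:R * Y ^+ 2) by rewrite mulr_ge0 // mulr_ge0 ?exprn_ge0.
  have -> : 2 ^+ 8 * (c * Y ^+ 2) = c * (128%:R * Y ^+ 2) * 2%:R by ring.
  apply: ler_wpM2l => //; under eq_bigr do rewrite lift0.
  lra.
rewrite big_mkcond; apply: ler_sum => -[a aa1] _ /=.
case: ifP => a1'; last first.
  by rewrite mulr_ge0 ?exprn_ge0 ?divr_ge0 // mulr_ge0 // mulr_ge0 ?exprn_ge0.
have a0 : (0 < a)%N by lia.
have ap : 1 <= a%:R :> R by rewrite ler1n.
have aY8 : a%:R * Y <= 1 / 8%:R.
  by apply: le_trans a1Y; rewrite ler_wpM2r // ler_nat.
apply: le_trans (_ : c * (a%:R * Y) ^+ a <= _); last first.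
  rewrite -mulrA ler_wpM2l //.
  have -> : a = (2 + (a - 2))%N by lia.
  set a' := (a - 2)%N; rewrite exprD exprMn.
  have le8 : ((2 + a')%:R * Y) ^+ a' <= (1 / 8%:R) ^+ a'.
    have -> : (2 + a' = a)%N by rewrite /a' subnKC.
    by apply: lerXn2r; rewrite ?nnegrE ?divr_ge0 // mulr_ge0.
  apply: le_trans (_ : (2 + a')%:R ^+ 2 * Y ^+ 2 * (1 / 8%:R) ^+ a' <= _).
    by apply: ler_wpM2l le8; rewrite mulr_ge0 ?exprn_ge0.
  have -> : (2 + a')%:R ^+ 2 * Y ^+ 2 * (1 / 8%:R) ^+ a' =
    Y ^+ 2 * ((1 / 8%:R) ^+ a' * (2 + a')%:R ^+ 2) by ring.
  rewrite [128%:R * _]mulrC -[leRHS]mulrA.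
  apply: ler_wpM2l; first exact: exprn_ge0.
  (* Use [a^2 <= 2 e^a <= 2 * 3^a]; then [18 (3/8)^a' <= 32 (1/2)^a']. *)
  apply: le_trans (_ : (1 / 8%:R) ^+ a' * (2%:R * 3%:R ^+ (2 + a')) <= _).
    apply: ler_wpM2l; first by rewrite exprn_ge0 ?divr_ge0.
    apply: le_trans (nat_pow_le_expR _ _) _; rewrite ler_wpM2l //.
    rewrite -[X in expR X]mulr1 expRM_natl.
    by apply: lerXn2r; rewrite ?nnegrE ?expR_ge0 ?expR1_le3.
  rewrite !exprD.
  have le2 : (1 / 8%:R) ^+ a' * 3%:R ^+ a' <= (1 / 2%:R) ^+ a' :> R.
    rewrite -exprMn; apply: lerXn2r; rewrite ?nnegrE ?mulr_ge0 ?divr_ge0 //; lra.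
  have := exprn_ge0 a' (divr_ge0 ler01 (ler0n R 2)).
  move: le2; set w := _ ^+ a' * _ ^+ a'; set w2 := (1 / 2) ^+ a' => le2 w20.
  have -> : (1 / 8%:R) ^+ a' * (2%:R * (3%:R ^+ 2 * 3%:R ^+ a')) = 18%:R * w :> R.
    by rewrite /w; ring.
  have -> : 128%:R * ((1 / 2%:R) ^+ 2 * w2) = 32%:R * w2 :> R by field.
  lra.
have powk : (1 + n%:R * (a%:R * rho)) ^+ k <= (k`!)%:R * expR 1 ^+ a * (1 + b) ^+ k.
  apply: le_trans (_ : (a%:R * (1 + b)) ^+ k <= _).
    apply: lerXn2r; rewrite ?nnegrE ?addr_ge0 ?mulr_ge0 ?addr_ge0 //.
    rewrite mulrCA -/b mulrDr mulr1; lra.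
  rewrite exprMn ler_wpM2r ?exprn_ge0 ?addr_ge0 //.
  apply: le_trans (nat_pow_le_expR _ _) _.
  by rewrite -[X in expR X]mulr1 expRM_natl.
have powa : n%:R ^+ a * (a%:R * rho) ^+ a.-1 <= n%:R * (a%:R * b) ^+ a.
  have -> : n%:R ^+ a * (a%:R * rho) ^+ a.-1 = n%:R * (a%:R * b) ^+ a.-1.
    by rewrite -{1}(prednK a0) exprS -mulrA -exprMn /b [n%:R * (a%:R * _)]mulrCA.
  rewrite ler_wpM2l // -[a in leRHS](prednK a0) [leRHS]exprS prednK // ler_peMl ?exprn_ge0 ?mulr_ge0 //.
  exact: mulr_ege1.
have powe : expR (- (theta * (3%:R / 4%:R * (a * (4 * k4))%:R))) ^+ N <= expR (- g) ^+ a.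
  rewrite -!expRM_natl ler_expR !mulrN lerN2.
  apply: le_trans (_ : a%:R * (theta * (3%:R * k4%:R) * N%:R) <= _); first by rewrite ler_wpM2l.
  by rewrite !natrM le_eqVlt; apply/orP; left; apply/eqP; field.
apply: le_trans (ler_pM _ _ powa (ler_pM _ _ powk powe)) _;
  rewrite ?mulr_ge0 ?exprn_ge0 ?mulr_ge0 ?addr_ge0 ?mulr_ge0 ?expR_ge0 //.
rewrite /c /Y le_eqVlt; apply/orP; left; apply/eqP.
rewrite !exprMn; ring.
Qed.

(** For [a1 < a <= M], [(e n / a)^a] is beaten by [exp (- g a)] because [a > a1]. Beyond [M], even
    all [2^n <= e^n] subsets are beaten by [exp (- g M) <= exp (- 3 n)]. *)
Lemma large_sum (n k M a1 k4 h : nat) (rho theta g c : R) (b := n%:R * rho) :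
  0 <= rho -> 0 <= theta -> 0 <= c -> (0 < a1)%N ->
  g <= theta * (3%:R * k4%:R) * h%:R -> 0 <= g ->
  expR 1 * n%:R <= a1%:R * expR (g - c) -> 3%:R * n%:R <= g * M%:R ->
  \sum_(a < n.+1 | (a1 < a)%N) 'C(n, a)%:R *
     ((1 + n%:R * (a%:R * rho)) ^+ k *
        expR (- (theta * (3%:R / 4%:R * (minn a M * (4 * k4))%:R))) ^+ h)
  <= n.+1%:R * ((1 + n%:R * b) ^+ k * (expR (- (c * a1%:R)) + expR (- (2%:R * n%:R)))).
Proof.
move=> rho0 theta0 c0 a10 gh g0 gc gM.
have b0 : 0 <= b by rewrite mulr_ge0.
have t0 : 0 <= (1 + n%:R * b) ^+ k * (expR (- (c * a1%:R)) + expR (- (2%:R * n%:R))).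
  by rewrite mulr_ge0 ?exprn_ge0 ?addr_ge0 ?mulr_ge0 ?expR_ge0.
apply: le_trans (_ : \sum_(a < n.+1) (1 + n%:R * b) ^+ k *
   (expR (- (c * a1%:R)) + expR (- (2%:R * n%:R))) <= _); last first.
  by rewrite sumr_const card_ord [leRHS]mulr_natl.
rewrite big_mkcond; apply: ler_sum => -[a an] _ /=; case: ifP => // a1a.
have a0 : (0 < a)%N := leq_ltn_trans (leq0n a1) a1a.
have apos : 0 < a%:R :> R by rewrite ltr0n.
have powe : expR (- (theta * (3%:R / 4%:R * (minn a M * (4 * k4))%:R))) ^+ h <=
    expR (- g) ^+ (minn a M).
  rewrite -!expRM_natl ler_expR !mulrN lerN2.
  apply: le_trans (_ : (minn a M)%:R * (theta * (3%:R * k4%:R) * h%:R) <= _); first by rewrite ler_wpM2l.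
  by rewrite !natrM le_eqVlt; apply/orP; left; apply/eqP; field.
have powk : (1 + n%:R * (a%:R * rho)) ^+ k <= (1 + n%:R * b) ^+ k.
  apply: lerXn2r; rewrite ?nnegrE ?addr_ge0 ?mulr_ge0 //.
  by rewrite lerD2l ler_wpM2l // /b ler_wpM2r // ler_nat -ltnS.
rewrite mulrCA; apply: ler_pM => //; rewrite ?exprn_ge0 ?addr_ge0 ?mulr_ge0 ?exprn_ge0 ?expR_ge0 //.
apply: le_trans (ler_wpM2l _ powe) _ => //.
have [aM|aM] := leqP a M.
  apply: le_trans (_ : expR (- (c * a1%:R)) <= _); last by rewrite lerDl expR_ge0.
  apply: le_trans (ler_wpM2r _ (binr_le_pow n a0)) _; first by rewrite exprn_ge0 ?expR_ge0.
  rewrite -exprMn.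
  apply: le_trans (_ : expR (- c) ^+ a <= _).
    apply: lerXn2r; rewrite ?nnegrE ?mulr_ge0 ?invr_ge0 ?expR_ge0 //.
    have -> : expR (- c) = expR (g - c) * expR (- g) by rewrite -expRD; congr expR; ring.
    apply: ler_wpM2r; first exact: expR_ge0.
    rewrite ler_pdivrMr //; apply: le_trans gc _.
    by rewrite mulrC ler_wpM2l ?expR_ge0 // ler_nat ltnW.
  rewrite -expRM_natl ler_expR mulrN lerN2 mulrC.
  by rewrite ler_wpM2r // ler_nat ltnW.
apply: le_trans (_ : expR (- (2%:R * n%:R)) <= _); last by rewrite lerDr expR_ge0.
apply: le_trans (_ : expR 1 ^+ n * expR (- (3%:R * n%:R)) <= _).
  apply: ler_pM; rewrite ?exprn_ge0 ?expR_ge0 //.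
    apply: le_trans (_ : (2 ^ n)%:R <= _).
      rewrite ler_nat; have -> : (2 ^ n = \sum_(i < n.+1) 'C(n, i))%N.
        by rewrite (Pascal 1 1); apply: eq_bigr => i _; rewrite !exp1n !muln1.
      by rewrite (bigD1 (Ordinal an)) //= leq_addr.
    rewrite natrX; apply: lerXn2r; rewrite ?nnegrE ?expR_ge0 //.
    by apply: le_trans (expR_ge1Dx _); rewrite -natr1.
  rewrite -expRM_natl ler_expR mulrN lerN2.
  by rewrite [M%:R * g]mulrC.
rewrite -expRM_natl -expRD ler_expR; lra.
Qed.

End NumericBounds.

From mathcomp Require Import all_classical all_reals all_analysis.

Import numFieldNormedType.Exports.
Local Open Scope classical_set_scope.
Local Open Scope ring_scope.

(** * Limits of real sequences *)

Section SequenceLimits.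
Variable R : realType.
Implicit Types (u v : nat -> R) (a b : R).

Lemma seq_eq u v a : (\forall n \near \oo, u n = v n) -> v @ \oo --> a -> u @ \oo --> a.
Proof. by move=> uv va; apply: cvg_trans va; apply: near_eq_cvg; apply: filterS uv => n ->. Qed.

Lemma seq_add u v a b : u @ \oo --> a -> v @ \oo --> b -> (fun n => u n + v n) @ \oo --> a + b.
Proof. exact: cvgD. Qed.

Lemma seq_sub u v a b : u @ \oo --> a -> v @ \oo --> b -> (fun n => u n - v n) @ \oo --> a - b.
Proof. exact: cvgB. Qed.

Lemma seq_mul u v a b : u @ \oo --> a -> v @ \oo --> b -> (fun n => u n * v n) @ \oo --> a * b.
Proof. exact: cvgM. Qed.

Lemma seq_inv u a : a != 0 -> u @ \oo --> a -> (fun n => (u n)^-1) @ \oo --> a^-1.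
Proof. exact: cvgV. Qed.

Lemma seq_scale c u a : u @ \oo --> a -> (fun n => c * u n) @ \oo --> c * a.
Proof. by apply: seq_mul; apply: cvg_cst. Qed.

Lemma seq_exp u a d : u @ \oo --> a -> (fun n => u n ^+ d) @ \oo --> a ^+ d.
Proof.
move=> ua; elim: d => [|d IH]; first by under eq_fun do rewrite expr0; apply: cvg_cst.
by under eq_fun do rewrite exprS; rewrite exprS; apply: seq_mul.
Qed.

Lemma seq_expR u a : u @ \oo --> a -> (fun n => expR (u n)) @ \oo --> expR a.
Proof. by move=> ua; apply: (continuous_cvg _ _ ua); apply: continuous_expR. Qed.

Lemma seq_sum (J : Type) (s : seq J) (Q : pred J) (u : J -> nat -> R) (a : J -> R) :
  (forall j, Q j -> u j @ \oo --> a j) ->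
  (fun n => \sum_(j <- s | Q j) u j n) @ \oo --> \sum_(j <- s | Q j) a j.
Proof.
move=> ua; elim: s => [|j s IH].
  by under eq_fun do rewrite big_nil; rewrite big_nil; apply: cvg_cst.
under eq_fun do rewrite big_cons; rewrite big_cons; case: ifP => // Qj.
by apply: seq_add => //; apply: ua.
Qed.

Lemma seq_squeeze0 u v : (\forall n \near \oo, `|u n| <= v n) -> v @ \oo --> (0 : R) ->
  u @ \oo --> (0 : R).
Proof.
move=> uv v0; apply: (@squeeze_cvgr _ _ _ _ (fun n => - v n) v) => //.
  by near=> n; rewrite -ler_norml; near: n.
by rewrite -oppr0; apply: cvgN.
Unshelve. all: by end_near. Qed.

Lemma seq_pow_exp u a d : 0 < a -> u @ \oo --> +oo ->
  (fun n => u n ^+ d * expR (- (a * u n))) @ \oo --> (0 : R).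
Proof.
move=> a0 uy.
apply: (@seq_squeeze0 _ (fun n => (d.+1`!)%:R / a ^+ d.+1 * (u n)^-1)).
  near=> n.
  have un : 0 < u n by near: n; exact: cvgry_gt.
  rewrite ger0_norm ?mulr_ge0 ?exprn_ge0 ?expR_ge0 ?(ltW un) //.
  rewrite ler_pdivlMr // mulrAC -exprSr expRN ler_pdivrMr ?expR_gt0 //.
  by apply: pow_le_expRM => //; apply: ltW.
rewrite -[X in _ --> X](mulr0 ((d.+1`!)%:R / a ^+ d.+1)); apply: seq_scale.
apply/gtr0_cvgV0 => //; near=> n; near: n; exact: cvgry_gt.
Unshelve. all: by end_near. Qed.

Lemma seq_near_lt u a b : u @ \oo --> a -> a < b -> \forall n \near \oo, u n < b.
Proof. by move=> ua ab; apply: (cvgr_lt a ua). Qed.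

Lemma seq_near_gt u a b : u @ \oo --> a -> b < a -> \forall n \near \oo, b < u n.
Proof. by move=> ua ab; apply: (cvgr_gt a ua). Qed.

Lemma seq_ninfty : (fun n => n%:R : R) @ \oo --> +oo.
Proof. exact: cvgr_idn. Qed.

Lemma seq_ln_ninfty : (fun n => ln n%:R : R) @ \oo --> +oo.
Proof.
apply/cvgryPge => A; near=> n.
have nA : expR A <= n%:R by near: n; apply: (cvgry_ge seq_ninfty).
by rewrite -[A]expRK ler_ln ?posrE ?expR_gt0 // (lt_le_trans (expR_gt0 A)).
Unshelve. all: by end_near. Qed.

Lemma seq_inv_infty u : u @ \oo --> +oo -> (fun n => (u n)^-1) @ \oo --> (0 : R).
Proof.
move=> uy; apply/gtr0_cvgV0 => //; near=> n; near: n; exact: cvgry_gt.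
Unshelve. all: by end_near. Qed.

End SequenceLimits.

(** * Bonferroni inequalities and the Poisson limit *)

Lemma sum_alternating_bin (R : realType) (N m : nat) : (0 < N)%N ->
  \sum_(j < m.+1) (-1) ^+ j * 'C(N, j)%:R = (-1) ^+ m * 'C(N.-1, m)%:R :> R.
Proof.
case: N => // N _; elim: m => [|m IH]; first by rewrite big_ord1 !expr0 !bin0.
rewrite big_ord_recr /= IH binS natrD exprS; ring.
Qed.

Lemma bonferroni (R : realType) (N p : nat) :
  \sum_(j < 2 * p) (-1) ^+ j * 'C(N, j)%:R <= (N == 0%N)%:R :> R /\
  (N == 0%N)%:R <= \sum_(j < (2 * p).+1) (-1) ^+ j * 'C(N, j)%:R :> R.
Proof.
have sum0 m : \sum_(j < m.+1) (-1) ^+ j * 'C(0, j)%:R = 1 :> R.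
  rewrite big_ord_recl bin0 mulr1 expr0 big1 ?addr0 // => j _.
  by rewrite lift0 bin0n mulr0.
have sgn2 : (-1) ^+ (2 * p) = 1 :> R by rewrite exprM sqrrN expr1n expr1n.
case: (posnP N) => [->|N0].
  split; last by rewrite sum0.
  by case: p {sgn2} => [|p]; rewrite ?mulnS ?sum0 // big_ord0.
split; last by rewrite sum_alternating_bin // sgn2 mul1r.
case: p sgn2 => [|p]; first by rewrite big_ord0.
rewrite mulnS sum_alternating_bin // => _.
have -> : (-1) ^+ (2 * p).+1 = -1 :> R.
  by rewrite exprS exprM sqrrN expr1n expr1n mulr1.
by rewrite mulN1r oppr_le0.
Qed.

(** For fixed [p] the two bounds converge to consecutive partial sums of the series of [exp (- z)];
    the truncation is chosen first, then [n]. *)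
Lemma bonferroni_limit (R : realType) (q : nat -> R) (S : nat -> nat -> R) (z : R) :
  (forall p, \forall n \near \oo,
     \sum_(j < 2 * p) (-1) ^+ j * S j n <= q n <= \sum_(j < (2 * p).+1) (-1) ^+ j * S j n) ->
  (forall j, S j @ \oo --> z ^+ j / (j`!)%:R) ->
  q @ \oo --> expR (- z).
Proof.
move=> bounds Slim.
pose T m : R := \sum_(j < m) (-1) ^+ j * (z ^+ j / (j`!)%:R).
have TE : T @ \oo --> expR (- z).
  have -> : T = series (exp_coeff (- z)).
    apply/funext => m; rewrite /series /= big_mkord; apply: eq_bigr => j _.
    by rewrite /exp_coeff /= mulrA -exprMn mulN1r.
  exact: is_cvg_series_exp_coeff.
have Tlim m : (fun n => \sum_(j < m) (-1) ^+ j * S j n) @ \oo --> T m.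
  by apply: seq_sum => j _; apply: seq_scale.
apply/cvgrPdist_lt => e e0.
have e2 : 0 < e / 2 by rewrite divr_gt0.
have /cvgrPdist_lt/(_ _ e2)[m0 _ Tm] := TE.
have lo := Tm (2 * m0)%N; have hi := Tm (2 * m0).+1.
have /= lo' : `|expR (- z) - T (2 * m0)%N| < e / 2 by apply: lo => /=; rewrite leq_pmull.
have /= hi' : `|expR (- z) - T (2 * m0).+1| < e / 2 by apply: hi => /=; rewrite ltnW // ltnS leq_pmull.
have /cvgrPdist_lt/(_ _ e2) lim1 := Tlim (2 * m0)%N.
have /cvgrPdist_lt/(_ _ e2) lim2 := Tlim (2 * m0).+1.
near=> n.
have /andP[b1 b2] : \sum_(j < 2 * m0) (-1) ^+ j * S j n <= q n <= \sum_(j < (2 * m0).+1) (-1) ^+ j * S j n.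
  by near: n; apply: bounds.
have : `|T (2 * m0)%N - \sum_(j < 2 * m0) (-1) ^+ j * S j n| < e / 2 by near: n.
have : `|T (2 * m0).+1 - \sum_(j < (2 * m0).+1) (-1) ^+ j * S j n| < e / 2 by near: n.
move: lo' hi' b1 b2; rewrite !ltr_norml; set x := \sum_(_ < _) _; set y := \sum_(_ < _) _.
move=> /andP[? ?] /andP[? ?] ? ? /andP[? ?] /andP[? ?]; apply/andP; split; lra.
Unshelve. all: by end_near. Qed.

(** * Asymptotics for set sizes in the window *)

Section Asymptotics.
Variables (R : realType) (k : nat) (P : nat -> nat) (K eps alpha : nat -> R) (c : R).
Let l n : R := ln n%:R.
Let L n := l n + (k.-1)%:R * ln (l n) + alpha n.
Hypotheses (k_gt0 : (0 < k)%N) (P_gt0 : forall n, (0 < P n)%N).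
Hypothesis KP : \forall n \near \oo, K n ^+ 2 / (P n)%:R = L n / n%:R.
Hypotheses (c_gt0 : 0 < c) (Kc : \forall n \near \oo, c * Num.sqrt (l n) <= K n).
Hypotheses (eps_ge0 : forall n, 0 <= eps n) (eps_l : (fun n => eps n * l n) @ \oo --> (0 : R)).
Hypothesis alpha_l : (fun n => alpha n / l n) @ \oo --> (0 : R).

Let K1 n := (1 - eps n) * K n.
Let K2 n := (1 + eps n) * K n.
Let rho n := K2 n ^+ 2 / (P n)%:R.

Let l_infty : l @ \oo --> +oo := @seq_ln_ninfty R.

Let l_ge A : \forall n \near \oo, A <= l n.
Proof. exact: (cvgry_ge l_infty). Qed.

Let n_exp n : (0 < n)%N -> n%:R = expR (l n) :> R.
Proof. by move=> n0; rewrite lnK // posrE ltr0n. Qed.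

Let poly_small d a : 0 < a -> (fun n => l n ^+ d * expR (- (a * l n))) @ \oo --> (0 : R).
Proof. by move=> a0; apply: seq_pow_exp l_infty. Qed.

Let linv : (fun n => (l n)^-1) @ \oo --> (0 : R).
Proof. exact: seq_inv_infty. Qed.

Let eps0 : eps @ \oo --> (0 : R).
Proof.
have := seq_mul eps_l linv; rewrite mulr0; apply: seq_eq; near=> n.
have l1 : 1 <= l n by near: n; exact: l_ge.
by rewrite mulfK // gt_eqF // (lt_le_trans ltr01).
Unshelve. all: by end_near. Qed.

Let lnl_l : (fun n => ln (l n) / l n) @ \oo --> (0 : R).
Proof.
have lnl : (fun n => ln (l n)) @ \oo --> +oo.
  apply/cvgryPge => A; near=> n.
  have nA : expR A <= l n by near: n; apply: l_ge.
  by rewrite -[A]expRK ler_ln ?posrE ?expR_gt0 // (lt_le_trans (expR_gt0 A)).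
have := @seq_pow_exp R _ 1 1 ltr01 lnl; apply: seq_eq; near=> n.
have l1 : 1 <= l n by near: n; exact: l_ge.
by rewrite expr1 mul1r expRN lnK // posrE (lt_le_trans ltr01).
Unshelve. all: by end_near. Qed.

Let L_l : (fun n => L n / l n) @ \oo --> (1 : R).
Proof.
have : (fun n => 1 + (k.-1)%:R * (ln (l n) / l n) + alpha n / l n) @ \oo --> (1 + (k.-1)%:R * 0 + 0 : R).
  by apply: seq_add => //; apply: seq_add; [apply: cvg_cst|apply: seq_scale].
rewrite mulr0 !addr0; apply: seq_eq; near=> n.
have l1 : 1 <= l n by near: n; exact: l_ge.
rewrite /L; field; by rewrite gt_eqF // (lt_le_trans ltr01).
Unshelve. all: by end_near. Qed.

Let b1 n := L n * (1 - eps n) ^+ 2.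
Let b2 n := L n * (1 + eps n) ^+ 2.

Let n_near : \forall n \near \oo, (0 < n)%N.
Proof. by exists 1%N. Qed.

Let b2E : \forall n \near \oo, n%:R * rho n = b2 n.
Proof.
near=> n; have n0 : (0 < n)%N by near: n.
have KPn : K n ^+ 2 / (P n)%:R = L n / n%:R by near: n.
rewrite /rho /K2 exprMn -[_ * _ / _]mulrA KPn /b2; field.
by rewrite pnatr_eq0 -lt0n.
Unshelve. all: by end_near. Qed.

Let b1E : \forall n \near \oo, n%:R * (K1 n ^+ 2 / (P n)%:R) = b1 n.
Proof.
near=> n; have n0 : (0 < n)%N by near: n.
have KPn : K n ^+ 2 / (P n)%:R = L n / n%:R by near: n.
rewrite /K1 exprMn -[_ * _ / _]mulrA KPn /b1; field.
by rewrite pnatr_eq0 -lt0n.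
Unshelve. all: by end_near. Qed.

Let b2_l : (fun n => b2 n / l n) @ \oo --> (1 : R).
Proof.
have : (fun n => L n / l n * (1 + eps n) ^+ 2) @ \oo --> (1 * (1 + 0) ^+ 2 : R).
  by apply: seq_mul => //; apply: seq_exp; apply: seq_add => //; apply: cvg_cst.
by rewrite addr0 expr1n mulr1; apply: seq_eq; near=> n; rewrite /b2 mulrAC.
Unshelve. all: by end_near. Qed.

Let b1_l : (fun n => b1 n / l n) @ \oo --> (1 : R).
Proof.
have : (fun n => L n / l n * (1 - eps n) ^+ 2) @ \oo --> (1 * (1 - 0) ^+ 2 : R).
  by apply: seq_mul => //; apply: seq_exp; apply: seq_sub => //; apply: cvg_cst.
by rewrite subr0 expr1n mulr1; apply: seq_eq; near=> n; rewrite /b1 mulrAC.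
Unshelve. all: by end_near. Qed.

Let L_eps : (fun n => L n * eps n) @ \oo --> (0 : R).
Proof.
have := seq_mul L_l eps_l; rewrite mulr0; apply: seq_eq; near=> n.
have l1 : 1 <= l n by near: n; exact: l_ge.
field; by rewrite gt_eqF // (lt_le_trans ltr01).
Unshelve. all: by end_near. Qed.

(** Here [eps -> 0] would not do: the difference is of order [L eps], and it must tend to 0 because
    [b1] stands in an exponent. *)
Let L_b1 : (fun n => L n - b1 n) @ \oo --> (0 : R).
Proof.
have : (fun n => L n * eps n * (2 - eps n)) @ \oo --> (0 * (2 - 0) : R).
  by apply: seq_mul => //; apply: seq_sub => //; apply: cvg_cst.
rewrite mul0r; apply: seq_eq; near=> n.
by rewrite /b1; ring.
Unshelve. all: by end_near. Qed.

Let b2_L : (fun n => b2 n - L n) @ \oo --> (0 : R).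
Proof.
have : (fun n => L n * eps n * (2 + eps n)) @ \oo --> (0 * (2 + 0) : R).
  by apply: seq_mul => //; apply: seq_add => //; apply: cvg_cst.
rewrite mul0r; apply: seq_eq; near=> n.
by rewrite /b2; ring.
Unshelve. all: by end_near. Qed.

Let K_infty : K @ \oo --> +oo.
Proof.
apply/cvgryPge => A; near=> n.
have lA : (A / c) ^+ 2 <= l n by near: n; exact: l_ge.
apply: le_trans (_ : c * Num.sqrt (l n) <= _); last by near: n.
rewrite mulrC -ler_pdivrMr //; apply: le_trans (ler_norm _) _.
by rewrite -sqrtr_sqr ler_wsqrtr.
Unshelve. all: by end_near. Qed.

Let K_ge A : \forall n \near \oo, A <= K n.
Proof. exact: (cvgry_ge K_infty). Qed.

Let rho_pos n : 0 <= rho n.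
Proof. by rewrite divr_ge0 // sqr_ge0. Qed.

Let rho_le : \forall n \near \oo, rho n <= 2 * l n * expR (- l n).
Proof.
have b2lt := seq_near_lt b2_l (_ : 1 < 2); near=> n.
have n0 : (0 < n)%N by near: n.
have l1 : 1 <= l n by near: n; exact: l_ge.
have l0 : 0 < l n by apply: lt_le_trans l1.
have : b2 n / l n < 2 by near: n; apply: b2lt; lra.
have <- : n%:R * rho n = b2 n by near: n.
rewrite ltr_pdivrMr // => /ltW le.
by rewrite expRN -(n_exp n0) ler_pdivlMr ?ltr0n // mulrC.
Unshelve. all: by end_near. Qed.

Let rho_poly d : (fun n => l n ^+ d * rho n) @ \oo --> (0 : R).
Proof.
apply: (@seq_squeeze0 _ _ (fun n => 2 * (l n ^+ d.+1 * expR (- (1 * l n))))).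
  near=> n; have l1 : 1 <= l n by near: n; exact: l_ge.
  have l0 : 0 <= l n by apply: le_trans l1.
  have := rho_pos n => r0.
  have h : 0 <= l n ^+ d * rho n by apply: mulr_ge0 => //; apply: exprn_ge0.
  rewrite (ger0_norm h) mul1r exprSr.
  have : rho n <= 2 * l n * expR (- l n) by near: n.
  move=> /(ler_wpM2l (exprn_ge0 d l0)) le; apply: le_trans le _.
  by rewrite le_eqVlt; apply/orP; left; apply/eqP; ring.
by rewrite -[X in _ --> X](mulr0 2); apply: seq_scale; apply: poly_small.
Unshelve. all: by end_near. Qed.

(* [4 * k4] is the lower bound [kappa] on the set sizes; unions of at most [M]
   sets are typically almost disjoint; [a1 = n^(11/16)] separates the sizes for
   which connected enumerations are counted from those for which all subsets
   are. *)
Let k4 n := Num.truncn (K1 n / 4).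
Let M n := (P n %/ (320 * k4 n))%N.
Let a1 n := Num.truncn (expR (11 / 16 * l n)).

Let K1_K : \forall n \near \oo, K n / 2 <= K1 n <= K n.
Proof.
have e2 := seq_near_lt eps0 (_ : 0 < 1 / 2); near=> n.
have : eps n < 1 / 2 by near: n; apply: e2; lra.
have K0 : 0 <= K n by near: n; exact: K_ge.
have := eps_ge0 n; rewrite /K1 => e0 e1; nra.
Unshelve. all: by end_near. Qed.

Let K1_infty : K1 @ \oo --> +oo.
Proof.
apply/cvgryPge => A; near=> n.
have KA : A * 2 <= K n by near: n; exact: K_ge.
have /andP[+ _] : K n / 2 <= K1 n <= K n by near: n.
apply: le_trans; lra.
Unshelve. all: by end_near. Qed.

Let k4_bounds : \forall n \near \oo, [/\ (0 < k4 n)%N, (k4 n)%:R <= K1 n / 4 & K1 n / 4 - 1 <= (k4 n)%:R].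
Proof.
near=> n.
have K14 : 4 <= K1 n by near: n; exact: (cvgry_ge K1_infty).
have K0 : 0 <= K1 n / 4 by lra.
have /andP[le1 lt1] := truncn_itv K0; split=> //.
- by rewrite /k4 truncn_gt0; lra.
- by move: lt1; rewrite -[ltRHS]natr1 /k4; lra.
Unshelve. all: by end_near. Qed.

Let L_lt2 : \forall n \near \oo, L n <= 2 * l n.
Proof.
have lt2 := seq_near_lt L_l (_ : 1 < 2); near=> n.
have l1 : 1 <= l n by near: n; exact: l_ge.
have : L n / l n < 2 by near: n; apply: lt2; lra.
by rewrite ltr_pdivrMr; [exact: ltW|lra].
Unshelve. all: by end_near. Qed.

Let L_gt : \forall n \near \oo, l n / 2 <= L n.
Proof.
have gt2 := seq_near_gt L_l (_ : 1 / 2 < 1); near=> n.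
have l1 : 1 <= l n by near: n; exact: l_ge.
have : 1 / 2 < L n / l n by near: n; apply: gt2; lra.
by rewrite ltr_pdivlMr; [move=> ?; lra|lra].
Unshelve. all: by end_near. Qed.

Let l_le_K : \forall n \near \oo, c ^+ 2 * l n <= K n ^+ 2.
Proof.
near=> n.
have l0 : 0 <= l n by near: n; exact: l_ge.
have le : c * Num.sqrt (l n) <= K n by near: n.
rewrite -[l n in leLHS]sqr_sqrtr // -exprMn.
by apply: lerXn2r; rewrite ?nnegrE ?mulr_ge0 ?sqrtr_ge0 ?(ltW c_gt0) // (le_trans _ le) // mulr_ge0 ?sqrtr_ge0 // ltW.
Unshelve. all: by end_near. Qed.

(* [nK/P = L/K], and [ln n <= (K/c)^2] *)
Let nKP : \forall n \near \oo, n%:R * K n / (P n)%:R <= 2 / c ^+ 2 * K n.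
Proof.
near=> n.
have n0 : (0 < n)%N by near: n.
have K1' : 1 <= K n by near: n; exact: K_ge.
have KPn : K n ^+ 2 / (P n)%:R = L n / n%:R by near: n.
have L2 : L n <= 2 * l n by near: n.
have lK : c ^+ 2 * l n <= K n ^+ 2 by near: n.
have K0 : 0 < K n by lra.
have -> : n%:R * K n / (P n)%:R = L n / K n.
  have np : n%:R != 0 :> R by rewrite pnatr_eq0 -lt0n.
  have -> : L n = n%:R * (K n ^+ 2 / (P n)%:R) by rewrite KPn mulrCA divff ?mulr1.
  field; rewrite pnatr_eq0 -lt0n P_gt0 /=; lra.
have c2 : 0 < c ^+ 2 by rewrite exprn_gt0.
have : l n <= K n ^+ 2 / c ^+ 2 by rewrite ler_pdivlMr // mulrC.
rewrite ler_pdivrMr // (_ : 2 / c ^+ 2 * K n * K n = 2 * (K n ^+ 2 / c ^+ 2)); first lra.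
by field; rewrite gt_eqF.
Unshelve. all: by end_near. Qed.

Let tau n : R := 3 ^+ 5 * (n%:R * (k4 n)%:R / (P n)%:R) * (1 / 2%:R) ^+ (k4 n).-1.

Let expR_half_le2 : expR (1 / 2) <= 2 :> R.
Proof.
have : expR (1 / 2) ^+ 2 <= 2 ^+ 2 :> R.
  by rewrite -expRM_natl mulrC divfK //; apply: le_trans (expR1_le3 R) _; rewrite expr2; lra.
by rewrite ler_pXn2r // nnegrE ?expR_ge0.
Qed.

(** By [nKP], which rests on the lower bound [c sqrt (ln n)] for the mean, [n k4 / P] is at most of
    order [K]; and [k4 >= K / 8 - 1], so the power of 1/2 wins. The factor [e] and the rate 1/16
    come from [(k4 - 1) / 2 >= K / 16 - 1]. *)
Let tau0 : tau @ \oo --> (0 : R).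
Proof.
pose C := 3 ^+ 5 * (2 / c ^+ 2) * expR 1.
apply: (@seq_squeeze0 _ _ (fun n => C * (K n ^+ 1 * expR (- (1 / 16 * K n))))); last first.
  by rewrite -[X in _ --> X](mulr0 C); apply: seq_scale; apply: seq_pow_exp => //; lra.
near=> n.
have [k40 k4K1 K1k4] : [/\ (0 < k4 n)%N, (k4 n)%:R <= K1 n / 4 & K1 n / 4 - 1 <= (k4 n)%:R] by near: n.
have /andP[K1l K1u] : K n / 2 <= K1 n <= K n by near: n.
have K0 : 1 <= K n by near: n; exact: K_ge.
have nkp : n%:R * K n / (P n)%:R <= 2 / c ^+ 2 * K n by near: n.
have Pp : 0 < (P n)%:R :> R by rewrite ltr0n.
rewrite /tau ger0_norm; last by rewrite mulr_ge0 ?exprn_ge0 ?divr_ge0 // mulr_ge0 // divr_ge0 // mulr_ge0.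
rewrite /C expr1.
have -> : 3 ^+ 5 * (2 / c ^+ 2) * expR 1 * (K n * expR (- (1 / 16 * K n))) =
  3 ^+ 5 * (2 / c ^+ 2 * K n) * (expR 1 * expR (- (1 / 16 * K n))) by ring.
apply: ler_pM.
- by rewrite mulr_ge0 // divr_ge0 // mulr_ge0.
- by rewrite exprn_ge0 ?divr_ge0.
- apply: ler_wpM2l => //; apply: le_trans nkp.
  by rewrite ler_wpM2r ?invr_ge0 ?(ltW Pp) // ler_wpM2l //; lra.
have half : 1 / 2 <= expR (- (1 / 2)) :> R.
  rewrite expRN -[leLHS]invrK lef_pV2 ?posrE ?expR_gt0 ?invr_gt0 ?divr_gt0 //.
  by rewrite invf_div divr1.
apply: le_trans (_ : expR (- (1 / 2)) ^+ (k4 n).-1 <= _).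
  by apply: lerXn2r; rewrite ?nnegrE ?divr_ge0 ?expR_ge0.
rewrite -expRM_natl -expRD ler_expR.
have : (k4 n)%:R = (k4 n).-1%:R + 1 :> R by rewrite natr1 prednK.
lra.
Unshelve. all: by end_near. Qed.

Let theta n := K1 n / (P n)%:R.

(** Normalised exponent: all [n] vertices avoid a set of [a] vertices with probability at most
    [exp (- a * w n * l n)]. The 3/4 is that of [cut_size], and [1 - 4 / K1] absorbs the rounding in
    [k4]. *)
Let w n := b1 n / l n * (3 / 4 * (1 - 4 / K1 n)).

Let w_lim : w @ \oo --> (3 / 4 : R).
Proof.
have : (fun n => b1 n / l n * (3 / 4 * (1 - 4 * (K1 n)^-1))) @ \oo --> (1 * (3 / 4 * (1 - 4 * 0)) : R).
  apply: seq_mul => //; apply: seq_scale; apply: seq_sub; first exact: cvg_cst.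
  by apply: seq_scale; apply: seq_inv_infty.
by rewrite mulr0 subr0 mulr1 mul1r.
Qed.

Let theta_k4 : \forall n \near \oo, l n * w n <= n%:R * (theta n * (3 * (k4 n)%:R)).
Proof.
near=> n.
have [k40 k4K1 K1k4] : [/\ (0 < k4 n)%N, (k4 n)%:R <= K1 n / 4 & K1 n / 4 - 1 <= (k4 n)%:R] by near: n.
have K11 : 1 <= K1 n by near: n; exact: (cvgry_ge K1_infty).
have l1 : 1 <= l n by near: n; exact: l_ge.
have b1n : n%:R * (K1 n ^+ 2 / (P n)%:R) = b1 n by near: n.
have Pp : 0 < (P n)%:R :> R by rewrite ltr0n.
have -> : l n * w n = n%:R * (theta n * (3 * (K1 n / 4 - 1))).
  rewrite /w -b1n /theta; field.
  by apply/and3P; split; rewrite gt_eqF // (lt_le_trans ltr01).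
apply: ler_wpM2l => //; apply: ler_wpM2l; first by rewrite divr_ge0 // (le_trans ler01).
by rewrite ler_wpM2l.
Unshelve. all: by end_near. Qed.

Let inv_n : (fun n => (n%:R : R)^-1) @ \oo --> (0 : R).
Proof. exact: seq_inv_infty (@seq_ninfty R). Qed.

Let a1_le n : (a1 n)%:R <= expR (11 / 16 * l n).
Proof. by rewrite truncn_le expR_ge0. Qed.

Let a1_ge n : expR (11 / 16 * l n) - 1 <= (a1 n)%:R.
Proof.
have /andP[_] := truncn_itv (expR_ge0 (11 / 16 * l n)).
by rewrite -[ltRHS]natr1 /a1; lra.
Qed.

(** Any constant strictly between 11/16 and 3/4 could replace 18/25. [v n] bounds the fraction
    [(a1 + k) / n] of lost vertices, as [5/16 = 1 - 11/16]. *)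
Let grown_exponent : \forall n \near \oo,
  18 / 25 * l n <= theta n * (3 * (k4 n)%:R) * (n - a1 n - k)%:R.
Proof.
pose v n : R := expR (- (5 / 16 * l n)) + k%:R * n%:R^-1.
have v0 : v @ \oo --> (0 : R).
  rewrite -[X in _ --> X](addr0 0); apply: seq_add; last first.
    by rewrite -[X in _ --> X](mulr0 k%:R); apply: seq_scale.
  have := @poly_small 0 (5 / 16); under eq_fun do rewrite expr0 mul1r.
  by apply; lra.
have wv : (fun n => w n * (1 - v n)) @ \oo --> (3 / 4 * (1 - 0) : R).
  by apply: seq_mul => //; apply: seq_sub => //; apply: cvg_cst.
have gt := seq_near_gt wv (_ : 18 / 25 < 3 / 4 * (1 - 0)).
have v1 := seq_near_lt v0 (_ : 0 < 1).
near=> n.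
have n0 : (0 < n)%N by near: n.
have np : 0 < n%:R :> R by rewrite ltr0n.
have l1 : 1 <= l n by near: n; exact: l_ge.
have K11 : 1 <= K1 n by near: n; exact: (cvgry_ge K1_infty).
have le1 : l n * w n <= n%:R * (theta n * (3 * (k4 n)%:R)) by near: n.
have le2 : 18 / 25 < w n * (1 - v n) by near: n; apply: gt; lra.
have le3 : v n < 1 by near: n; apply: v1; lra.
have th0 : 0 <= theta n * (3 * (k4 n)%:R).
  apply: mulr_ge0; last exact: mulr_ge0.
  by apply: divr_ge0 => //; apply: le_trans K11.
have N_ge : n%:R * (1 - v n) <= (n - a1 n - k)%:R.
  apply: le_trans (natr_subBB R _ _ _).
  have -> : n%:R * (1 - v n) = n%:R - n%:R * expR (- (5 / 16 * l n)) - k%:R.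
    by rewrite /v; field; rewrite gt_eqF.
  rewrite lerD2r lerD2l lerN2; apply: le_trans (a1_le n) _.
  rewrite {1}(n_exp n0) -expRD ler_expR; lra.
apply: le_trans (ler_wpM2l th0 N_ge).
apply: le_trans (_ : l n * w n * (1 - v n) <= _).
  rewrite -[l n * w n * _]mulrA [18 / 25 * _]mulrC.
  by apply: ler_wpM2l (ltW le2); apply: le_trans l1.
have -> : theta n * (3 * (k4 n)%:R) * (n%:R * (1 - v n)) =
   n%:R * (theta n * (3 * (k4 n)%:R)) * (1 - v n) by ring.
by rewrite ler_wpM2r // subr_ge0 ltW.
Unshelve. all: by end_near. Qed.

(** Only about half of the vertices are sure to be on the far side, and 9/25 is just below half of
    3/4. *)
Let large_exponent : \forall n \near \oo,
  9 / 25 * l n <= theta n * (3 * (k4 n)%:R) * ((n - k)./2)%:R.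
Proof.
pose v n : R := 1 / 2 - (k%:R + 1) / 2 * n%:R^-1.
have v0 : v @ \oo --> (1 / 2 - (k%:R + 1) / 2 * 0 : R).
  by apply: seq_sub; [apply: cvg_cst|apply: seq_scale].
rewrite mulr0 subr0 in v0.
have gt := seq_near_gt (seq_mul w_lim v0) (_ : 9 / 25 < 3 / 4 * (1 / 2)).
have v1 := seq_near_gt v0 (_ : 0 < 1 / 2).
near=> n.
have n0 : (0 < n)%N by near: n.
have np : 0 < n%:R :> R by rewrite ltr0n.
have l1 : 1 <= l n by near: n; exact: l_ge.
have K11 : 1 <= K1 n by near: n; exact: (cvgry_ge K1_infty).
have le1 : l n * w n <= n%:R * (theta n * (3 * (k4 n)%:R)) by near: n.
have le2 : 9 / 25 < w n * v n by near: n; apply: gt; lra.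
have le3 : 0 < v n by near: n; apply: v1; lra.
have th0 : 0 <= theta n * (3 * (k4 n)%:R).
  apply: mulr_ge0; last exact: mulr_ge0.
  by apply: divr_ge0 => //; apply: le_trans K11.
have N_ge : n%:R * v n <= ((n - k)./2)%:R.
  have -> : n%:R * v n = (n%:R - k%:R - 1) / 2 by rewrite /v; field; rewrite gt_eqF.
  exact: natr_half_sub.
apply: le_trans (ler_wpM2l th0 N_ge).
apply: le_trans (_ : l n * w n * v n <= _).
  rewrite -[l n * w n * _]mulrA [9 / 25 * _]mulrC.
  by apply: ler_wpM2l (ltW le2); apply: le_trans l1.
have -> : theta n * (3 * (k4 n)%:R) * (n%:R * v n) =
   n%:R * (theta n * (3 * (k4 n)%:R)) * v n by ring.
by rewrite ler_wpM2r // ltW.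
Unshelve. all: by end_near. Qed.

Let b2_bounds : \forall n \near \oo, 1 <= n%:R * rho n <= 2 * l n.
Proof.
have lt2 := seq_near_lt b2_l (_ : 1 < 2).
have gt2 := seq_near_gt b2_l (_ : 1 / 2 < 1).
near=> n.
have l1 : 2 <= l n by near: n; exact: l_ge.
have -> : n%:R * rho n = b2 n by near: n.
have : b2 n / l n < 2 by near: n; apply: lt2; lra.
have : 1 / 2 < b2 n / l n by near: n; apply: gt2; lra.
have l0 : 0 < l n by lra.
by rewrite ltr_pdivlMr // ltr_pdivrMr // => h1 h2; apply/andP; split; lra.
Unshelve. all: by end_near. Qed.

Let Y n := expR 1 * (n%:R * rho n) * expR (- (18 / 25 * l n)).

Let Y_le : \forall n \near \oo, 0 <= Y n <= 6 * l n * expR (- (18 / 25 * l n)).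
Proof.
near=> n.
have /andP[b_ge b_le] : 1 <= n%:R * rho n <= 2 * l n by near: n.
have e3 := expR1_le3 R; have e0 := expR_ge0 (1 : R).
have Y0 : 0 <= Y n.
  by apply: mulr_ge0; [apply: mulr_ge0 => //; lra|exact: expR_ge0].
rewrite Y0 /=.
apply: ler_wpM2r; first exact: expR_ge0.
have -> : 6 * l n = 3 * (2 * l n) by ring.
apply: ler_pM => //; lra.
Unshelve. all: by end_near. Qed.

(** [13/400 = 18/25 - 11/16]: this is where [a1] must not be too large. *)
Let a1Y : \forall n \near \oo, (a1 n)%:R * Y n <= 1 / 8%:R.
Proof.
have lim := @poly_small 1 (13 / 400) (_ : 0 < 13 / 400).
have lt : \forall n \near \oo, 6 * (l n ^+ 1 * expR (- (13 / 400 * l n))) < 1 / 8.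
  apply: (@seq_near_lt _ _ 0); last lra.
  by rewrite -[X in _ --> X](mulr0 6); apply: seq_scale; apply: lim; lra.
near=> n.
have /andP[Y0 Yl] : 0 <= Y n <= 6 * l n * expR (- (18 / 25 * l n)) by near: n.
apply: le_trans (_ : 6 * (l n ^+ 1 * expR (- (13 / 400 * l n))) <= _); last first.
  by apply: ltW; near: n.
apply: le_trans (ler_pM _ Y0 (a1_le n) Yl) _ => //.
rewrite expr1.
have -> : - (13 / 400 * l n) = 11 / 16 * l n + - (18 / 25 * l n) by field.
by rewrite expRD le_eqVlt; apply/orP; left; apply/eqP; ring.
Unshelve. all: by end_near. Qed.

Let grown_bound n : R := 2 ^+ 8 * (n%:R * (k`!)%:R * (1 + n%:R * rho n) ^+ k * Y n ^+ 2).

Let grown_bound0 : grown_bound @ \oo --> (0 : R).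
Proof.
pose C : R := 2 ^+ 8 * (k`!)%:R * 3 ^+ k * 36%:R.
apply: (@seq_squeeze0 _ _ (fun n => C * (l n ^+ k.+2 * expR (- (11 / 25 * l n))))); last first.
  by rewrite -[X in _ --> X](mulr0 C); apply: seq_scale; apply: poly_small; lra.
near=> n.
have n0 : (0 < n)%N by near: n.
have l1 : 2 <= l n by near: n; exact: l_ge.
have /andP[b_ge b_le] : 1 <= n%:R * rho n <= 2 * l n by near: n.
have /andP[Y0 Yl] : 0 <= Y n <= 6 * l n * expR (- (18 / 25 * l n)) by near: n.
have pk : 0 <= (1 + n%:R * rho n) ^+ k by rewrite exprn_ge0 //; lra.
rewrite ger0_norm; last first.
  by apply: mulr_ge0 => //; apply: mulr_ge0; [apply: mulr_ge0 => //; apply: mulr_ge0|apply: exprn_ge0].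
have le1 : (1 + n%:R * rho n) ^+ k <= (3 * l n) ^+ k.
  by apply: lerXn2r; rewrite ?nnegrE; lra.
have le2 : Y n ^+ 2 <= (6 * l n * expR (- (18 / 25 * l n))) ^+ 2.
  by apply: lerXn2r; rewrite ?nnegrE // (le_trans Y0).
apply: le_trans (_ : 2 ^+ 8 * (n%:R * (k`!)%:R * (3 * l n) ^+ k *
   (6 * l n * expR (- (18 / 25 * l n))) ^+ 2) <= _).
  apply: ler_wpM2l => //; apply: ler_pM => //.
  - by rewrite mulr_ge0 // mulr_ge0.
  - exact: exprn_ge0.
  - by apply: ler_wpM2l => //; rewrite mulr_ge0.
have -> : - (11 / 25 * l n) = l n + (- (18 / 25 * l n) + - (18 / 25 * l n)) by field.
rewrite !expRD -(n_exp n0) /C !exprMn -[k.+2]addn2 exprD.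
rewrite le_eqVlt; apply/orP; left; apply/eqP; ring.
Unshelve. all: by end_near. Qed.

Let a1_infty : (fun n => (a1 n)%:R : R) @ \oo --> +oo.
Proof.
apply/cvgryPge => A; near=> n.
have lA : (A + 1) * 2 <= l n by near: n; exact: l_ge.
have l1 : 1 <= l n by near: n; exact: l_ge.
apply: le_trans (a1_ge n).
have := expR_ge1Dx (11 / 16 * l n); lra.
Unshelve. all: by end_near. Qed.

(** [11/16 + 9/25 - 1/50 = 1 + 11/400]: this is where [a1] must not be too small. *)
Let large_entropy : \forall n \near \oo,
  expR 1 * n%:R <= (a1 n)%:R * expR (9 / 25 * l n - l n / 50).
Proof.
near=> n.
have n0 : (0 < n)%N by near: n.
have l1 : 400 <= l n by near: n; exact: l_ge.
have e3 := expR1_le3 R.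
have a1n := a1_ge n.
have E2 : 2 <= expR (11 / 16 * l n) by have := expR_ge1Dx (11 / 16 * l n); lra.
apply: le_trans (_ : expR (11 / 16 * l n) / 2 * expR (9 / 25 * l n - l n / 50) <= _); last first.
  by apply: ler_wpM2r; [exact: expR_ge0|lra].
have -> : expR (11 / 16 * l n) / 2 * expR (9 / 25 * l n - l n / 50) =
    expR (11 / 400 * l n) / 2 * n%:R.
  rewrite (n_exp n0) [LHS]mulrAC [RHS]mulrAC -!expRD; congr (expR _ / 2); by field.
apply: ler_wpM2r => //; have := expR_ge1Dx (11 / 400 * l n); lra.
Unshelve. all: by end_near. Qed.

(** [M] is at least about [P / (80 K)] and [P = n K^2 / L], so [l M] is at least of order [n K], and
    [K] tends to infinity. *)
Let M_ge : \forall n \near \oo, 3 * n%:R <= 9 / 25 * l n * (M n)%:R.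
Proof.
near=> n.
have n0 : (0 < n)%N by near: n.
have l1 : 1 <= l n by near: n; exact: l_ge.
have [k40 k4K1 K1k4] : [/\ (0 < k4 n)%N, (k4 n)%:R <= K1 n / 4 & K1 n / 4 - 1 <= (k4 n)%:R] by near: n.
have /andP[K1l K1u] : K n / 2 <= K1 n <= K n by near: n.
have K0 : 1600 <= K n by near: n; exact: K_ge.
have L2 : L n <= 2 * l n by near: n.
have Lg : l n / 2 <= L n by near: n.
have KPn : K n ^+ 2 / (P n)%:R = L n / n%:R by near: n.
have np : 0 < n%:R :> R by rewrite ltr0n.
have Pp : 0 < (P n)%:R :> R by rewrite ltr0n.
have kp : 0 < (k4 n)%:R :> R by rewrite ltr0n.
have Kp : 0 < K n by lra.
have Lp : 0 < L n by lra.
have ln_n : l n <= n%:R by have := expR_ge1Dx (l n); rewrite -(n_exp n0); lra.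
have PE : (P n)%:R = n%:R * K n ^+ 2 / L n.
  have : n%:R * K n ^+ 2 = L n * (P n)%:R.
    have -> : K n ^+ 2 = L n / n%:R * (P n)%:R by rewrite -KPn divfK // gt_eqF.
    by field; rewrite gt_eqF.
  by move=> ->; field; rewrite gt_eqF.
have Mlb : (P n)%:R / (80 * K n) - 1 <= (M n)%:R.
  have : (P n < (M n).+1 * (320 * k4 n))%N by rewrite /M ltn_ceil // muln_gt0.
  rewrite -(ltr_nat R) !natrM => lt; rewrite lerBlDr natr1.
  rewrite ler_pdivrMr; last by rewrite mulr_gt0.
  apply: le_trans (ltW lt) _; apply: ler_wpM2l => //; lra.
apply: le_trans (_ : 9 / 25 * l n * ((P n)%:R / (80 * K n) - 1) <= _); last first.
  by apply: ler_wpM2l => //; lra.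
have : n%:R * K n / 160 <= l n * ((P n)%:R / (80 * K n)).
  have -> : l n * ((P n)%:R / (80 * K n)) = n%:R * K n / 160 * (2 * l n / L n).
    by rewrite PE; field; rewrite !gt_eqF.
  rewrite ler_peMr //; first by rewrite divr_ge0 // mulr_ge0 // ltW.
  by rewrite ler_pdivlMr // mul1r.
have : n%:R * 1600 <= n%:R * K n by rewrite ler_wpM2l.
rewrite (_ : 9 / 25 * l n * (_ - 1) = 9 / 25 * (l n * ((P n)%:R / (80 * K n))) - 9 / 25 * l n); last by ring.
lra.
Unshelve. all: by end_near. Qed.

Let a1_M : \forall n \near \oo, (a1 n <= M n)%N.
Proof.
have lim := @poly_small 1 (5 / 16).
have lt : \forall n \near \oo, l n ^+ 1 * expR (- (5 / 16 * l n)) < 1.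
  by apply: (@seq_near_lt _ _ 0); [apply: lim; lra|lra].
near=> n.
have n0 : (0 < n)%N by near: n.
have l1 : 1 <= l n by near: n; exact: l_ge.
have le1 : 3 * n%:R <= 9 / 25 * l n * (M n)%:R by near: n.
have : l n ^+ 1 * expR (- (5 / 16 * l n)) < 1 by near: n.
rewrite expr1 => lt1; rewrite -(ler_nat R); apply: le_trans (a1_le n) _.
have E : expR (11 / 16 * l n) = n%:R * expR (- (5 / 16 * l n)).
  by rewrite (n_exp n0) -expRD; congr expR; field.
have lp : 0 < l n by lra.
rewrite -(ler_pM2l lp) E mulrCA.
have : n%:R * (l n * expR (- (5 / 16 * l n))) <= n%:R * 1 by rewrite ler_wpM2l // ltW.
have : 0 <= n%:R :> R by [].
have : 0 <= l n * (M n)%:R by rewrite mulr_ge0 // ltW.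
rewrite -mulrA in le1; lra.
Unshelve. all: by end_near. Qed.

Let large_bound n : R := n.+1%:R * ((1 + n%:R * (n%:R * rho n)) ^+ k *
  (expR (- (l n / 50 * (a1 n)%:R)) + expR (- (2%:R * n%:R)))).

Let large_bound0 : large_bound @ \oo --> (0 : R).
Proof.
pose C : R := 4 * 3 ^+ k.
apply: (@seq_squeeze0 _ _ (fun n => C * (l n ^+ k * expR (- (1 * l n))))); last first.
  by rewrite -[X in _ --> X](mulr0 C); apply: seq_scale; apply: poly_small.
have nl : (fun n => n%:R * expR (- (1 / 2 * n%:R))) @ \oo --> (0 : R).
  have := @seq_pow_exp R _ (1 / 2) 1 _ (@seq_ninfty R); under eq_fun do rewrite expr1.
  by apply; lra.
near=> n.
have n0 : (0 < n)%N by near: n.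
have l1 : (k.+2)%:R <= l n by near: n; exact: l_ge.
have l2 : 2 <= l n by near: n; exact: l_ge.
have a1b : 50 * (k.+2)%:R <= (a1 n)%:R :> R by near: n; apply: (cvgry_ge a1_infty).
have /andP[b_ge b_le] : 1 <= n%:R * rho n <= 2 * l n by near: n.
have lpos : 0 <= l n by lra.
have n_ge1 : 1 <= n%:R :> R by rewrite ler1n.
have nle : (k.+2)%:R * l n <= 2%:R * n%:R.
  have l22 : l n ^+ 2 <= 2%:R * n%:R by rewrite (n_exp n0); apply: pow_le_expR.
  by apply: le_trans l22; rewrite expr2 ler_wpM2r.
have e1 : expR (- (l n / 50 * (a1 n)%:R)) <= expR (- ((k.+2)%:R * l n)).
  rewrite ler_expR lerN2 (_ : _ * l n = l n / 50 * (50 * (k.+2)%:R)); last by field.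
  by apply: ler_wpM2l => //; apply: divr_ge0.
have e2 : expR (- (2%:R * n%:R)) <= expR (- ((k.+2)%:R * l n)) by rewrite ler_expR lerN2.
have base : 0 <= 1 + n%:R * (n%:R * rho n).
  by rewrite addr_ge0 // mulr_ge0 // mulr_ge0.
have pk : (1 + n%:R * (n%:R * rho n)) ^+ k <= (n%:R * (3 * l n)) ^+ k.
  apply: lerXn2r; rewrite ?nnegrE //; first by rewrite mulr_ge0 // mulr_ge0.
  have : n%:R * (n%:R * rho n) <= n%:R * (2 * l n) by rewrite ler_wpM2l.
  have : 1 * 1 <= n%:R * l n by rewrite ler_pM //; lra.
  lra.
rewrite ger0_norm; last first.
  by apply: mulr_ge0 => //; apply: mulr_ge0; [apply: exprn_ge0|apply: addr_ge0; exact: expR_ge0].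
apply: le_trans (_ : 2 * n%:R * ((n%:R * (3 * l n)) ^+ k * (2 * expR (- ((k.+2)%:R * l n)))) <= _).
  apply: ler_pM => //.
  - by apply: mulr_ge0; [apply: exprn_ge0|apply: addr_ge0; exact: expR_ge0].
  - by rewrite -natr1; lra.
  apply: ler_pM => //; first exact: exprn_ge0.
  lra.
have -> : expR (- ((k.+2)%:R * l n)) = (n%:R ^+ k.+1)^-1 * expR (- (1 * l n)).
  rewrite (n_exp n0) -expRM_natl -expRN -expRD; congr expR.
  by rewrite -[k.+2%:R]natr1; ring.
rewrite /C !exprMn le_eqVlt; apply/orP; left; apply/eqP; rewrite exprS; field.
have nn0 : n%:R != 0 :> R by rewrite pnatr_eq0 -lt0n.
by rewrite expf_neq0.
Unshelve. all: by end_near. Qed.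

Variable delta : nat -> nat -> R.
Hypothesis delta_law : \forall n \near \oo,
  [/\ forall s, 0 <= delta n s, \sum_(s < (P n).+1) delta n s = 1 &
      forall s, 0 < delta n s -> K1 n <= s%:R <= K2 n].

Let mu n : {set 'I_(P n)} -> R := size_biased (delta n).
Arguments mu : clear implicits.

Let law_facts_at n : Prop := [/\
  [/\ 0 <= K1 n, 0 <= K2 n, 0 <= K2 n / (P n)%:R & 0 <= theta n],
  (forall y, 0 <= mu n y) /\ \sum_y mu n y = 1,
  forall y, 0 < mu n y -> K1 n <= #|y|%:R <= K2 n,
  (forall B : {set 'I_(P n)}, prob (mu n) (fun y => B \subset y) <= (K2 n / (P n)%:R) ^+ #|B|) /\
  (forall U : {set 'I_(P n)}, prob (mu n) (fun y => [disjoint y & U]%B) <= expR (- (theta n * #|U|%:R))) &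
  (forall Z : {set 'I_(P n)}, prob (mu n) (fun y => y \subset Z) <=
     (#|Z|%:R / #|'I_(P n)|%:R) ^+ (4 * k4 n)) /\
  forall (r : nat) (U : {set 'I_(P n)}),
    r.+1%:R * K2 n < (P n)%:R -> #|U|%:R <= r%:R * K2 n ->
    expR (- (r%:R * K2 n ^+ 2 / ((P n)%:R - r.+1%:R * K2 n))) <=
    prob (mu n) (fun y => [disjoint y & U]%B)].

Let law_facts : \forall n \near \oo, law_facts_at n.
Proof.
near=> n; rewrite /law_facts_at.
have [d0 d1 ds] : [/\ forall s, 0 <= delta n s, \sum_(s < (P n).+1) delta n s = 1 &
      forall s, 0 < delta n s -> K1 n <= s%:R <= K2 n] by near: n.
have [k40 k4K1 K1k4] : [/\ (0 < k4 n)%N, (k4 n)%:R <= K1 n / 4 & K1 n / 4 - 1 <= (k4 n)%:R] by near: n.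
have K11 : 1 <= K1 n by near: n; exact: (cvgry_ge K1_infty).
have K0 : 1 <= K n by near: n; exact: K_ge.
have K20 : 0 <= K2 n by rewrite mulr_ge0 ?addr_ge0 // (le_trans ler01).
have K10 : 0 <= K1 n by rewrite (le_trans ler01).
have m0 : (0 < #|'I_(P n)|)%N by rewrite card_ord.
have d1' : \sum_(s < #|'I_(P n)|.+1) delta n s = 1 by rewrite card_ord.
have ds' s : 0 < delta n s -> [/\ K1 n <= s%:R, s%:R <= K2 n & (4 * k4 n <= s)%N].
  move=> /ds/andP[sl su]; split=> //.
  rewrite -(ler_nat R) natrM; apply: le_trans sl; lra.
have sup := @size_biased_sup R _ (delta n) m0 d0 d1' (K1 n) (K2 n) (4 * k4 n)%N ds'.
have avoid := @size_biased_avoid R _ (delta n) m0 d0 d1' (K1 n) (K2 n) (4 * k4 n)%N ds'.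
have inside := @size_biased_inside R _ (delta n) m0 d0 d1' (K1 n) (K2 n) (4 * k4 n)%N ds'.
have avoid_ge := @size_biased_avoid_ge R _ (delta n) d0 d1' (K1 n) (K2 n) (4 * k4 n)%N ds'.
rewrite card_ord in sup avoid avoid_ge.
split=> //.
- by split=> //; rewrite divr_ge0.
- by split=> [y|]; [exact: size_biased_ge0|exact: size_biased_sum1].
- by move=> y; apply: (@size_biased_supp R _ (delta n) d0 (K1 n) (K2 n) (4 * k4 n)%N ds').
Unshelve. all: by end_near. Qed.

Lemma disconnected_cvg0 :
  (fun n => Ex (mu n) (fun f : {ffun 'I_n -> {set 'I_(P n)}} =>
     (`[< ~ k_connected k (meet_rel f) >] &&
      [forall v, (k <= #|nbrs (meet_rel f) v|)%N])%:R)) @ \oo --> (0 : R).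
Proof.
have lim : (fun n => 2 * tau n + (grown_bound n + large_bound n)) @ \oo --> (2 * 0 + (0 + 0) : R).
  by apply: seq_add; [apply: seq_scale|apply: seq_add].
rewrite mulr0 !addr0 in lim; apply: (@seq_squeeze0 _ _ _ _ lim).
have t2 := seq_near_lt tau0 (_ : 0 < 1 / 2).
near=> n.
have [[K10 K20 p0 th0] [mu0 mu1] mus [sup avoid] [inside _]] : law_facts_at n by near: n.
have n0 : (0 < n)%N by near: n.
have kn : (k < n)%N by near: n; exists k.+1.
have l1 : 1 <= l n by near: n; exact: l_ge.
have [k40 k4K1 K1k4] : [/\ (0 < k4 n)%N, (k4 n)%:R <= K1 n / 4 & K1 n / 4 - 1 <= (k4 n)%:R] by near: n.
rewrite ger0_norm; last by apply: Ex_ge0.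
have a1M : (a1 n <= M n)%N by near: n.
have MP : (320 * k4 n * M n <= P n)%N by rewrite mulnC leq_divM.
have := @disconnected_prob R _ (mu n) mu0 mu1 (K2 n / (P n)%:R) (K2 n) (theta n) (4 * k4 n)
  p0 th0 K20 _ sup avoid inside 'I_n k (M n) (a1 n).
rewrite !card_ord => le; apply: le_trans (le _ kn a1M _) _.
- by move=> y /mus/andP[].
- rewrite three_quarters; apply: leq_trans MP.
  by rewrite -mulnA [(k4 n * _)%N]mulnC leq_mul2r orbT.
have rhoE : K2 n / (P n)%:R * K2 n = rho n by rewrite /rho expr2 mulrAC.
rewrite rhoE /cut_size; apply: lerD.
  apply: small_union_sum => //.
  by apply: ltW; near: n; apply: t2; lra.
apply: lerD.
  apply: grown_sum => //; first by have /andP[] : 1 <= n%:R * rho n <= 2 * l n by near: n.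
    by near: n.
  by near: n.
apply: (@large_sum _ _ _ _ _ _ _ _ _ (9 / 25 * l n)) => //.
- by rewrite divr_ge0 // (le_trans ler01).
- have : 1 <= (a1 n)%:R :> R by near: n; apply: (cvgry_ge a1_infty).
  by rewrite ler1n.
- by near: n.
- by rewrite mulr_ge0 // (le_trans ler01).
- by near: n.
- by near: n.
Unshelve. all: by end_near. Qed.

Let Pb n (Q : {ffun 'I_n -> {set 'I_(P n)}} -> bool) : R := Ex (mu n) (fun f => (Q f)%:R).

Lemma connected_degree_cvg0 :
  (fun n => Pb (fun f : {ffun 'I_n -> {set 'I_(P n)}} =>
              [forall v, (k <= #|nbrs (meet_rel f) v|)%N]) -
            Pb (fun f : {ffun 'I_n -> {set 'I_(P n)}} =>
              `[< k_connected k (meet_rel f) >])) @ \oo --> (0 : R).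
Proof.
apply: seq_eq disconnected_cvg0; near=> n.
have n2 : (1 < n)%N by near: n; exists 2%N.
rewrite /Pb -ExB; apply: eq_Ex => f.
case: (pselect (k_connected k (meet_rel f))) => kc.
  have -> : [forall v, (k <= #|nbrs (meet_rel f) v|)%N].
    by apply/forallP => v; apply: k_connected_degree => //; rewrite card_ord.
  by rewrite (asboolT kc) (asboolF (fun h : ~ k_connected k (meet_rel f) => h kc)) subrr.
by rewrite (asboolF kc) (asboolT kc) subr0.
Unshelve. all: by end_near. Qed.

(** * Asymptotic probability that [r] given vertices have low degree *)

Let d := k.-1.
Let nat_near (m : nat) : \forall n \near \oo, (m < n)%N.
Proof. by exists m.+1. Qed.

Let kE : k = d.+1. Proof. by rewrite /d prednK. Qed.

(* [1 / scale n] is the asymptotic probability that a given vertex has degree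
   less than [k]. *)
Let scale n : R := n%:R * expR (alpha n) * (d`!)%:R.

Let scaleE : \forall n \near \oo, scale n = expR (L n) * ((d`!)%:R * (l n)^-1 ^+ d).
Proof.
near=> n; have n0 : (0 < n)%N by near: n.
have l1 : 1 <= l n by near: n; exact: l_ge.
have lp : 0 < l n by apply: lt_le_trans l1.
rewrite /scale (n_exp n0) /L -/d.
have {1}-> : l n + d%:R * ln (l n) + alpha n = l n + alpha n + d%:R * ln (l n) by ring.
rewrite (expRD (l n + alpha n)) (expRD (l n)) expRM_natl lnK ?posrE //.
rewrite exprVn; field; by rewrite expf_neq0 // gt_eqF.
Unshelve. all: by end_near. Qed.

Let b1_n : (fun n => b1 n / n%:R) @ \oo --> (0 : R).
Proof.
have ln0 : (fun n => l n ^+ 1 * expR (- (1 * l n))) @ \oo --> (0 : R) by apply: poly_small.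
have := seq_mul b1_l ln0; rewrite mulr0; apply: seq_eq; near=> n.
have n0 : (0 < n)%N by near: n.
have l1 : 1 <= l n by near: n; exact: l_ge.
rewrite expr1 mul1r expRN -(n_exp n0) mulrA divfK // gt_eqF //.
by apply: lt_le_trans l1.
Unshelve. all: by end_near. Qed.

Let ov r n : R := (1 + n%:R * (r%:R * rho n)) ^+ (r * k) *
   ((r ^ 2)%:R * (expR (expR (theta n * (n%:R * (r ^ 2)%:R)) * rho n) - 1)).

Let upper r n : R := expR (- (theta n * (r%:R * K1 n))) ^+ (n - r - r * k) *
   ((\sum_(j < k) (n%:R * rho n) ^+ j / (j`!)%:R) ^+ r + ov r n).

Let low_upper r : \forall n \near \oo, forall h : 'I_r -> 'I_n, injective h ->
  Pb (fun f => low_degrees h k f) <= upper r n.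
Proof.
near=> n => h hI.
have [[K10 K20 p0 th0] [mu0 mu1] mus [sup avoid] _] : law_facts_at n by near: n.
have rhoE : K2 n / (P n)%:R * K2 n = rho n by rewrite /rho expr2 mulrAC.
have le1 := @low_degree_disjoint R _ (mu n) mu0 mu1 _ (K1 n) (K2 n) (theta n) p0 K10 th0 mus sup avoid K20 'I_n r h hI k.
have le2 := @low_degree_overlap R _ (mu n) mu0 mu1 _ (K1 n) (K2 n) (theta n) p0 th0 mus sup avoid K20 'I_n r h hI k.
rewrite !card_ord rhoE in le1 le2.
rewrite /upper mulrDr; apply: (le_trans _ (lerD le1 (le_trans le2 _))); last by rewrite mulrCA.
rewrite -ExD; apply: Ex_le => // f _.
by rewrite -natrD ler_nat; case: low_degrees => //=; case: disjoint_family.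
Unshelve. all: by end_near. Qed.

Let expRB1_le (y : R) : 0 <= y -> y <= 1 / 2 -> expR y - 1 <= 2 * y.
Proof.
move=> y0 y2; have := expR_ge1Dx (- y); rewrite expRN => le.
have : expR y * (1 - y) <= 1.
  apply: le_trans (ler_wpM2l (expR_ge0 y) le) _.
  by rewrite mulfV // gt_eqF // expR_gt0.
have := expR_ge0 y; set e := expR y => e0 h; nra.
Qed.

(** The exponent in [x] is at most [L r^2 / K], below [l / 2] once [K >= 4 r^2 + 1]. So
    [x <= sqrt n], while [rho] is of order [ln n / n], and [x rho] outweighs the powers of [ln n] in
    front. *)
Let ov0 r : ov r @ \oo --> (0 : R).
Proof.
have y0 : (fun n => l n ^+ 1 * expR (- (1 / 2 * l n))) @ \oo --> (0 : R).
  by apply: poly_small; lra.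
have ylt := seq_near_lt y0 (_ : 0 < 1 / 4).
pose C : R := (2 * r%:R + 1) ^+ (r * k) * (r ^ 2)%:R * 4.
apply: (@seq_squeeze0 _ _ (fun n => C * (l n ^+ (r * k).+1 * expR (- (1 / 2 * l n))))); last first.
  by rewrite -[X in _ --> X](mulr0 C); apply: seq_scale; apply: poly_small; lra.
near=> n.
have n0 : (0 < n)%N by near: n.
have l1 : 1 <= l n by near: n; exact: l_ge.
have l0 : 0 <= l n by rewrite (le_trans ler01).
have /andP[b_ge b_le] : 1 <= n%:R * rho n <= 2 * l n by near: n.
have /andP[K1l K1u] : K n / 2 <= K1 n <= K n by near: n.
have Kr : 4 * (r ^ 2)%:R + 1 <= K n by near: n; exact: K_ge.
have L2 : L n <= 2 * l n by near: n.
have KPn : K n ^+ 2 / (P n)%:R = L n / n%:R by near: n.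
have r2 : 0 <= (r ^ 2)%:R :> R by [].
have Kp : 0 < K n by lra.
have np : n%:R != 0 :> R by rewrite pnatr_eq0 -lt0n.
have nKL : n%:R * K n / (P n)%:R * K n = L n.
  have -> : L n = n%:R * (K n ^+ 2 / (P n)%:R) by rewrite KPn mulrCA divff ?mulr1.
  by ring.
have x_le : theta n * (n%:R * (r ^ 2)%:R) <= 1 / 2 * l n.
  apply: le_trans (_ : n%:R * K n / (P n)%:R * (r ^ 2)%:R <= _).
    have -> : theta n * (n%:R * (r ^ 2)%:R) = n%:R * K1 n / (P n)%:R * (r ^ 2)%:R.
      by rewrite /theta; ring.
    by do 2!apply: ler_wpM2r => //; apply: ler_wpM2l.
  rewrite -(ler_pM2r Kp) mulrAC nKL.
  apply: le_trans (_ : 2 * l n * (r ^ 2)%:R <= _); first by rewrite ler_wpM2r.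
  have : l n * (4 * (r ^ 2)%:R + 1) <= l n * K n by rewrite ler_wpM2l.
  have : 0 <= l n * (r ^ 2)%:R by rewrite mulr_ge0.
  lra.
have rle : rho n <= 2 * l n * expR (- l n) by near: n.
set x := expR (theta n * (n%:R * (r ^ 2)%:R)).
have xr : x * rho n <= 2 * (l n ^+ 1 * expR (- (1 / 2 * l n))).
  apply: le_trans (_ : expR (1 / 2 * l n) * (2 * l n * expR (- l n)) <= _).
    by apply: ler_pM; rewrite ?expR_ge0 // ler_expR.
  have -> : - (1 / 2 * l n) = 1 / 2 * l n + - l n by field.
  by rewrite expRD expr1 le_eqVlt; apply/orP; left; apply/eqP; ring.
have xr0 : 0 <= x * rho n by rewrite mulr_ge0 ?expR_ge0.
have ylt' : l n ^+ 1 * expR (- (1 / 2 * l n)) < 1 / 4 by near: n; apply: ylt; lra.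
have e1 : expR (x * rho n) - 1 <= 2 * (x * rho n) by apply: expRB1_le => //; lra.
have e0 : 0 <= expR (x * rho n) - 1 by rewrite subr_ge0 -expR0 ler_expR.
have base : 0 <= 1 + n%:R * (r%:R * rho n) by rewrite addr_ge0 // mulr_ge0 // mulr_ge0.
have ble : 1 + n%:R * (r%:R * rho n) <= (2 * r%:R + 1) * l n.
  have : r%:R * (n%:R * rho n) <= r%:R * (2 * l n) by rewrite ler_wpM2l.
  rewrite (_ : n%:R * (r%:R * rho n) = r%:R * (n%:R * rho n)); last by ring.
  lra.
rewrite /ov -/x ger0_norm; last by apply: mulr_ge0; [apply: exprn_ge0|apply: mulr_ge0].
have pk : (1 + n%:R * (r%:R * rho n)) ^+ (r * k) <= ((2 * r%:R + 1) * l n) ^+ (r * k).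
  by apply: lerXn2r => //; rewrite nnegrE (le_trans base).
have s2 : (r ^ 2)%:R * (expR (x * rho n) - 1) <= (r ^ 2)%:R * (2 * (2 * (l n ^+ 1 * expR (- (1 / 2 * l n))))).
  apply: ler_wpM2l => //; lra.
apply: le_trans (ler_pM (exprn_ge0 _ base) (mulr_ge0 r2 e0) pk s2) _.
rewrite /C exprMn expr1 [l n ^+ _.+1]exprS.
by rewrite le_eqVlt; apply/orP; left; apply/eqP; ring.
Unshelve. all: by end_near. Qed.

(** Since [n rho ~ ln n] tends to infinity, the last term [j = k - 1] dominates the sum. *)
Let trunc_sum : (fun n => (d`!)%:R * (l n)^-1 ^+ d *
   \sum_(j < k) (n%:R * rho n) ^+ j / (j`!)%:R) @ \oo --> (1 : R).
Proof.
have lim : (fun n => \sum_(j < k) (d`!)%:R / (j`!)%:R * ((b2 n / l n) ^+ j * (l n)^-1 ^+ (d - j)))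
   @ \oo --> (\sum_(j < k) (d`!)%:R / (j`!)%:R * (1 ^+ j * 0 ^+ (d - j)) : R).
  by apply: seq_sum => j _; apply: seq_scale; apply: seq_mul; apply: seq_exp.
have E : \sum_(j < k) (d`!)%:R / (j`!)%:R * (1 ^+ j * 0 ^+ (d - j)) = 1 :> R.
  have dk : (d < k)%N by rewrite kE.
  rewrite (bigD1 (Ordinal dk)) //= subnn expr0 expr1n !mulr1 divff ?pnatr_eq0 -?lt0n ?fact_gt0 //.
  rewrite big1 ?addr0 // => j jd; have jd' : (j < d)%N.
    by rewrite ltn_neqAle jd -ltnS -kE ltn_ord.
  by rewrite expr0n subn_eq0 leqNgt jd' !mulr0.
rewrite E in lim; apply: seq_eq lim; near=> n.
have l1 : 1 <= l n by near: n; exact: l_ge.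
have b2n : n%:R * rho n = b2 n by near: n.
rewrite b2n mulr_sumr; apply: eq_bigr => j _.
have jd : (j <= d)%N by rewrite -ltnS -kE ltn_ord.
have lp : l n != 0 by rewrite gt_eqF // (lt_le_trans ltr01).
have -> : (l n)^-1 ^+ d = (l n)^-1 ^+ (d - j) * (l n)^-1 ^+ j by rewrite -exprD subnK.
by rewrite [(b2 n / l n) ^+ j]exprMn; ring.
Unshelve. all: by end_near. Qed.

Let exponent_id (a s x b m : R) : m != 0 ->
  a * (x - b) + a * s * (b / m) = a * x + (m - s) * - (a * (b / m)).
Proof. by move=> m0; field. Qed.

Let product_id (x y z u v : R) (i j : nat) :
  (x * y) ^+ i * (z ^+ j * (u ^+ i + v)) = x ^+ i * z ^+ j * ((y * u) ^+ i + y ^+ i * v).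
Proof. by rewrite !exprMn; ring. Qed.

(** [exp (r L)] cancels the avoidance factor up to the exponent [ex], which collects [L - b1] and
    the effect of the [r + r k] exempted vertices; both vanish in the limit. *)
Let upper_cvg1 r : (fun n => scale n ^+ r * upper r n) @ \oo --> (1 : R).
Proof.
pose ex n : R := r%:R * (L n - b1 n) + r%:R * (r + r * k)%:R * (b1 n / n%:R).
have ex0 : (fun n => expR (ex n)) @ \oo --> (1 : R).
  rewrite -(@expR0 R); apply: seq_expR.
  have : (fun n => r%:R * (L n - b1 n) + r%:R * (r + r * k)%:R * (b1 n / n%:R)) @ \oo -->
    (r%:R * 0 + r%:R * (r + r * k)%:R * 0 : R) by apply: seq_add; apply: seq_scale.
  by rewrite !mulr0 addr0.
have lim : (fun n => expR (ex n) * (((d`!)%:R * (l n)^-1 ^+ d *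
   \sum_(j < k) (n%:R * rho n) ^+ j / (j`!)%:R) ^+ r + ((d`!)%:R * (l n)^-1 ^+ d) ^+ r * ov r n))
   @ \oo --> (1 * (1 ^+ r + ((d`!)%:R * 0 ^+ d) ^+ r * 0) : R).
  apply: seq_mul => //; apply: seq_add; first exact: seq_exp.
  by apply: seq_mul => //; apply: seq_exp; apply: seq_scale; apply: seq_exp.
rewrite mulr0 addr0 expr1n mulr1 in lim; apply: seq_eq lim; near=> n.
have n0 : (r + r * k < n)%N by near: n; exact: nat_near.
have np : 0 < n%:R :> R by rewrite ltr0n; apply: leq_ltn_trans n0.
have -> : scale n = expR (L n) * ((d`!)%:R * (l n)^-1 ^+ d) by near: n.
have b1n : n%:R * (K1 n ^+ 2 / (P n)%:R) = b1 n by near: n.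
have exE : expR (ex n) = expR (L n) ^+ r * expR (- (theta n * (r%:R * K1 n))) ^+ (n - r - r * k).
  rewrite -!expRM_natl -expRD; congr expR; rewrite /ex -subnDA natrB ?(ltnW n0) //.
  have -> : theta n * (r%:R * K1 n) = r%:R * (b1 n / n%:R).
    have -> : b1 n / n%:R = K1 n ^+ 2 / (P n)%:R by rewrite -b1n mulrAC divff ?mul1r // gt_eqF.
    by rewrite /theta mulrCA; congr (_ * _); rewrite expr2 mulrAC.
  by apply: exponent_id; rewrite gt_eqF.
rewrite exE /upper; exact: product_id.
Unshelve. all: by end_near. Qed.

Let t n := K1 n ^+ 2 / (P n)%:R.
(** [t - t^2] stands for [1 - exp (- t)], which it bounds from below by [expRN_le], with
    [t = theta K1]. *)
Let qs (r n : nat) := t n - t n ^+ 2 - r%:R * rho n ^+ 2.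
Let q0 (r n : nat) := expR (- (r%:R * K2 n ^+ 2 / ((P n)%:R - r.+1%:R * K2 n))).
Let s1 (r n : nat) := 1 - (r ^ 2)%:R * ((P n)%:R * (K2 n / (P n)%:R) ^+ 2).
Let s2 (r n : nat) : R := 1 - (r ^ 2)%:R * (n%:R * (d%:R / (n - r)%:R) ^+ 2).
Let lower r n : R :=
  'C(n - r, d)%:R ^+ r * (s2 r n * (qs r n ^+ (r * d) * q0 r n ^+ n * s1 r n)).

Let rho0 : rho @ \oo --> (0 : R).
Proof. by have := rho_poly 0; under eq_fun do rewrite expr0 mul1r. Qed.

Let t0 : t @ \oo --> (0 : R).
Proof.
apply: seq_eq b1_n; near=> n; have n0 : (0 < n)%N by near: n.
have <- : n%:R * (K1 n ^+ 2 / (P n)%:R) = b1 n by near: n.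
by rewrite mulrAC divff ?mul1r // pnatr_eq0 -lt0n.
Unshelve. all: by end_near. Qed.

Let qs_lim r : (fun n => n%:R * qs r n / l n) @ \oo --> (1 : R).
Proof.
have lim : (fun n => b1 n / l n * (1 - t n) - r%:R * (b2 n / l n * rho n)) @ \oo -->
    (1 * (1 - 0) - r%:R * (1 * 0) : R).
  apply: seq_sub; last by apply: seq_scale; apply: seq_mul.
  by apply: seq_mul => //; apply: seq_sub => //; apply: cvg_cst.
rewrite mul1r !mulr0 !subr0 in lim; apply: seq_eq lim; near=> n.
have <- : n%:R * (K1 n ^+ 2 / (P n)%:R) = b1 n by near: n.
have <- : n%:R * rho n = b2 n by near: n.
rewrite /qs -/(t n); set a := t n; set b := rho n; set m := n%:R; set e := (l n)^-1.
clearbody a b m e.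
by rewrite expr2; ring.
Unshelve. all: by end_near. Qed.

Let qs_pos r : \forall n \near \oo, 0 <= qs r n.
Proof.
have gt := seq_near_gt (qs_lim r) (_ : 0 < 1); near=> n.
have n0 : (0 < n)%N by near: n.
have l1 : 1 <= l n by near: n; exact: l_ge.
have lp : 0 < l n by apply: lt_le_trans l1.
have : 0 < n%:R * qs r n / l n by near: n; apply: gt.
by rewrite pmulr_lgt0 ?invr_gt0 // pmulr_rgt0 ?ltr0n // => /ltW.
Unshelve. all: by end_near. Qed.

Let y_lim r : (fun n => l n * (r.+1%:R * K2 n / (P n)%:R)) @ \oo --> (0 : R).
Proof.
apply: (@seq_squeeze0 _ _ (fun n => r.+1%:R * (l n ^+ 1 * rho n))); last first.
  by rewrite -[X in _ --> X](mulr0 r.+1%:R); apply: seq_scale; apply: rho_poly.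
near=> n.
have l1 : 1 <= l n by near: n; exact: l_ge.
have l0 : 0 <= l n by rewrite (le_trans ler01).
have K0 : 1 <= K n by near: n; exact: K_ge.
have K21 : 1 <= K2 n.
  apply: le_trans K0 _; rewrite /K2 mulrDl mul1r lerDl.
  by apply: mulr_ge0 => //; rewrite (le_trans ler01) //; near: n; exact: K_ge.
have K20 : 0 <= K2 n by rewrite (le_trans ler01).
rewrite ger0_norm; last by rewrite mulr_ge0 // divr_ge0 // mulr_ge0.
rewrite expr1 (_ : l n * _ = r.+1%:R * (l n * (K2 n / (P n)%:R))); last first.
  by move: (l n) (K2 n) (P n)%:R => a b m; ring.
do 2!apply: ler_wpM2l => //.
by rewrite /rho ler_wpM2r ?invr_ge0 // expr2 ler_peMl.
Unshelve. all: by end_near. Qed.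

Let y0_lim r : (fun n => r.+1%:R * K2 n / (P n)%:R) @ \oo --> (0 : R).
Proof.
have := seq_mul linv (y_lim r); rewrite mulr0; apply: seq_eq; near=> n.
have l1 : 1 <= l n by near: n; exact: l_ge.
by rewrite mulKf // gt_eqF // (lt_le_trans ltr01).
Unshelve. all: by end_near. Qed.

Let q0_id (a b m k2 q : R) : q != 0 -> 1 - a * k2 / q != 0 -> q - a * k2 != 0 ->
  m * - (b * k2 ^+ 2 / (q - a * k2)) = - (b * (m * (k2 ^+ 2 / q))) * (1 - a * k2 / q)^-1.
Proof.
move=> q0' h1 h2; have -> : q - a * k2 = q * (1 - a * k2 / q) by field.
by rewrite invfM; ring.
Qed.

(** Apart from the denominator, the exponent of [q0 ^+ n] is [- r b2], and [b2 - L] tends to 0. The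
    denominator [P - (r + 1) K2] changes it by about [r b2 y], negligible because [l y] tends to
    0. *)
Let q0_lim r : (fun n => expR (L n) ^+ r * q0 r n ^+ n) @ \oo --> (1 : R).
Proof.
pose y n := r.+1%:R * K2 n / (P n)%:R.
have lim : (fun n => r%:R * (- (b2 n - L n) - b2 n / l n * (l n * y n) * (1 - y n)^-1)) @ \oo -->
    (r%:R * (- 0 - 1 * 0 * (1 - 0)^-1) : R).
  apply: seq_scale; apply: seq_sub; first by apply: cvgN; exact: b2_L.
  apply: seq_mul; first by apply: seq_mul => //; exact: y_lim.
  by apply: seq_inv; [rewrite subr0 oner_eq0|apply: seq_sub; [apply: cvg_cst|exact: y0_lim]].
rewrite oppr0 mulr0 mul0r subr0 mulr0 in lim.
have := seq_expR lim; rewrite expR0; apply: seq_eq; near=> n.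
have l1 : 1 <= l n by near: n; exact: l_ge.
have lp : l n != 0 by rewrite gt_eqF // (lt_le_trans ltr01).
have y1 : y n < 1 by near: n; apply: (seq_near_lt (y0_lim r)); lra.
have y1' : 1 - y n != 0 by rewrite gt_eqF // subr_gt0.
have Pp : 0 < (P n)%:R :> R by rewrite ltr0n.
have b2n : n%:R * rho n = b2 n by near: n.
have den : (P n)%:R - r.+1%:R * K2 n != 0.
  by have := y1; rewrite /y ltr_pdivrMr // mul1r => h; rewrite gt_eqF // subr_gt0.
rewrite /q0 -!expRM_natl -expRD; congr expR.
rewrite q0_id // ?gt_eqF // -/(y n) -/(rho n) b2n.
move: (b2 n) (L n) (l n) (y n) lp y1' => a b e z e0 z1.
by field; rewrite ?e0 ?z1.
Unshelve. all: by end_near. Qed.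

Let bin_lim (r m : nat) : (fun n => (m`!)%:R * 'C(n - r, m)%:R / n%:R ^+ m) @ \oo --> (1 : R).
Proof.
have lo : (fun n => (1 - (r + m)%:R * (n%:R)^-1) ^+ m) @ \oo --> (1 : R).
  rewrite -[X in _ --> X](expr1n _ m); apply: seq_exp.
  rewrite -[X in _ --> X](subr0 1); apply: seq_sub; first exact: cvg_cst.
  by rewrite -[X in _ --> X](mulr0 (r + m)%:R); apply: seq_scale.
apply: (@squeeze_cvgr _ _ _ _ (fun n => (1 - (r + m)%:R * (n%:R)^-1) ^+ m) (fun=> 1)) => //; last exact: cvg_cst.
near=> n.
have n0 : (r + m < n)%N by near: n; exact: nat_near.
have np : 0 < n%:R :> R by rewrite ltr0n; apply: leq_ltn_trans n0.
have ffE : (m`!)%:R * 'C(n - r, m)%:R = ((n - r) ^_ m)%:R :> R.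
  by rewrite -natrM mulnC bin_ffact.
rewrite ffE; apply/andP; split; last first.
  rewrite ler_pdivrMr ?exprn_gt0 // mul1r -natrX ler_nat.
  have := bin_ffact (n - r) m; have := binr_le R (n - r) m.
  rewrite ler_pdivlMr ?ltr0n ?fact_gt0 // -natrM -natrX ler_nat bin_ffact => le _.
  apply: leq_trans le _; case: (m) => // e; rewrite leq_exp2r //; lia.
have -> : 1 - (r + m)%:R * n%:R^-1 = (n - (r + m))%:R / n%:R :> R.
  have nE : (n - (r + m))%:R = n%:R - (r + m)%:R :> R by apply: natrB; apply: ltnW.
  by rewrite nE mulrBl divff // gt_eqF.
rewrite expr_div_n ler_wpM2r ?invr_ge0 ?exprn_ge0 // -natrX ler_nat.
rewrite subnDA; elim: (m) => // e IH.
rewrite ffactnSr expnSr.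
apply: leq_trans (_ : (n - r - e) ^ e * (n - r - e) <= _)%N.
  by rewrite leq_mul // ?leq_sub2l //; case: (e) => // e'; rewrite leq_exp2r // leq_sub2l.
by rewrite leq_mul.
Unshelve. all: by end_near. Qed.

Let s1_lim r : s1 r @ \oo --> (1 : R).
Proof.
have lim : (fun n => 1 - (r ^ 2)%:R * rho n) @ \oo --> (1 - (r ^ 2)%:R * 0 : R).
  by apply: seq_sub; [apply: cvg_cst|apply: seq_scale].
rewrite mulr0 subr0 in lim; apply: seq_eq lim; near=> n.
rewrite /s1 /rho; congr (1 - _ * _).
have Pn0 : (P n)%:R != 0 :> R by rewrite pnatr_eq0 -lt0n.
by field.
Unshelve. all: by end_near. Qed.

Let s2_id (a m : R) : m != 0 -> m * (2 * a / m) ^+ 2 = 4 * a ^+ 2 * m^-1.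
Proof. by move=> m0; field. Qed.

Let s2_lim r : s2 r @ \oo --> (1 : R).
Proof.
have lim : (fun n => 1 - (r ^ 2)%:R * (4 * d%:R ^+ 2 * n%:R^-1)) @ \oo --> (1 - (r ^ 2)%:R * (4 * d%:R ^+ 2 * 0) : R).
  by apply: seq_sub; [apply: cvg_cst|do 2!apply: seq_scale].
rewrite !mulr0 subr0 in lim.
apply: (squeeze_cvgr _ lim (cvg_cst (1 : R))).
near=> n.
have n0 : (2 * r < n)%N by near: n; exact: nat_near.
have np : 0 < n%:R :> R by rewrite ltr0n; apply: leq_ltn_trans n0.
have nr : n%:R / 2 <= (n - r)%:R :> R.
  rewrite ler_pdivrMr // -natrM ler_nat; lia.
have nrp : 0 < (n - r)%:R :> R.
  by rewrite ltr0n subn_gt0; apply: leq_ltn_trans n0; rewrite mul2n -addnn leq_addr.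
rewrite /s2; apply/andP; split; last first.
  by rewrite lerBlDr lerDl !mulr_ge0 // exprn_ge0 // divr_ge0.
rewrite lerD2l lerN2 ler_wpM2l //.
have le : d%:R / (n - r)%:R <= 2 * d%:R / n%:R :> R.
  rewrite [2 * d%:R]mulrC -[leRHS]mulrA; apply: ler_wpM2l => //.
  by rewrite -[leRHS]invrK lef_pV2 ?posrE // ?invr_gt0 ?divr_gt0 // invf_div.
apply: le_trans (_ : n%:R * (2 * d%:R / n%:R) ^+ 2 <= _).
  by apply: ler_wpM2l => //; apply: lerXn2r; rewrite ?nnegrE ?divr_ge0 ?mulr_ge0.
by rewrite s2_id ?lexx // gt_eqF.
Unshelve. all: by end_near. Qed.

Let lower_id (x f e v m s q z u : R) (r : nat) : m != 0 ->
  (f * v / m ^+ d) ^+ r * ((m * q * e) ^+ (r * d) * (x ^+ r * z) * (s * u)) =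
  (x * (f * e ^+ d)) ^+ r * (v ^+ r * (s * (q ^+ (r * d) * z * u))).
Proof.
move=> m0.
have -> : (m * q * e) ^+ (r * d) = (m ^+ d) ^+ r * q ^+ (r * d) * (e ^+ d) ^+ r.
  by rewrite !exprMn -!exprM ![(d * r)%N]mulnC.
have md : m ^+ d != 0 by rewrite expf_neq0.
move: (m ^+ d) (e ^+ d) (q ^+ (r * d)) md => m' e' q' md.
rewrite !exprMn exprVn; field; exact: expf_neq0.
Qed.

Let lower_cvg1 r : (fun n => scale n ^+ r * lower r n) @ \oo --> (1 : R).
Proof.
have lim : (fun n => ((d`!)%:R * 'C(n - r, d)%:R / n%:R ^+ d) ^+ r *
  ((n%:R * qs r n / l n) ^+ (r * d) * (expR (L n) ^+ r * q0 r n ^+ n) * (s2 r n * s1 r n))) @ \oo -->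
  (1 ^+ r * (1 ^+ (r * d) * 1 * (1 * 1)) : R).
  apply: seq_mul; first by apply: seq_exp; apply: bin_lim.
  apply: seq_mul; last by apply: seq_mul.
  by apply: seq_mul => //; apply: seq_exp; apply: qs_lim.
rewrite !expr1n !mulr1 in lim; apply: seq_eq lim; near=> n.
have n0 : (0 < n)%N by near: n.
have -> : scale n = expR (L n) * ((d`!)%:R * (l n)^-1 ^+ d) by near: n.
by rewrite /lower; apply/esym; apply: lower_id; rewrite pnatr_eq0 -lt0n.
Unshelve. all: by end_near. Qed.

Let expRN_le (z : R) : 0 <= z -> expR (- z) <= 1 - z + z ^+ 2.
Proof.
move=> z0; have e0 : 0 <= expR (- z) by exact: expR_ge0.
have : expR (- z) * (1 + z) <= 1.
  apply: le_trans (ler_wpM2l e0 (expR_ge1Dx z)) _.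
  by rewrite expRN mulVf // gt_eqF // expR_gt0.
have : 0 <= z ^+ 3 by rewrite exprn_ge0.
have zp : 0 < 1 + z by rewrite (lt_le_trans ltr01) // lerDl.
move=> z3 le; rewrite -(ler_pM2r zp); apply: le_trans le _.
by rewrite (_ : _ * (1 + z) = 1 + z ^+ 3); [rewrite lerDl|ring].
Qed.

Let low_lower r : \forall n \near \oo, forall h : 'I_r -> 'I_n, injective h ->
  lower r n <= Pb (fun f => low_degrees h k f).
Proof.
have s1p := seq_near_gt (s1_lim r) (_ : 0 < 1).
have s2p := seq_near_gt (s2_lim r) (_ : 0 < 1).
have ylt := seq_near_lt (y0_lim r) (_ : 0 < 1).
have tlt := seq_near_lt t0 (_ : 0 < 1).
near=> n => h hI.
have [[K10 K20 p0 th0] [mu0 mu1] mus [sup avoid] [_ avoid_ge]] : law_facts_at n by near: n.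
have rhoE : K2 n / (P n)%:R * K2 n = rho n by rewrite /rho expr2 mulrAC.
have tE : theta n * K1 n = t n by rewrite /t /theta expr2 mulrAC.
have n0 : (r + d < n)%N by near: n; exact: nat_near.
have Pp : 0 < (P n)%:R :> R by rewrite ltr0n.
have y1 : r.+1%:R * K2 n / (P n)%:R < 1 by near: n; apply: ylt.
have yP : r.+1%:R * K2 n < (P n)%:R by move: y1; rewrite ltr_pdivrMr // mul1r.
have t1 : t n < 1 by near: n; apply: tlt.
have t0' : 0 <= t n by rewrite divr_ge0 // exprn_ge0.
have qs0 : 0 <= qs r n by near: n; apply: qs_pos.
have r0 : 0 <= r%:R * rho n ^+ 2 by rewrite mulr_ge0 // exprn_ge0.
have et := expRN_le t0'.
have := @low_degree_lower R _ (mu n) mu0 mu1 (K2 n / (P n)%:R) (K1 n) (K2 n) (theta n) p0 th0 K20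
  mus sup avoid 'I_n r h hI d (q0 r n) (qs r n).
rewrite !card_ord rhoE tE -kE => le; apply: le.
- exact: expR_ge0.
- rewrite -[leRHS](@expR0 R) ler_expR oppr_le0; apply: divr_ge0.
    by apply: mulr_ge0 => //; exact: exprn_ge0.
  by rewrite subr_ge0; exact: ltW.
- exact: qs0.
- rewrite /qs; have : 0 <= t n ^+ 2 by exact: exprn_ge0.
  by move: (t n ^+ 2) (t n) (r%:R * _) r0 t1 => *; lra.
- by move=> U UK; apply: avoid_ge.
- by rewrite /qs lerD2r; lra.
- by rewrite leq_subRL ?(leq_trans (leq_addr d r)) // ltnW.
- by rewrite subn_gt0; apply: leq_ltn_trans n0; apply: leq_addr.
- exact: leq_ltn_trans (leq0n _) n0.
- by apply: ltW; near: n; apply: s1p.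
- by apply: ltW; near: n; apply: s2p.
Unshelve. all: by end_near. Qed.

(** * Moments and limit law of the number of vertices of low degree *)

Let low_count n (f : {ffun 'I_n -> {set 'I_(P n)}}) :=
  #|low_vertices k f|.

(** Binomial moments of the number of low vertices, the sums in the Bonferroni inequalities; [lam]
    is asymptotically the mean of that number. *)
Let S (r n : nat) : R := Ex (mu n) (fun f => 'C(low_count f, r)%:R).

Let lam n : R := expR (- alpha n) / (d`!)%:R.

Let lam_pos n : 0 < lam n.
Proof. by rewrite divr_gt0 ?expR_gt0. Qed.

Let scale_lam n : scale n * lam n = n%:R.
Proof.
by rewrite /scale /lam mulrACA divff ?gt_eqF // mulr1 -mulrA -expRD subrr expR0 mulr1.
Qed.

Let S_sum r n : S r n = \sum_(A : {set 'I_n} | #|A| == r)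
  Pb (fun f => [forall v in A, (#|nbrs (meet_rel f) v| < k)%N]).
Proof.
rewrite /Pb -Ex_sum; apply: eq_Ex => f; rewrite /low_count /= -cards_draws -sum1_card natr_sum.
rewrite big_mkcond [RHS]big_mkcond; apply: eq_bigr => A _; rewrite inE andbC.
case: (#|A| == r) => //=.
have -> : (A \subset low_vertices k f) =
    [forall v in A, (#|nbrs (meet_rel f) v| < k)%N].
  apply/fintype.subsetP/forall_inP => [sub v vA|sub v vA]; last by rewrite inE sub.
  by have := sub v vA; rewrite inE.
by case: [forall v in A, _].
Qed.

Let S_bounds r : \forall n \near \oo,
  'C(n, r)%:R * lower r n <= S r n <= 'C(n, r)%:R * upper r n.
Proof.
have lo := low_lower r; have up := low_upper r; near=> n.
have lon : forall h : 'I_r -> 'I_n, injective h -> lower r n <= Pb (fun f : {ffun 'I_n -> {set 'I_(P n)}} => low_degrees h k f).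
  by near: n.
have upn : forall h : 'I_r -> 'I_n, injective h -> Pb (fun f : {ffun 'I_n -> {set 'I_(P n)}} => low_degrees h k f) <= upper r n.
  by near: n.
have E (x : R) : 'C(n, r)%:R * x = \sum_(A : {set 'I_n} | #|A| == r) x.
  by rewrite sumr_draws card_ord.
have hA (A : {set 'I_n}) : #|A| == r -> exists2 h : 'I_r -> 'I_n, injective h &
   forall f : {ffun 'I_n -> {set 'I_(P n)}}, [forall v in A, (#|nbrs (meet_rel f) v| < k)%N] = low_degrees (O := 'I_(P n)) h k f.
  move=> /eqP Ar; exists (fun i => enum_val (cast_ord (esym Ar) i)).
    by move=> i j /enum_val_inj/cast_ord_inj.
  move=> f; apply/forall_inP/forallP => [H i|H v vA]; first by apply: H; apply: enum_valP.
  have := H (cast_ord Ar (enum_rank_in vA v)).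
  by rewrite cast_ordK enum_rankK_in.
rewrite !E S_sum; apply/andP; split; apply: ler_sum => A Ar; have [h hI hE] := hA A Ar.
  by rewrite /Pb; under eq_Ex do rewrite hE; apply: lon.
by rewrite /Pb; under eq_Ex do rewrite hE; apply: upn.
Unshelve. all: by end_near. Qed.

(** Normalising by [lam], which may converge or tend to 0 or to infinity, makes this serve all three
    cases. *)
Let S_lim r : (fun n => (r`!)%:R * S r n / lam n ^+ r) @ \oo --> (1 : R).
Proof.
have binl : (fun n => (r`!)%:R * 'C(n, r)%:R / n%:R ^+ r) @ \oo --> (1 : R).
  by have := bin_lim 0 r; apply: seq_eq; near=> n; rewrite subn0.
have lo := seq_mul binl (lower_cvg1 r); have up := seq_mul binl (upper_cvg1 r).
rewrite mulr1 in lo up.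
apply: (squeeze_cvgr _ lo up); near=> n.
have n0 : (0 < n)%N by near: n.
have /andP[Slo Sup] : 'C(n, r)%:R * lower r n <= S r n <= 'C(n, r)%:R * upper r n.
  by near: n; apply: S_bounds.
have lr : 0 < lam n ^+ r by rewrite exprn_gt0.
have E x : (r`!)%:R * 'C(n, r)%:R / n%:R ^+ r * (scale n ^+ r * x) =
    (r`!)%:R * ('C(n, r)%:R * x) / lam n ^+ r.
  rewrite -(scale_lam n) exprMn.
  have sr : scale n ^+ r != 0.
    rewrite expf_neq0 // gt_eqF // /scale !mulr_gt0 ?expR_gt0 //.
    by rewrite ltr0n.
  move: (scale n ^+ r) (lam n ^+ r) sr lr => a b a0 b0.
  by field; rewrite a0 gt_eqF.
by rewrite !E; apply/andP; split; apply: ler_wpM2r; rewrite ?invr_ge0 ?(ltW lr) //; apply: ler_wpM2l.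
Unshelve. all: by end_near. Qed.

Let none_low n := Pb (fun f : {ffun 'I_n -> {set 'I_(P n)}} =>
  [forall v, (k <= #|nbrs (meet_rel f) v|)%N]).

Let none_lowE n (f : {ffun 'I_n -> {set 'I_(P n)}}) :
  [forall v, (k <= #|nbrs (meet_rel f) v|)%N] = (low_count f == 0%N).
Proof.
rewrite cards_eq0; apply/forallP/eqP => [H|/setP H v].
  by apply/setP => v; rewrite !inE ltnNge H.
by have := H v; rewrite !inE ltnNge => /negbFE.
Qed.

Let law01 : \forall n \near \oo, (forall y, 0 <= mu n y) /\ \sum_y mu n y = 1.
Proof.
near=> n; have [_ ? _ _ _] : law_facts_at n by near: n.
by [].
Unshelve. all: by end_near. Qed.

Lemma none_low_finite (a : R) : alpha @ \oo --> a ->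
  none_low @ \oo --> expR (- (expR (- a) / (d`!)%:R)).
Proof.
move=> al.
have laml : lam @ \oo --> expR (- a) / (d`!)%:R.
  by apply: seq_mul; [apply: seq_expR; apply: cvgN|exact: cvg_cst].
apply: (@bonferroni_limit R _ S) => [p|j].
  near=> n; have [mu0 mu1] : (forall y, 0 <= mu n y) /\ \sum_y mu n y = 1 by near: n.
  rewrite /none_low /Pb /S.
  have E m : \sum_(j < m) (-1) ^+ j * Ex (mu n) (fun f : {ffun 'I_n -> {set 'I_(P n)}} => 'C(low_count f, j)%:R) =
     Ex (mu n) (fun f : {ffun 'I_n -> {set 'I_(P n)}} => \sum_(j < m) (-1) ^+ j * 'C(low_count f, j)%:R).
    by rewrite Ex_sum; apply: eq_bigr => j _; rewrite ExZ.
  rewrite !E; apply/andP; split; apply: Ex_le => // f _; rewrite none_lowE.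
    by case: (bonferroni R (low_count f) p).
  by case: (bonferroni R (low_count f) p).
have lim : (fun n => (j`!)%:R * S j n / lam n ^+ j * (lam n ^+ j / (j`!)%:R)) @ \oo -->
   (1 * ((expR (- a) / (d`!)%:R) ^+ j / (j`!)%:R) : R).
  by apply: seq_mul; [exact: S_lim|apply: seq_mul; [exact: seq_exp|exact: cvg_cst]].
rewrite mul1r in lim; apply: seq_eq lim; near=> n.
have lj : lam n ^+ j != 0 by rewrite gt_eqF // exprn_gt0.
have fj : (j`!)%:R != 0 :> R by rewrite gt_eqF.
move: (lam n ^+ j) (S j n) lj => x y lj.
by field; rewrite fj lj.
Unshelve. all: by end_near. Qed.

Let none_low_le1 : \forall n \near \oo, 0 <= none_low n <= 1.
Proof.
near=> n; have [mu0 mu1] : (forall y, 0 <= mu n y) /\ \sum_y mu n y = 1 by near: n.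
rewrite Ex_ge0 //= -[leRHS](Ex_cst 'I_n mu1); apply: Ex_le => // f _.
by rewrite lern1 leq_b1.
Unshelve. all: by end_near. Qed.

Lemma none_low_pinfty : alpha @ \oo --> +oo -> none_low @ \oo --> (1 : R).
Proof.
move=> al.
have lam0 : lam @ \oo --> (0 : R).
  have := @seq_pow_exp R _ 1 0 ltr01 al => e0.
  have : (fun n => alpha n ^+ 0 * expR (- (1 * alpha n)) * (d`!)%:R^-1) @ \oo --> (0 * (d`!)%:R^-1 : R).
    by apply: seq_mul; [exact: e0|exact: cvg_cst].
  by rewrite mul0r; apply: seq_eq; near=> n; rewrite expr0 !mul1r.
have S0 : S 1 @ \oo --> (0 : R).
  have := seq_mul (S_lim 1) lam0; rewrite mulr0; apply: seq_eq; near=> n.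
  by rewrite (_ : (1`!)%:R = 1 :> R) // mul1r expr1 divfK // gt_eqF.
have lim : (fun n => 1 - S 1 n) @ \oo --> (1 - 0 : R) by apply: seq_sub => //; apply: cvg_cst.
rewrite subr0 in lim; apply: (squeeze_cvgr _ lim (cvg_cst (1 : R))); near=> n.
have [mu0 mu1] : (forall y, 0 <= mu n y) /\ \sum_y mu n y = 1 by near: n.
have /andP[_ ->] : 0 <= none_low n <= 1 by near: n.
rewrite andbT lerBlDr /none_low /Pb /S -ExD -[leLHS](Ex_cst 'I_n mu1).
apply: Ex_le => // f _; rewrite none_lowE bin1 -natrD ler1n.
by case: (low_count f) => // m; rewrite addnS.
Unshelve. all: by end_near. Qed.

(** Chebyshev's inequality around [lam] instead of the exact mean: for the number [X] of low
    vertices, the indicator of [X = 0] is at most [(X - lam)^2 / lam^2], whose mean is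
    [u 2 + u 1 / lam - 2 u 1 + 1]. *)
Lemma none_low_ninfty : alpha @ \oo --> -oo -> none_low @ \oo --> (0 : R).
Proof.
move=> al.
have il0 : (fun n => (lam n)^-1) @ \oo --> (0 : R).
  have al' : (fun n => - alpha n) @ \oo --> +oo by apply/cvgNry.
  have := @seq_pow_exp R _ 1 0 ltr01 al' => e0.
  have : (fun n => (d`!)%:R * ((- alpha n) ^+ 0 * expR (- (1 * (- alpha n))))) @ \oo --> ((d`!)%:R * 0 : R).
    by apply: seq_scale; exact: e0.
  by rewrite mulr0; apply: seq_eq; near=> n; rewrite expr0 !mul1r opprK /lam invf_div expRN invrK.
pose u j n := (j`!)%:R * S j n / lam n ^+ j.
have lim : (fun n => u 2 n + u 1%N n * (lam n)^-1 - 2 * u 1%N n + 1) @ \oo -->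
    (1 + 1 * 0 - 2 * 1 + 1 : R).
  apply: seq_add; last exact: cvg_cst.
  apply: seq_sub; last by apply: seq_scale; exact: S_lim.
  by apply: seq_add; [exact: S_lim|apply: seq_mul => //; exact: S_lim].
rewrite mulr0 addr0 mulr1 (_ : 1 - 2 + 1 = 0 :> R) in lim; last by ring.
apply: (@seq_squeeze0 _ _ _ _ lim); near=> n.
have [mu0 mu1] : (forall y, 0 <= mu n y) /\ \sum_y mu n y = 1 by near: n.
have /andP[p0 _] : 0 <= none_low n <= 1 by near: n.
rewrite ger0_norm //.
have lp := lam_pos n; have l2 : 0 < lam n ^+ 2 by rewrite exprn_gt0.
have E : u 2 n + u 1%N n * (lam n)^-1 - 2 * u 1%N n + 1 =
    (2 * S 2 n + S 1 n - 2 * lam n * S 1 n + lam n ^+ 2) / lam n ^+ 2.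
  rewrite /u (_ : (2`!)%:R = 2 :> R) // (_ : (1`!)%:R = 1 :> R) //.
  move: (S 2 n) (S 1 n) (lam n) lp => x y z z0; field; exact: lt0r_neq0.
rewrite E ler_pdivlMr // /none_low /Pb /S -ExZr -!ExZ -ExD -ExB -[X in _ <= _ + X](Ex_cst 'I_n mu1) -ExD.
apply: Ex_le => // f _; rewrite none_lowE bin1.
have bin2E : 2 * 'C(low_count f, 2)%:R = (low_count f)%:R ^+ 2 - (low_count f)%:R :> R.
  rewrite -natrM mulnC (bin_ffact (low_count f) 2) ffactnS ffactn1 natrM.
  case: (low_count f) => [|m]; first by rewrite mul0r expr0n subr0.
  by rewrite /= -natr1; ring.
case: eqP => [->|_].
  by rewrite mul1r bin0n /=; lra.
rewrite mul0r bin2E; have := sqr_ge0 ((low_count f)%:R - lam n).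
rewrite sqrrB; lra.
Unshelve. all: by end_near. Qed.

Let connected n := Pb (fun f : {ffun 'I_n -> {set 'I_(P n)}} =>
  `[< k_connected k (meet_rel f) >]).

Let connected_limit (x : R) : none_low @ \oo --> x -> connected @ \oo --> x.
Proof.
move=> nl; have := seq_sub nl connected_degree_cvg0; rewrite subr0.
by apply: seq_eq; near=> n; rewrite subKr.
Unshelve. all: by end_near. Qed.

Lemma k_connected_cvg : [/\ alpha @ \oo --> -oo -> connected @ \oo --> (0 : R),
  alpha @ \oo --> +oo -> connected @ \oo --> (1 : R) &
  forall a : R, alpha @ \oo --> a ->
    connected @ \oo --> expR (- (expR (- a) / (d`!)%:R))].
Proof.
split=> [al|al|a al]; apply: connected_limit.
- exact: none_low_ninfty.
- exact: none_low_pinfty.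
- exact: none_low_finite.
Qed.

End Asymptotics.

(** * From probability measures to finite sums *)

Lemma measure_preimage_seq (d : measure_display) (T : measurableType d) (R : realType)
    (mu : {measure set T -> \bar R}) (V : eqType) (F : T -> V) (s : seq V) :
  (forall v, measurable [set w | F w = v]) -> uniq s ->
  mu [set w | F w \in s] = (\sum_(v <- s) mu [set w | F w = v])%E.
Proof.
move=> mF; have mFs : forall r : seq V, measurable [set w | F w \in r].
  elim=> [|v r mr].
    by rewrite (_ : [set _ | _] = set0) //; apply/seteqP; split.
  rewrite (_ : [set _ | _] = [set w | F w = v] `|` [set w | F w \in r]); first exact: measurableU.
  by apply/seteqP; split=> w /=; rewrite inE; move/predU1P.
elim: s => [|v s IH] /=.
  by rewrite big_nil (_ : [set _ | _] = set0) ?measure0 //; apply/seteqP; split.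
case/andP => vs us; rewrite big_cons -IH // -measureU //.
  by congr (mu _); apply/seteqP; split=> w /=; rewrite inE; move/predU1P.
by apply/seteqP; split=> // w /= [->]; apply/negP.
Qed.

Section BoundedLaw.
Variables (R : realType) (m : nat) (D : probability nat R).
Hypothesis D_supp : D [set x : nat | (1 <= x <= m)%N] = 1%E.

Let w (s : nat) : R := fine (D [set s]).

Let wE s : D [set s] = (w s)%:E.
Proof. by rewrite fineK // fin_num_measure. Qed.

Let D_above : D (~` [set x : nat | (x < m.+1)%N]) = 0%E.
Proof.
apply/eqP; rewrite eq_le measure_ge0 andbT.
apply: le_trans (_ : D (~` [set x : nat | (1 <= x <= m)%N]) <= _)%E.
  by apply: le_measure; rewrite ?inE // => x /= xm /andP[_ xm']; apply: xm; rewrite ltnS.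
by rewrite probability_setC // D_supp subee.
Qed.

Lemma bounded_law_integral (g : nat -> R) : (forall s, 0 <= g s) ->
  (\int[D]_x (g x)%:E)%E = (\sum_(s < m.+1) fine (D [set nat_of_ord s]) * g s)%:E.
Proof.
move=> g0; rewrite (ge0_negligible_integral _ _ _ _ D_above) //; last first.
  by move=> x _; rewrite lee_fin.
rewrite (_ : setT `\` _ = \big[setU/set0]_(s <- iota 0 m.+1) [set s]); last first.
  rewrite setTD setCK -bigcup_seq; apply/seteqP; split=> x.
    by move=> xm; exists x => //; apply: etrans xm; apply: mem_iota.
  by case=> y ym ->; apply: etrans ym; apply/esym/mem_iota.
rewrite ge0_integral_bigsetU ?iota_uniq //; last first.
- by move=> x _; rewrite lee_fin.
- by move=> i j _ _ [x [/= <- <-]].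
rewrite -sumEFin -(big_mkord predT (fun s => (fine (D [set s]) * g s)%:E)).
rewrite /index_iota subn0; apply: eq_bigr => s _.
rewrite (eq_integral (cst (g s)%:E)); last by move=> x; rewrite inE => ->.
rewrite integral_cst // (mulrC (fine _)) EFinM; congr mule; exact: wE.
Qed.

Lemma bounded_law_sum1 : \sum_(s < m.+1) fine (D [set nat_of_ord s]) = 1.
Proof.
apply: EFin_inj; transitivity (1%:E * D setT)%E; last by rewrite probability_setT mule1.
apply: etrans (integral_cst D measurableT 1%:E).
apply: etrans (esym (bounded_law_integral (fun=> ler01))); congr EFin.
by apply: eq_bigr => s _; rewrite mulr1.
Qed.

Lemma bounded_law_mean : mean D = \sum_(s < m.+1) fine (D [set nat_of_ord s]) * s%:R.
Proof. by rewrite /mean unlock bounded_law_integral. Qed.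

Lemma bounded_law_var :
  var D = \sum_(s < m.+1) fine (D [set nat_of_ord s]) * (s%:R - mean D) ^+ 2.
Proof.
rewrite /var /variance unlock unlock.
apply: (congr1 fine (etrans _ (bounded_law_integral (fun s => sqr_ge0 (s%:R - mean D))))).
apply: eq_integral => x _ /=.
by rewrite expr2 /mean unlock.
Qed.

Lemma bounded_law_chebyshev (t : R) : 0 < t ->
  \sum_(s < m.+1 | t < `|s%:R - mean D|) fine (D [set nat_of_ord s]) <= var D / t ^+ 2.
Proof.
move=> t0; rewrite ler_pdivlMr ?exprn_gt0 // mulr_suml bounded_law_var.
rewrite [leRHS](bigID (fun s : 'I__ => t < `|s%:R - mean D|)) /= -[leLHS]addr0; apply: lerD.
  apply: ler_sum => s ts; rewrite ler_wpM2l ?fine_ge0 // -[leRHS]real_normK ?num_real //.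
  by rewrite lerXn2r ?nnegrE ?(ltW t0) ?(ltW ts).
by apply: sumr_ge0 => s _; rewrite mulr_ge0 ?fine_ge0 ?sqr_ge0.
Qed.

End BoundedLaw.

Section ObjectSetLaw.
Variables (R : realType) (d : measure_display) (Omega : measurableType d).
Variables (Pr : probability Omega R) (n m : nat) (D : probability nat R).
Variable obj : 'I_n -> Omega -> {set 'I_m}.
Hypothesis law : random_object_sets Pr D obj.

(** The event is a finite disjoint union of fibres of the whole family; [ros_independent] with
    singletons [B i] gives the measure of each fibre as a product. *)
Lemma object_sets_law (Q : pred {ffun 'I_n -> {set 'I_m}}) :
  Pr [set w | Q [ffun i => obj i w]] =
  (Ex (size_biased (fun s => fine (D [set s]))) (fun f : {ffun 'I_n -> {set 'I_m}} => (Q f)%:R))%:E.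
Proof.
pose F w := [ffun i => obj i w].
have FE f : [set w | F w = f] = [set w | forall i, obj i w = f i].
  apply/seteqP; split=> w /= => [<- i|fw]; first by rewrite ffunE.
  by apply/ffunP => i; rewrite ffunE.
have mF f : measurable [set w | F w = f].
  rewrite FE (_ : [set w | _] = \bigcap_(i in [set: 'I_n]) [set w | obj i w = f i]).
    apply: fin_bigcap_measurable => // i _; exact: (ros_measurable law).
  by apply/seteqP; split=> w /= fw => [i _|i]; apply: fw.
rewrite (_ : [set w | _] = [set w | F w \in [seq f <- index_enum _ | Q f]]); last first.
  by apply/seteqP; split=> w /=; rewrite mem_filter mem_index_enum andbT.
rewrite measure_preimage_seq ?filter_uniq ?index_enum_uniq // big_filter /Ex -sumEFin.
rewrite big_mkcond; apply: eq_bigr => f _.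
case: (Q f); last by rewrite mulr0.
rewrite mulr1 FE; apply: etrans (ros_independent law (fun i => [set f i])) _.
rewrite -prodEFin; apply: eq_bigr => i _; rewrite /= (ros_uniform law i erefl) (ros_size law) /size_biased card_ord EFinM.
by rewrite fineK ?fin_num_measure.
Qed.

End ObjectSetLaw.

(** * Cost of conditioning on typical sizes *)

Lemma bernoulli_ineq (R : realType) (x : R) (n : nat) : 0 <= x -> x <= 1 ->
  1 - x ^+ n <= n%:R * (1 - x).
Proof.
move=> x0 x1; elim: n => [|n IH]; first by rewrite expr0 subrr mul0r.
have xn : x ^+ n <= 1 by rewrite exprn_ile1.
have : x ^+ n * (1 - x) <= 1 - x by rewrite ler_piMl // subr_ge0.
rewrite exprSr -natr1; lra.
Qed.

Section Domination.
Variables (R : realType) (T I : finType) (mu nu : T -> R) (g : R).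
Hypotheses (g_ge0 : 0 <= g) (g_le1 : g <= 1) (nu_ge0 : forall y, 0 <= nu y).
Hypotheses (mu_sum1 : \sum_y mu y = 1) (nu_sum1 : \sum_y nu y = 1).
Hypothesis dominated : forall y, g * nu y <= mu y.

Let Ex_dominated (Q : pred {ffun I -> T}) :
  g ^+ #|I| * Ex nu (fun f : {ffun I -> T} => (Q f)%:R) <= Ex mu (fun f : {ffun I -> T} => (Q f)%:R).
Proof.
rewrite /Ex mulr_sumr; apply: ler_sum => f _; rewrite mulrA ler_wpM2r //.
rewrite -prodr_const -big_split /=; apply: ler_prod => i _.
by rewrite dominated mulr_ge0.
Qed.

(** Domination in every coordinate gives a factor [g ^+ #|I|] for [Q] and for its complement, so the
    two probabilities differ by at most [1 - g ^+ #|I|]. *)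
Lemma Ex_total_variation (Q : pred {ffun I -> T}) :
  `|Ex mu (fun f : {ffun I -> T} => (Q f)%:R) - Ex nu (fun f : {ffun I -> T} => (Q f)%:R)| <= #|I|%:R * (1 - g).
Proof.
have compl (w : T -> R) : \sum_y w y = 1 ->
    Ex w (fun f : {ffun I -> T} => (~~ Q f)%:R) = 1 - Ex w (fun f : {ffun I -> T} => (Q f)%:R).
  move=> w1; rewrite -[X in X - _](Ex_cst I w1) -ExB.
  by apply: eq_Ex => f; case: (Q f); rewrite ?subrr ?subr0.
have lo := Ex_dominated Q; have := Ex_dominated (predC Q); rewrite /= !compl // => hi.
have := bernoulli_ineq #|I| g_ge0 g_le1.
have y0 : 0 <= Ex nu (fun f : {ffun I -> T} => (Q f)%:R) by apply: Ex_ge0.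
have y1 : 0 <= 1 - Ex nu (fun f : {ffun I -> T} => (Q f)%:R) by rewrite -compl //; apply: Ex_ge0.
have gn : 0 <= 1 - g ^+ #|I| by rewrite subr_ge0 exprn_ile1.
move: lo hi y0 y1 gn; set x := Ex mu _; set y := Ex nu _; set h := g ^+ _; set b := _ * (1 - g).
move=> lo hi y0 y1 gn hb; have := mulr_ge0 gn y0; have := mulr_ge0 gn y1.
rewrite ler_norml => ? ?; apply/andP; split; lra.
Qed.

End Domination.

Section Conditioning.
Variables (R : realType) (n m : nat) (w : nat -> R) (good : pred nat).
Hypotheses (w_ge0 : forall s, 0 <= w s) (w_sum1 : \sum_(s < m.+1) w s = 1).

Let G := \sum_(s < m.+1 | good s) w s.

Definition conditioned (s : nat) : R := if good s && (s <= m)%N then w s / G else 0.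

Hypothesis G_gt0 : 0 < G.

Lemma conditioned_ge0 s : 0 <= conditioned s.
Proof. by rewrite /conditioned; case: ifP => // _; rewrite divr_ge0 // ltW. Qed.

Lemma conditioned_sum1 : \sum_(s < m.+1) conditioned s = 1.
Proof.
rewrite -[RHS](divff (lt0r_neq0 G_gt0)) {1}/G mulr_suml [RHS]big_mkcond /=.
by apply: eq_bigr => s _; rewrite /conditioned -ltnS ltn_ord andbT.
Qed.

Lemma conditioned_good s : 0 < conditioned s -> good s.
Proof. by rewrite /conditioned; case: (good s); rewrite ?ltxx. Qed.

Lemma conditioned_dist (Q : pred {ffun 'I_n -> {set 'I_m}}) :
  `|Ex (size_biased w) (fun f : {ffun 'I_n -> {set 'I_m}} => (Q f)%:R)
    - Ex (size_biased conditioned) (fun f : {ffun 'I_n -> {set 'I_m}} => (Q f)%:R)| <=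
  n%:R * \sum_(s < m.+1 | ~~ good s) w s.
Proof.
have GE : \sum_(s < m.+1 | ~~ good s) w s = 1 - G.
  by rewrite -[in RHS]w_sum1 [in RHS](bigID (fun s : 'I__ => good s)) /= addrAC subrr add0r.
have cardm : #|'I_m| = m := card_ord m.
rewrite GE; apply: le_trans (_ : #|'I_n|%:R * (1 - G) <= _); last by rewrite card_ord.
apply: Ex_total_variation.
- exact: ltW.
- by rewrite -subr_ge0 -GE sumr_ge0.
- by apply: size_biased_ge0; apply: conditioned_ge0.
- by apply: size_biased_sum1; rewrite ?card_ord.
- by apply: size_biased_sum1; rewrite ?card_ord //; apply: conditioned_sum1.
- move=> y; rewrite /size_biased mulrA ler_wpM2r ?invr_ge0 // /conditioned.
  by case: ifP => _; rewrite ?mulr0 // mulrCA divff ?mulr1 // gt_eqF.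
Qed.

End Conditioning.

(** * Choice of the size window and conclusion *)

Lemma eqOmega_near (R : realType) (u v : nat -> R) : u =Omega_\oo v ->
  exists2 c : R, 0 < c & \forall n \near \oo, c * `|v n| <= `|u n|.
Proof. by rewrite eqOmegaE qualifE => /asboolP. Qed.

Lemma eqo_near (R : realType) (u v : nat -> R) : u =o_\oo v ->
  forall e : R, 0 < e -> \forall n \near \oo, `|u n| <= e * `|v n|.
Proof. by move/eqoP. Qed.

Theorem theorem1 (R : realType) (k : nat) (P : nat -> nat)
    (D : nat -> probability nat R) (alpha : nat -> R)
    (d : nat -> measure_display) (Omega : forall n, measurableType (d n))
    (Pr : forall n, probability (Omega n) R)
    (obj : forall n, 'I_n -> Omega n -> {set 'I_(P n)})
    (k_gt0 : (0 < k)%N)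
    (P_gt0 : forall n, (0 < P n)%N)
    (D_supp : forall n, D n [set x : nat | (1 <= x <= P n)%N] = 1%E)
    (obj_law : forall n, random_object_sets (Pr n) (D n) (obj n))
    (alphaE : forall n, (2 <= n)%N ->
      mean (D n) ^+ 2 / (P n)%:R =
        (ln n%:R + (k.-1)%:R * ln (ln n%:R) + alpha n) / n%:R)
    (mean_Omega :
      (fun n => mean (D n)) =Omega_\oo (fun n => Num.sqrt (ln n%:R) : R))
    (var_o :
      (fun n => var (D n)) =o_\oo
        (fun n => mean (D n) ^+ 2 / (n%:R * ln n%:R ^+ 2)))
    (alpha_o : (fun n => `|alpha n|) =o_\oo (fun n => ln n%:R : R)) :
  let p : nat -> \bar R := fun n =>
    Pr n [set w | k_connected k (intersection_graph (fun i => obj n i w))] in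
  [/\ alpha @ \oo --> -oo -> p @ \oo --> 0%:E,
      alpha @ \oo --> +oo -> p @ \oo --> 1%:E &
      forall a : R, alpha @ \oo --> a ->
        p @ \oo --> (expR (- (expR (- a) / ((k.-1)`!)%:R)))%:E].
Proof.
move=> p.
pose K n : R := mean (D n); pose l n : R := ln n%:R.
pose w n s : R := fine (D n [set s]).
have w0 n s : 0 <= w n s by rewrite fine_ge0.
have w1 n : \sum_(s < (P n).+1) w n s = 1 := bounded_law_sum1 (D_supp n).
pose Q n : pred {ffun 'I_n -> {set 'I_(P n)}} := fun f => `[< k_connected k (meet_rel f) >].
pose q n (mu : {set 'I_(P n)} -> R) : R := Ex mu (fun f : {ffun 'I_n -> {set 'I_(P n)}} => (Q n f)%:R).
have pE n : p n = (q n (size_biased (w n)))%:E.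
  rewrite /q -(object_sets_law (obj_law n)) /p; congr (Pr n _).
  have E x : (meet_rel [ffun i => obj n i x] : rel 'I_n) = intersection_graph (fun i => obj n i x).
    by apply/funext => i; apply/funext => j; rewrite /meet_rel /intersection_graph !ffunE.
  by apply/seteqP; split=> x /=; rewrite /Q E => /asboolP.
have l_infty : l @ \oo --> +oo := @seq_ln_ninfty R.
have l_gt0 : \forall n \near \oo, 0 < l n.
  by apply: cvgry_gt l_infty _.
have K_ge0 n : 0 <= K n.
  rewrite /K (bounded_law_mean (D_supp n)); apply: sumr_ge0 => s _.
  by rewrite mulr_ge0 ?w0.
have [c c_gt0 Kc'] := eqOmega_near mean_Omega.
have Kc : \forall n \near \oo, c * Num.sqrt (l n) <= K n.
  apply: filterS Kc' => n.
  by rewrite (ger0_norm (sqrtr_ge0 _)) (ger0_norm (K_ge0 n)).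
have K_gt0 : \forall n \near \oo, 0 < K n.
  near=> n; have cK : c * Num.sqrt (l n) <= K n by near: n.
  apply: lt_le_trans cK; rewrite mulr_gt0 // sqrtr_gt0.
  by near: n.
pose v n : R := var (D n).
have v_ge0 n : 0 <= v n.
  rewrite /v (bounded_law_var (D_supp n)); apply: sumr_ge0 => s _.
  by rewrite mulr_ge0 ?sqr_ge0 ?w0.
(* The first term is the ratio that the variance hypothesis sends to 0. The term [1 / n] keeps [e n]
   positive when the variance is 0, as Chebyshev's inequality needs a positive threshold. *)
pose e n : R := v n * (n%:R * l n ^+ 2) / K n ^+ 2 + n%:R^-1.
have e_ge0 n : 0 <= e n by rewrite addr_ge0 ?invr_ge0 // divr_ge0 ?sqr_ge0 // mulr_ge0 ?v_ge0 // mulr_ge0 ?sqr_ge0.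
have e_cvg0 : e @ \oo --> (0 : R).
  suff H : (fun n => v n * (n%:R * l n ^+ 2) / K n ^+ 2) @ \oo --> (0 : R).
    by have := seq_add H (seq_inv_infty (@seq_ninfty R)); rewrite addr0.
  apply/cvgrPdist_le => x x0; near=> n.
  have Kn : 0 < K n ^+ 2 by rewrite exprn_gt0 //; near: n.
  have ln2 : 0 < n%:R * l n ^+ 2.
    rewrite mulr_gt0 ?ltr0n ?exprn_gt0 //; last by near: n.
    by near: n; exists 1%N.
  have : `|v n| <= x * `|K n ^+ 2 / (n%:R * l n ^+ 2)| by near: n; apply: (eqo_near var_o x0).
  rewrite (ger0_norm (v_ge0 n)) (ger0_norm (divr_ge0 (ltW Kn) (ltW ln2))) => le.
  rewrite sub0r normrN (ger0_norm (divr_ge0 (mulr_ge0 (v_ge0 n) (ltW ln2)) (ltW Kn))).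
  by rewrite ler_pdivrMr // -ler_pdivlMr // -mulrA.
(* The fourth root meets both demands: [eps ln n = e^(1/4)] tends to 0, and [n] times the Chebyshev
   bound [v / (eps K)^2] is at most [e / sqrt e = sqrt e], which also tends to 0. *)
pose eps n : R := Num.sqrt (Num.sqrt (e n)) / l n.
pose good n : pred nat := fun s => `|s%:R - K n| <= eps n * K n.
pose bad n : R := \sum_(s < (P n).+1 | ~~ good n s) w n s.
have bad_le : \forall n \near \oo, n%:R * bad n <= Num.sqrt (e n).
  near=> n; have n0 : 0 < n%:R :> R by rewrite ltr0n; near: n; exists 1%N.
  have Kn : 0 < K n by near: n.
  have ln0 : 0 < l n by near: n.
  have en : 0 < e n.
    by rewrite ltr_wpDl ?invr_gt0 // divr_ge0 ?sqr_ge0 // mulr_ge0 ?v_ge0 // mulr_ge0 ?sqr_ge0.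
  have sn : 0 < Num.sqrt (e n) by rewrite sqrtr_gt0.
  have t0 : 0 < eps n * K n by rewrite mulr_gt0 // divr_gt0 // sqrtr_gt0.
  have t2 : (eps n * K n) ^+ 2 = Num.sqrt (e n) * K n ^+ 2 / l n ^+ 2.
    by rewrite /eps exprMn expr_div_n sqr_sqrtr ?(ltW sn) // mulrAC.
  have : bad n <= v n / (eps n * K n) ^+ 2.
    rewrite /bad (eq_bigl (fun s : 'I__ => eps n * K n < `|s%:R - K n|)); last first.
      by move=> s; rewrite /good -ltNge.
    exact: bounded_law_chebyshev.
  rewrite t2 -(ler_pM2l n0) => /le_trans -> //.
  have -> : n%:R * (v n / (Num.sqrt (e n) * K n ^+ 2 / l n ^+ 2)) =
      v n * (n%:R * l n ^+ 2) / K n ^+ 2 / Num.sqrt (e n).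
    by field; rewrite ?gt_eqF.
  by rewrite ler_pdivrMr // -expr2 sqr_sqrtr ?(ltW en) // lerDl invr_ge0 ltW.
have sqrt_cvg0 (u : nat -> R) : u @ \oo --> (0 : R) -> (fun n => Num.sqrt (u n)) @ \oo --> (0 : R).
  move=> u0; rewrite -(@sqrtr0 R); apply: continuous_cvg u0. exact: sqrt_continuous.
have bad_cvg0 : (fun n => n%:R * bad n) @ \oo --> (0 : R).
  apply: seq_squeeze0 (sqrt_cvg0 _ e_cvg0); apply: filterS bad_le => n le.
  by rewrite ger0_norm // mulr_ge0 // sumr_ge0.
pose delta n := conditioned (P n) (w n) (good n).
have G_gt0 : \forall n \near \oo, 0 < \sum_(s < (P n).+1 | good n s) w n s.
  near=> n; have lt1 : n%:R * bad n < 1 by near: n; exact: seq_near_lt bad_cvg0 ltr01.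
  have n1 : 1 <= n%:R :> R by rewrite ler1n; near: n; exists 1%N.
  have b0 : 0 <= bad n by rewrite sumr_ge0.
  have : bad n <= n%:R * bad n by rewrite ler_peMl.
  have := w1 n; rewrite (bigID (fun s : 'I__ => good n s)) /= -/(bad n) => E le.
  rewrite -(addrK (bad n) (\sum_(_ < _ | _) _)) E subr_gt0.
  exact: le_lt_trans lt1.
have KP : \forall n \near \oo, K n ^+ 2 / (P n)%:R =
    (l n + (k.-1)%:R * ln (l n) + alpha n) / n%:R.
  by exists 2%N => // n; apply: alphaE.
have eps_ge0 n : 0 <= eps n.
  (* At [n = 0] both [ln] and the inverse take their default value 0. *)
  case: n => [|n]; first by rewrite /eps /l ln0 // invr0 mulr0.
  by rewrite divr_ge0 ?sqrtr_ge0 // ln_ge0 // ler1n.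
have eps_l : (fun n => eps n * l n) @ \oo --> (0 : R).
  apply: seq_eq (sqrt_cvg0 _ (sqrt_cvg0 _ e_cvg0)); near=> n.
  by rewrite /eps divfK // gt_eqF //; near: n.
have alpha_l : (fun n => alpha n / l n) @ \oo --> (0 : R).
  apply/cvgrPdist_le => x x0; near=> n.
  have ln0 : 0 < l n by near: n.
  have : `|(`|alpha n|)| <= x * `|l n| by near: n; exact: (eqo_near alpha_o x0).
  by rewrite normr_id sub0r normrN normrM normfV -ler_pdivrMr ?normr_gt0 ?gt_eqF.
have delta_law : \forall n \near \oo, [/\ forall s, 0 <= delta n s,
    \sum_(s < (P n).+1) delta n s = 1 &
    forall s, 0 < delta n s -> (1 - eps n) * K n <= s%:R <= (1 + eps n) * K n].
  apply: filterS G_gt0 => n G0; split.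
  - by move=> s; apply: conditioned_ge0.
  - exact: conditioned_sum1.
  - by move=> s /conditioned_good; rewrite /good ler_distl !mulrDl !mul1r mulNr.
have [ninf pinf fin] := k_connected_cvg k_gt0 P_gt0 KP c_gt0 Kc eps_ge0 eps_l alpha_l delta_law.
have dist0 : (fun n => q n (size_biased (w n)) - q n (size_biased (delta n))) @ \oo --> (0 : R).
  apply: seq_squeeze0 bad_cvg0; apply: filterS G_gt0 => n G0.
  exact: conditioned_dist.
have transfer (x : R) : (fun n => q n (size_biased (delta n))) @ \oo --> x -> p @ \oo --> x%:E.
  move=> qx; rewrite (_ : p = (fun n => (q n (size_biased (w n)))%:E)); last by apply/funext.
  apply: cvg_EFin; first exact: nearW.
  rewrite -[x]addr0; apply: seq_eq (seq_add qx dist0); near=> n; rewrite /= addrC subrK.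
  by [].
split=> [al|al|a al]; apply: transfer.
- exact: ninf.
- exact: pinf.
- exact: fin.
Unshelve. all: by end_near. Qed.
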